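(* Let $A$ be a ring (possibly non-associative, non-commutative, and non-unitary). Assume that $A$ is finitely generated as an abelian group. Let $A^2$ denote the additive subgroup of $A$ generated by all products $xy$ with $x,y\in A$. If $A^2$ is infinite, then there exists a ring of algebraic integers $O$ such that $(O;\mathcal{L}_{\mathrm{ring}})$ is e-interpretable in $(A;\mathcal{L}_{\mathrm{ring}})$, and the Diophantine problem $\mathcal{D}(O;\mathcal{L}_{\mathrm{ring}})$ is Karp-reducible to $\mathcal{D}(A;\mathcal{L}_{\mathrm{ring}})$. If otherwise $A^2$ is finite, then $\mathcal{D}(A;\mathcal{L}_{\mathrm{ring}})$ is decidable.
   Context: A ring here is an abelian group with a biadditive multiplication; no associativity, commutativity or identity is assumed unless stated. A ring of algebraic integers is the integral closure of $\mathbb{Z}$ in a number field (a finite extension of $\mathbb{Q}$). The language of rings is $\mathcal{L}_{\mathrm{ring}}=(+,\cdot)$; $(S;\mathcal{L})$ means $S$ considered as a structure in the language $\mathcal{L}$. Equations. A (possibly multi-sorted) structure $\mathcal{M}$ has sorts, functions and relations, always including equality on each sort. An equation in $\mathcal{M}$ is an atomic formula $r(\tau_1,\dots,\tau_k)$ where $r$ is a signature relation (typically equality) and the $\tau_i$ are terms in which any elements of $\mathcal{M}$ may be used as constants (coefficients). A system of equations is a finite conjunction of equations. The Diophantine problem $\mathcal{D}(\mathcal{M})$ is the algorithmic problem of deciding whether a given system of equations in $\mathcal{M}$ has a solution in $\mathcal{M}$ (coefficients range over the whole structure, or over a suitable computable subset if the structure is not countable). A problem $P_1$ is Karp-reducible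 to $P_2$ if a polynomial-time algorithm transforms inputs of $P_1$ into inputs of $P_2$ with the same answer. E-interpretability. A basic set of $\mathcal{M}$ is a finite Cartesian product of sorts of $\mathcal{M}$. A subset $X$ of a basic set $M$ is e-definable in $\mathcal{M}$ if there is a system of equations $\Sigma(\mathbf{x},\mathbf{y})$ such that for all $\mathbf{a}\in M$: $\mathbf{a}\in X$ iff $\Sigma(\mathbf{a},\mathbf{y})$ has a solution $\mathbf{y}$ in $\mathcal{M}$. A structure $\mathcal{A}$ with sorts $A_i$ is e-interpretable in $\mathcal{M}$ if for each $i$ there are a basic set $M(A_i)$ of $\mathcal{M}$, an e-definable subset $X_i\subseteq M(A_i)$ and a surjective map $\phi_i:X_i\to A_i$ such that for each function and relation in the signature of $\mathcal{A}$ (including equality on each sort), the preimage of its graph under $(\phi_i)_i$ is e-definable in $\mathcal{M}$. *)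

(* Defs.v *)
From HB Require Import structures.
From mathcomp Require Import all_boot all_order all_algebra all_field.
From mathcomp Require Import boolp classical_sets cardinality.

Set Implicit Arguments.
Unset Strict Implicit.
Unset Printing Implicit Defensive.

Import GRing.Theory.
Local Open Scope classical_set_scope.
Local Open Scope ring_scope.

Record naRing : Type := NaRing {
  na_sort :> zmodType;
  na_mul : na_sort -> na_sort -> na_sort;
  na_mulDl : left_distributive na_mul +%R;
  na_mulDr : right_distributive na_mul +%R
}.

Definition naRing_of (R : pzRingType) : naRing :=
  @NaRing R *%R (@mulrDl R) (@mulrDr R).

Definition int_comb (A : zmodType) (m : nat) (gs : m.-tuple A)
    (c : m.-tuple int) : A :=
  \sum_(i < m) tnth gs i *~ tnth c i.

Definition generates (A : zmodType) (m : nat) (gs : m.-tuple A) : Prop :=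
  forall x : A, exists c : m.-tuple int, x = int_comb gs c.

Definition fin_gen (A : zmodType) : Prop :=
  exists (m : nat) (gs : m.-tuple A), generates gs.

Definition is_subgroup (A : zmodType) (H : set A) : Prop :=
  H 0 /\ forall x y, H x -> H y -> H (x - y).

Definition square (A : naRing) : set A :=
  smallest (@is_subgroup A) [set z | exists x y : A, z = na_mul x y].

Definition algint (K : fieldExtType rat) : {pred K} :=
  fun x => `[< integralOver (intr : int -> K) x >].
Arguments algint : clear implicits.

Fact algint_subring (K : fieldExtType rat) : subring_closed (algint K).
Proof.
split=> [|x y|x y]; rewrite ?unfold_in.
- by apply/asboolP; apply: integral1.
- by move=> /asboolP hx /asboolP hy; apply/asboolP; apply: integral_sub.
- by move=> /asboolP hx /asboolP hy; apply/asboolP; apply: integral_mul.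
Qed.

HB.instance Definition _ (K : fieldExtType rat) :=
  GRing.isSubringClosed.Build K (algint K) (@algint_subring K).

Record ringOfIntegers (K : fieldExtType rat) : Type := RingOfIntegers {
  roi_val :> K;
  roi_valP : roi_val \in algint K
}.

HB.instance Definition _ (K : fieldExtType rat) :=
  [isSub for @roi_val K].
HB.instance Definition _ (K : fieldExtType rat) :=
  [Choice of ringOfIntegers K by <:].
HB.instance Definition _ (K : fieldExtType rat) :=
  [SubChoice_isSubComNzRing of ringOfIntegers K by <:].

(* The constants of the terms range over [C]: either the ring itself, or the
   finite codes of its elements when systems are given as input data. *)
Inductive term (C : Type) : Type :=
  | TVar of nat
  | TCst of C
  | TAdd of term C & term C
  | TMul of term C & term C.
Arguments TVar {C}.

Definition system (C : Type) : Type := seq (term C * term C).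

Fixpoint eval (C : Type) (A : naRing) (val : C -> A) (v : nat -> A)
    (t : term C) : A :=
  match t with
  | TVar i => v i
  | TCst c => val c
  | TAdd t1 t2 => eval val v t1 + eval val v t2
  | TMul t1 t2 => na_mul (eval val v t1) (eval val v t2)
  end.

Definition satisfies (C : Type) (A : naRing) (val : C -> A) (v : nat -> A)
    (S : system C) : Prop :=
  foldr (fun e P => eval val v e.1 = eval val v e.2 /\ P) True S.

Definition solvable (C : Type) (A : naRing) (val : C -> A) (S : system C) :
    Prop :=
  exists v : nat -> A, satisfies val v S.

(* The variables 0, ..., n - 1 of the system are the free variables x; all the
   others are the existentially quantified variables y. *)
Definition e_definable (A : naRing) (n : nat) (X : set (n.-tuple A)) : Prop :=
  exists S : system A, forall a : n.-tuple A,
    X a <-> exists v : nat -> A,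
      (forall i : 'I_n, v i = tnth a i) /\ satisfies id v S.

(* Both structures, in the signature of +, * and =, have one sort, so
   a basic set of A is a power of A. Only the restriction of [phi] to [X]
   matters. *)
Definition e_interpretable (B A : naRing) : Prop :=
  exists (n : nat) (X : set (n.-tuple A)) (phi : n.-tuple A -> B),
    [/\ e_definable X,
        (forall b : B, exists2 x, X x & phi x = b),
        e_definable [set w : (n + n).-tuple A | exists x y : n.-tuple A,
          [/\ X x, X y, w = [tuple of x ++ y] & phi x = phi y]],
        e_definable [set w : (n + (n + n)).-tuple A |
          exists x y z : n.-tuple A,
          [/\ X x, X y, X z, w = [tuple of x ++ (y ++ z)]
            & phi x + phi y = phi z]]
      & e_definable [set w : (n + (n + n)).-tuple A |
          exists x y z : n.-tuple A,
          [/\ X x, X y, X z, w = [tuple of x ++ (y ++ z)]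
            & na_mul (phi x) (phi y) = phi z]]].

Inductive symbol : Type :=
  | SZero | SOne | SPos | SNeg | SCst | SVar | SAdd | SMul | SEqn.

Definition word : Type := seq symbol.

(* Structured programs for a machine with stacks over the alphabet [symbol].
   A program mentions finitely many stacks, and a test is a table over the
   finite type [option symbol] applied to the top of one stack ([None] when it
   is empty). Two stacks make a tape, and conversely each step is a bounded
   number of steps of a multitape Turing machine, so the running times are
   those of Turing machines up to a constant factor. *)
Inductive program : Type :=
  | Skip
  | Push of nat & symbol
  | Pop of nat
  | Seq of program & program
  | If of nat & (option symbol -> bool) & program & program
  | While of nat & (option symbol -> bool) & program.

Definition store : Type := nat -> word.

Definition upd (s : store) (r : nat) (w : word) : store :=
  fun r' => if r' == r then w else s r'.

(* [exec p s s' t]: started in [s], [p] halts in [s'] after [t] steps. *)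
Inductive exec : program -> store -> store -> nat -> Prop :=
  | ExecSkip s : exec Skip s s 1
  | ExecPush r a s : exec (Push r a) s (upd s r (a :: s r)) 1
  | ExecPop r s : exec (Pop r) s (upd s r (behead (s r))) 1
  | ExecSeq p q s1 s2 s3 t u :
      exec p s1 s2 t -> exec q s2 s3 u -> exec (Seq p q) s1 s3 (t + u)%N
  | ExecIf r (g : option symbol -> bool) p q s s' t :
      exec (if g (ohead (s r)) then p else q) s s' t ->
      exec (If r g p q) s s' t.+1
  | ExecWhileEnd r (g : option symbol -> bool) p s :
      ~~ g (ohead (s r)) -> exec (While r g p) s s 1
  | ExecWhileStep r (g : option symbol -> bool) p s1 s2 s3 t u :
      g (ohead (s1 r)) -> exec p s1 s2 t -> exec (While r g p) s2 s3 u ->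
      exec (While r g p) s1 s3 (t + u).+1.

(* Input and output are on stack 0, read from the top. *)
Definition computes (p : program) (w w' : word) (t : nat) : Prop :=
  exists s : store, exec p (upd (fun=> [::]) 0 w) s t /\ s 0%N = w'.

Record problem : Type := Problem {
  instance : Type;
  encode : instance -> word;
  positive : instance -> Prop
}.

Definition decidable_problem (P : problem) : Prop :=
  exists p : program, forall x : instance P, exists (b : bool) (t : nat),
    computes p (encode x) [:: if b then SOne else SZero] t /\
    (positive x <-> b).

Definition karp_reducible (P Q : problem) : Prop :=
  exists (p : program) (c d : nat), forall x : instance P,
    exists (y : instance Q) (t : nat),
    [/\ computes p (encode x) (encode y) t,
        (t <= c * (size (encode x)).+1 ^ d)%N
      & positive x <-> positive y].

(* Binary digits, least significant first. *)
Fixpoint encode_pos (p : BinNums.positive) : word :=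
  match p with
  | BinNums.xH => [:: SOne]
  | BinNums.xO p => SZero :: encode_pos p
  | BinNums.xI p => SOne :: encode_pos p
  end.

Definition encode_nat (n : nat) : word :=
  if bin_of_nat n is BinNums.Npos p then encode_pos p else [::].

Definition encode_int (z : int) : word :=
  (if 0 <= z then SPos else SNeg) :: encode_nat `|z|%N.

(* Terms in prefix notation. A constant is the list of its integer coordinates
   with respect to a fixed generating tuple, in binary; the index of a variable,
   which is only a name, is written in unary. *)
Fixpoint encode_term (m : nat) (t : term (m.-tuple int)) : word :=
  match t with
  | TVar i => SVar :: nseq i SOne
  | TCst c => SCst :: flatten (map encode_int c)
  | TAdd t1 t2 => SAdd :: encode_term t1 ++ encode_term t2
  | TMul t1 t2 => SMul :: encode_term t1 ++ encode_term t2
  end.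

Definition encode_system (m : nat) (S : system (m.-tuple int)) : word :=
  flatten [seq SEqn :: encode_term e.1 ++ encode_term e.2 | e <- S].

(* The coefficients are given by their coordinates with respect to [gs], which
   need not be unique. *)
Definition diophantine (A : naRing) (m : nat) (gs : m.-tuple A) : problem :=
  {| instance := system (m.-tuple int);
     encode := @encode_system m;
     positive := solvable (int_comb gs) |}.

(* Main.v *)
From HB Require Import structures.
Require Import Defs.
From mathcomp Require Import all_boot all_order all_algebra all_field.
From mathcomp Require Import boolp classical_sets cardinality.
From mathcomp Require Import perm spectral zify ring.

(* Let A be generated by a_1, ..., a_m. A scalar is a pair of families b, c of
   elements of A with b_i a_j = a_i c_j for which a_i a_j |-> b_i a_j is a well
   defined endomorphism of A^2; scalars form an e-definable set, and their
   endomorphisms commute. If A^2 is infinite, the scalars have a common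
   eigenvector in Hom(A^2, C), hence a character lambda onto an order D of a number
   field K. An ideal q of D has finitely many generators over Z, so that
   "lambda(z) belongs to q" is a system of equations z.b_i a_j =
   sum_k t_k.b_i s_k.c_j in scalars t_k, with fixed s_k. As N O is an ideal of D
   for some N > 0, O is e-interpreted by dividing by N. This interpretation is
   additive, so constants can be written with their given binary coordinates,
   and the reduction replaces each variable and each subterm by a block of
   variables.

   If A^2 is finite, it is killed by the exponent E of the torsion of A, so that
   adding multiples of E to the variables changes the equations affinely, with
   the matrix of occurrences of the variables outside products. Bounding its
   minors gives an explicit modulus M, a multiple of E, such that a system which
   is solvable modulo M A is solvable. Finitely many assignments of residues
   have to be tried. *)

Set Implicit Arguments.
Unset Strict Implicit.
Unset Printing Implicit Defensive.

(** * Word functions computed by stack programs *)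

(** The scalars commute because each acts through left factors and through right factors at once,
    and actions on different factors commute. The same remark makes multiplication expressible:
    [b_i] of one scalar times [c_j] of another is the value of the composite at [a_i a_j], so no
    coordinates of scalars are needed. Lambda may have a kernel, and then equality of scalars is too
    strong; the kernel is the case q = 0 of the description of ideals, and every equation between
    scalars is taken up to an unknown summand in it. In that description the coefficients ought to
    be integers, over which equations in [A] cannot quantify; scalars replace them, as they do not
    lead out of an ideal. In the finite case a solution modulo M is shifted by multiples of E until
    a maximal independent set of equations holds exactly. In each other equation the free
    coordinates of the remaining defect are multiples of a large number but bounded by a smaller
    one. The programs have two uses, a polynomial-time reduction and an exhaustive search that only
    has to be computable; one set of lemmas covers both. *)

Definition polym (P : nat -> nat) : Prop :=
  {homo P : m n / m <= n} /\ exists c d, forall n, P n <= c * n.+1 ^ d.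

Lemma polym_const c : polym (fun=> c).
Proof. by split=> //; exists c, 0 => n; rewrite expn0 muln1. Qed.

Lemma polym_id : polym id.
Proof. by split=> //; exists 1, 1 => n; rewrite mul1n expn1. Qed.

Lemma polym_add P Q : polym P -> polym Q -> polym (fun n => P n + Q n).
Proof.
move=> [mP [c [d hP]]] [mQ [c' [d' hQ]]]; split=> [m n mn|].
  by rewrite leq_add ?mP ?mQ.
exists (c + c'), (d + d') => n; rewrite mulnDl leq_add //.
  by rewrite (leq_trans (hP n)) // leq_mul2l leq_pexp2l ?orbT // leq_addr.
by rewrite (leq_trans (hQ n)) // leq_mul2l leq_pexp2l ?orbT // leq_addl.
Qed.

Lemma polym_mul P Q : polym P -> polym Q -> polym (fun n => P n * Q n).
Proof.
move=> [mP [c [d hP]]] [mQ [c' [d' hQ]]]; split=> [m n mn|].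
  by rewrite leq_mul ?mP ?mQ.
by exists (c * c'), (d + d') => n; rewrite expnD mulnACA leq_mul.
Qed.

(** Replacing the inner function by its bound needs a monotone outer function; this is why [polym]
    includes monotonicity. *)
Lemma polym_comp P Q : polym P -> polym Q -> polym (fun n => P (Q n)).
Proof.
move=> [mP [c [d hP]]] [mQ [c' [d' hQ]]]; split=> [m n mn|].
  by rewrite mP ?mQ.
exists (c * c'.+1 ^ d), (d' * d) => n; apply: leq_trans (hP _) _.
rewrite -mulnA leq_mul2l expnM -expnMn; apply/orP; right.
have [->|d_gt0] := posnP d; first by rewrite !expn0.
by rewrite leq_exp2r // mulSn -addn1 addnC leq_add // expn_gt0.
Qed.

Lemma polym_succ P : polym P -> polym (fun n => (P n).+1).
Proof.
by move=> mP; under eq_fun do rewrite -addn1; apply: polym_add => //;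
  exact: polym_const.
Qed.

Ltac polym_auto := by do ?[exact: polym_const | exact: polym_id | assumption
  | apply: polym_mul | apply: polym_add | apply: polym_succ].

Definition st (e : seq word) : store := nth [::] e.

Lemma upd_st k (e l : seq word) i w :
  size e = k -> upd (st (e ++ l)) (k + i) w = st (e ++ set_nth [::] l i w).
Proof.
move=> <-; apply/funext=> j; rewrite /upd /st !nth_cat nth_set_nth /=.
case: (ltnP j (size e)) => hj; first by rewrite ltn_eqF // ltn_addr.
by rewrite -{1}(subnKC hj) eqn_add2l.
Qed.

Lemma st_nth k (e l : seq word) i :
  size e = k -> st (e ++ l) (k + i) = nth [::] l i.
Proof.
by move=> <-; rewrite /st nth_cat ltnNge leq_addr /= addKn.
Qed.

Lemma st_trim (e l : seq word) : st (e ++ l) = st (e ++ rcons l [::]).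
Proof.
by rewrite -rcons_cat; apply/funext=> i; rewrite /st nth_rcons_default.
Qed.

(** The time bound is claimed only under [B]. With [B := True] the lemmas below yield
    polynomial-time programs; with [B := False] all conditions on time and growth are vacuous and
    the same lemmas yield plain computability. *)
Definition run (B : Prop) p s s' (T : nat) : Prop :=
  exists2 t, exec p s s' t & B -> t <= T.

Section Run.
Variable B : Prop.

Lemma run_le p s s' T U : (B -> T <= U) -> run B p s s' T -> run B p s s' U.
Proof.
by move=> TU [t ht hT]; exists t => // b; apply: leq_trans (hT b) (TU b).
Qed.

Lemma run_seq p q s1 s2 s3 T U :
  run B p s1 s2 T -> run B q s2 s3 U -> run B (Seq p q) s1 s3 (T + U).
Proof.
move=> [t ht hT] [u hu hU]; exists (t + u); first exact: ExecSeq hu.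
by move=> b; rewrite leq_add ?hT ?hU.
Qed.

Lemma run_if r g p q s s' T :
  run B (if g (ohead (s r)) then p else q) s s' T ->
  run B (If r g p q) s s' T.+1.
Proof. by move=> [t ht hT]; exists t.+1; [exact: ExecIf | exact: hT]. Qed.

Lemma run_while_end r (g : option symbol -> bool) p s :
  ~~ g (ohead (s r)) -> run B (While r g p) s s 1.
Proof. by exists 1; first exact: ExecWhileEnd. Qed.

Lemma run_while_step r (g : option symbol -> bool) p s1 s2 s3 T U :
  g (ohead (s1 r)) -> run B p s1 s2 T -> run B (While r g p) s2 s3 U ->
  run B (While r g p) s1 s3 (T + U).+1.
Proof.
move=> hg [t ht hT] [u hu hU]; exists (t + u).+1; first exact: ExecWhileStep hu.
by move=> b; rewrite ltnS leq_add ?hT ?hU.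
Qed.

Lemma run_push r a s : run B (Push r a) s (upd s r (a :: s r)) 1.
Proof. by exists 1; first exact: ExecPush. Qed.

Lemma run_pop r s : run B (Pop r) s (upd s r (behead (s r))) 1.
Proof. by exists 1; first exact: ExecPop. Qed.

Definition symbol_code a :=
  match a with
  | SZero => 0 | SOne => 1 | SPos => 2 | SNeg => 3 | SCst => 4
  | SVar => 5 | SAdd => 6 | SMul => 7 | SEqn => 8
  end.

Definition symbol_eq a b := symbol_code a == symbol_code b.

Definition is_sym a (o : option symbol) :=
  if o is Some b then symbol_eq a b else false.

Definition symbols :=
  [:: SZero; SOne; SPos; SNeg; SCst; SVar; SAdd; SMul; SEqn].

(** A test has two outcomes, so the branching on a symbol is a chain of nine tests, whence the [9]
    in [run_case]. *)
Definition case_prog r (F : symbol -> program) :=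
  foldr (fun a p => If r (is_sym a) (F a) p) Skip symbols.

Lemma run_case r F s s' T a :
  ohead (s r) = Some a -> run B (F a) s s' T ->
  run B (case_prog r F) s s' (T + 9).
Proof.
move=> ha hF; rewrite /case_prog /=.
by case: a ha hF => ha [t ht hT]; (eexists;
  [ do ?[apply: ExecIf; rewrite ha /=]; exact: ht | move=> b;
    rewrite addnC -addn1; move: (hT b); lia]).
Qed.

Definition nonempty (o : option symbol) : bool := o.

Definition clear r := While r nonempty (Pop r).

Definition rev_move r q :=
  While r nonempty (case_prog r (fun a => Seq (Push q a) (Pop r))).

Definition move r q z := Seq (rev_move r z) (rev_move z q).

(** Reading a stack destroys it, so the second pass restores [r] while it fills [q]. *)
Definition copy r q z :=
  Seq (rev_move r z)
    (While z nonempty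
       (case_prog z (fun a => Seq (Push r a) (Seq (Push q a) (Pop z))))).

Lemma upd_same s r : upd s r (s r) = s.
Proof. by apply/funext=> i; rewrite /upd; case: eqP => [->|]. Qed.

Lemma upd_twice s r w w' : upd (upd s r w) r w' = upd s r w'.
Proof. by apply/funext=> i; rewrite /upd; case: eqP. Qed.

Lemma upd_at s r w : upd s r w r = w.
Proof. by rewrite /upd eqxx. Qed.

Lemma upd_ne s r r' w : r' != r -> upd s r w r' = s r'.
Proof. by rewrite /upd => /negPf ->. Qed.

Lemma run_clear s r : run B (clear r) s (upd s r [::]) (2 * (size (s r)).+1).
Proof.
move E: (s r) => w; elim: w s E => [|a w IH] s E.
  rewrite -E upd_same; apply: run_le (run_while_end _ _) => //.
  by rewrite E.
have := IH (upd s r w); rewrite upd_at upd_twice => /(_ erefl) H.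
apply: (@run_le _ _ _ (1 + 2 * (size w).+1).+1); first by move=> _ /=; lia.
by apply: run_while_step (run_pop r s) _; rewrite E.
Qed.

Lemma run_rev_move s r q : r != q ->
  run B (rev_move r q) s (upd (upd s r [::]) q (catrev (s r) (s q)))
    (13 * (size (s r)).+1).
Proof.
move=> rq; move E: (s r) => w; elim: w s E => [|a w IH] s E.
  rewrite -E upd_same /= E /= upd_same.
  by apply: run_le (run_while_end _ _) => //; rewrite E.
pose s1 := upd s q (a :: s q).
have E1 : s1 r = a :: w by rewrite /s1 upd_ne.
have := IH (upd s1 r w); rewrite upd_at => /(_ erefl) H.
apply: (@run_le _ _ _ (2 + 9 + 13 * (size w).+1).+1).
  by move=> _ /=; lia.
apply: (@run_while_step _ _ _ _ (upd s1 r w)); first by rewrite E.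
  apply: (@run_case _ _ _ _ _ a); first by rewrite E.
  apply: (@run_seq _ _ _ s1 _ 1 1); first exact: run_push.
  by have := run_pop r s1; rewrite E1.
have -> : upd (upd s r [::]) q (catrev (a :: w) (s q)) =
    upd (upd (upd s1 r w) r [::]) q (catrev w (upd s1 r w q)).
  apply/funext=> i; rewrite /s1 /upd eqxx (eq_sym q) (negPf rq).
  by case: (i =P q) => // _; case: (i =P r).
exact: H.
Qed.

Lemma run_move s r q z : r != q -> r != z -> q != z -> s z = [::] ->
  run B (move r q z) s (upd (upd s r [::]) q (s r ++ s q))
    (26 * (size (s r)).+1).
Proof.
move=> rq rz qz sz.
have H1 := run_rev_move s rz; rewrite sz in H1.
have H2 : z != q by rewrite eq_sym.
have := run_rev_move (upd (upd s r [::]) z (catrev (s r) [::])) H2.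
rewrite upd_at upd_twice upd_ne // upd_ne 1?eq_sym // => H3.
have := run_seq H1 H3; rewrite (catrevE (s r) [::]) cats0 size_rev.
rewrite (catrevE (rev _)) revK.
have -> : upd (upd s r [::]) z [::] = upd s r [::].
  by rewrite -[in RHS](upd_same (upd s r [::]) z) upd_ne 1?eq_sym // sz.
by apply: run_le => _; lia.
Qed.

Lemma run_copy s r q z : r != q -> r != z -> q != z ->
  s z = [::] -> s q = [::] ->
  run B (copy r q z) s (upd s q (s r)) (30 * (size (s r)).+1).
Proof.
move=> rq rz qz sz sq.
have H1 := run_rev_move s rz; rewrite sz catrevE cats0 in H1.
suff H2 w s1 : s1 z = w ->
    run B (While z nonempty
       (case_prog z (fun a => Seq (Push r a) (Seq (Push q a) (Pop z)))))
     s1 (upd (upd (upd s1 r (catrev w (s1 r))) q (catrev w (s1 q))) z [::])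
     (13 * (size w).+1).
  have := H2 (rev (s r)) (upd (upd s r [::]) z (rev (s r))).
  rewrite upd_at => /(_ erefl).
  rewrite !catrevE revK (upd_ne _ _ rz) upd_at cats0 upd_ne // upd_ne 1?eq_sym //.
  rewrite sq cats0 size_rev => H3.
  have := run_seq H1 H3.
  set s' := upd _ z [::]; have -> : s' = upd s q (s r).
    apply/funext=> i; rewrite /s' /upd; case: (i =P z) => [->|_].
      by rewrite eq_sym (negPf qz) sz.
    by case: (i =P q) => // _; case: (i =P r) => [->|].
  by apply: run_le => _; lia.
elim: w s1 => [|a w IH] s1 E.
  rewrite /= !upd_same -E upd_same.
  by apply: run_le (run_while_end _ _) => //; rewrite E.
pose s2 := upd (upd (upd s1 r (a :: s1 r)) q (a :: s1 q)) z w.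
apply: (@run_le _ _ _ ((1 + (1 + 1)) + 9 + 13 * (size w).+1).+1).
  by move=> _ /=; lia.
have := IH s2; rewrite /s2 upd_at => /(_ erefl) H.
apply: (@run_while_step _ _ _ _ s2); first by rewrite E.
  apply: (@run_case _ _ _ _ _ a); first by rewrite E.
  apply: run_seq (run_push _ _ _) _.
  have := run_push q a (upd s1 r (a :: s1 r)).
  rewrite upd_ne 1?eq_sym // => K1; apply: run_seq K1 _.
  have := run_pop z (upd (upd s1 r (a :: s1 r)) q (a :: s1 q)).
  by rewrite upd_ne 1?eq_sym // upd_ne 1?eq_sym // E.
move: H; congr run; apply/funext=> i; rewrite /upd.
case: (i =P z) => // _; case: (i =P q) => [_|_].
  by rewrite (negPf qz) eqxx.
by case: (i =P r) => // _; rewrite (negPf rz) (negPf rq) eqxx.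
Qed.

End Run.

(** * Relocation of programs to other stacks *)

Fixpoint rename (rho : nat -> nat) p :=
  match p with
  | Skip => Skip
  | Push r a => Push (rho r) a
  | Pop r => Pop (rho r)
  | Seq p q => Seq (rename rho p) (rename rho q)
  | If r g p q => If (rho r) g (rename rho p) (rename rho q)
  | While r g p => While (rho r) g (rename rho p)
  end.

(** Injectivity keeps the stacks of the program apart, so the run can be followed step by step
    inside a larger store, whose other stacks are not touched. *)
Lemma exec_rename rho p s s' t : injective rho -> exec p s s' t ->
  forall S, (forall r, S (rho r) = s r) ->
  exists S', [/\ exec (rename rho p) S S' t, forall r, S' (rho r) = s' r
    & forall r, (forall r', rho r' <> r) -> S' r = S r].
Proof.
move=> rho_inj; elim=> {p s s' t} /=.
- by move=> s S hS; exists S; split=> //; exact: ExecSkip.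
- move=> r a s S hS; exists (upd S (rho r) (a :: S (rho r))).
  split=> [|q|q hq]; [exact: ExecPush | |].
    by rewrite /upd (inj_eq rho_inj) !hS.
  by rewrite upd_ne //; apply/eqP => /esym; apply: hq.
- move=> r s S hS; exists (upd S (rho r) (behead (S (rho r)))).
  split=> [|q|q hq]; [exact: ExecPop | |].
    by rewrite /upd (inj_eq rho_inj) !hS.
  by rewrite upd_ne //; apply/eqP => /esym; apply: hq.
- move=> p q s1 s2 s3 t u _ IHp _ IHq S hS.
  have [S2 [e2 h2 k2]] := IHp S hS; have [S3 [e3 h3 k3]] := IHq S2 h2.
  exists S3; split=> [|//|r hr]; first exact: ExecSeq e2 e3.
  by rewrite k3 ?k2.
- move=> r g p q s s' t _ IH S hS.
  have [S' [e' h' k']] := IH S hS; exists S'; split=> //.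
  by apply: ExecIf; rewrite hS; case: (g _) e'.
- move=> r g p s hg S hS; exists S; split=> //.
  by apply: ExecWhileEnd; rewrite hS.
- move=> r g p s1 s2 s3 t u hg _ IHp _ IHq S hS.
  have [S2 [e2 h2 k2]] := IHp S hS; have [S3 [e3 h3 k3]] := IHq S2 h2.
  exists S3; split=> [|//|q hq]; last by rewrite k3 ?k2.
  by apply: ExecWhileStep e2 e3; rewrite hS.
Qed.

(** * Computable functions of several words *)

Definition total (e : seq word) : nat := sumn (map size e).

Lemma total_cat e l : total (e ++ l) = total e + total l.
Proof. by rewrite /total map_cat sumn_cat. Qed.

Lemma total_take k e : total (take k e) <= total e.
Proof. by rewrite -{2}(cat_take_drop k e) total_cat leq_addr. Qed.

Lemma size_nth_total (e : seq word) i : size (nth [::] e i) <= total e.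
Proof.
elim: e i => [|w e IH] [|i] //=; rewrite /total /= ?leq_addr //.
exact: leq_trans (IH i) (leq_addl _ _).
Qed.

(* The variables are the stacks [0, ..., k - 1]; the stacks from [k] on are
   empty before and, except for the result on stack [k], after the run. *)
Definition cmp (B : Prop) (k : nat) (f : seq word -> word) : Prop :=
  exists p P, polym P /\ forall e, size e = k ->
    run B p (st e) (st (rcons e (f e))) (P (total e)).

(** One step pushes at most one symbol. Hence a time bound is also a bound on the output, which is
    what composition of programs needs. *)
Lemma exec_size p s s' t r : exec p s s' t -> size (s' r) <= size (s r) + t.
Proof.
elim=> {p s s' t} //=.
- by move=> s; rewrite leq_addr.
- by move=> q a s; rewrite /upd; case: eqP => [->|_] /=; lia.
- by move=> q s; rewrite /upd; case: eqP => [->|_]; rewrite ?size_behead; lia.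
all: by move=> *; lia.
Qed.

Section Computable.
Variable B : Prop.

Lemma cmp_ext k f g : (forall e, size e = k -> f e = g e) ->
  cmp B k f -> cmp B k g.
Proof.
move=> fg [p [P [mP h]]]; exists p, P; split=> // e he.
by rewrite -fg //; apply: h.
Qed.

Lemma run_result_size p e w T : B ->
  run B p (st e) (st (rcons e w)) T -> size w <= T.
Proof.
move=> b [t /(@exec_size _ _ _ _ (size e)) ht hT]; apply: leq_trans (hT b).
by move: ht; rewrite /st nth_rcons ltnn eqxx nth_default.
Qed.

Lemma cmp_size k f : cmp B k f -> exists2 P, polym P &
  forall e, B -> size e = k -> size (f e) <= P (total e).
Proof.
move=> [p [P [mP h]]]; exists P => // e b he.
exact: run_result_size (h e he).
Qed.

(** The stacks from [k] on, which the program uses as scratch space, are shifted to start at [k'],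
    so that the added variables are preserved. *)
Lemma cmp_weaken k k' f : k <= k' -> cmp B k f ->
  cmp B k' (fun e => f (take k e)).
Proof.
move=> kk [p [P [mP h]]].
pose rho r := if r < k then r else r + (k' - k).
have rho_inj : injective rho by move=> i j; rewrite /rho; do 2!case: ifP; lia.
exists (rename rho p), P; split=> // e he.
have hk : size (take k e) = k by rewrite size_takel ?he.
have [t ht hT] := h _ hk.
have [r|S [eS hS kS]] := exec_rename rho_inj ht (S := st e).
  rewrite /st /rho; case: (ltnP r k) => hr; first by rewrite nth_take.
  by rewrite !nth_default ?hk ?he //; lia.
exists t => [|b]; last first.
  by apply: leq_trans (hT b) _; apply: (proj1 mP); apply: total_take.
have -> : st (rcons e (f (take k e))) = S; last exact: eS.
apply/funext=> r; rewrite /st nth_rcons he.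
case: (ltnP r k) => rk.
  have := hS r; rewrite /rho rk => ->; rewrite /st nth_rcons hk rk nth_take //.
  by rewrite (leq_trans rk kk).
case: (ltnP r k') => rk'.
  rewrite kS // => r'; rewrite /rho; case: ifP; lia.
have -> : r = rho (r - (k' - k)) by rewrite /rho; case: ifP; lia.
rewrite hS /st nth_rcons hk /rho.
have -> : (r - (k' - k) < k) = false by lia.
have -> : (r - (k' - k) == k) = (r == k') by lia.
by rewrite subnK //; lia.
Qed.

Lemma cmp_nil k : cmp B k (fun=> [::]).
Proof.
exists Skip, (fun=> 1); split=> [|e he]; first exact: polym_const.
exists 1 => //; rewrite -cats1 -[[:: [::]]]/(rcons [::] [::]) -st_trim cats0.
exact: ExecSkip.
Qed.

Lemma cmp_cons a k f : cmp B k f -> cmp B k (fun e => a :: f e).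
Proof.
move=> [p [P [mP h]]]; exists (Seq p (Push (k + 0) a)), (fun n => P n + 1).
split=> [|e he]; first polym_auto.
apply: run_seq (h e he) _; have := run_push B (k + 0) a (st (rcons e (f e))).
by rewrite -!cats1 st_nth // upd_st.
Qed.

Lemma cmp_behead k f : cmp B k f -> cmp B k (fun e => behead (f e)).
Proof.
move=> [p [P [mP h]]]; exists (Seq p (Pop (k + 0))), (fun n => P n + 1).
split=> [|e he]; first polym_auto.
apply: run_seq (h e he) _; have := run_pop B (k + 0) (st (rcons e (f e))).
by rewrite -!cats1 st_nth // upd_st.
Qed.

Lemma cmp_nth k i : i < k -> cmp B k (fun e => nth [::] e i).
Proof.
move=> ik; exists (copy i (k + 0) (k + 1)), (fun n => 30 * (n + 1)).
split=> [|e he].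
  polym_auto.
apply: (@run_le _ _ _ _ (30 * (size (st e i)).+1)).
  by move=> _; rewrite addn1 leq_mul2l /= ltnS size_nth_total.
have hd j : st e (k + j) = [::] by rewrite /st nth_default ?he ?leq_addr.
have := @run_copy B (st e) i (k + 0) (k + 1).
rewrite !hd -{2}(cats0 e) upd_st //= cats1.
by apply=> //; lia.
Qed.

Lemma cmp_if (g : option symbol -> bool) k f f1 f2 :
  cmp B k f -> cmp B k f1 -> cmp B k f2 ->
  cmp B k (fun e => if g (ohead (f e)) then f1 e else f2 e).
Proof.
move=> [p [P [mP h]]] [p1 [P1 [mP1 h1]]] [p2 [P2 [mP2 h2]]].
exists (Seq p (If (k + 0) g (Seq (clear (k + 0)) p1) (Seq (clear (k + 0)) p2))).
exists (fun n => P n + (2 * (P n).+1 + (P1 n + P2 n)).+1); split=> [|e he].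
  polym_auto.
apply: run_seq (h e he) _; apply: run_if.
rewrite -cats1 st_nth //=.
have Hc : run B (clear (k + 0)) (st (e ++ [:: f e])) (st e)
    (2 * (P (total e)).+1).
  have := run_clear B (st (e ++ [:: f e])) (k + 0).
  rewrite upd_st //= st_nth //= -[[:: [::]]]/(rcons [::] [::]) -st_trim cats0.
  by apply: run_le => b; rewrite leq_mul2l /= ltnS (run_result_size b (h e he)).
rewrite !cats1 in Hc *; case: (g _); apply: run_seq Hc _.
- by apply: run_le (h1 e he) => _; rewrite leq_addr.
- by apply: run_le (h2 e he) => _; rewrite leq_addl.
Qed.

Lemma run_clear_st k e l i : size e = k ->
  run B (clear (k + i)) (st (e ++ l)) (st (e ++ set_nth [::] l i [::]))
    (2 * (size (nth [::] l i)).+1).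
Proof.
move=> he; have := run_clear B (st (e ++ l)) (k + i).
by rewrite upd_st // st_nth.
Qed.

Lemma run_rev_move_st k e l i j : size e = k -> i != j ->
  run B (rev_move (k + i) (k + j)) (st (e ++ l))
    (st (e ++ set_nth [::] (set_nth [::] l i [::]) j
                (catrev (nth [::] l i) (nth [::] l j))))
    (13 * (size (nth [::] l i)).+1).
Proof.
move=> he ij; have := @run_rev_move B (st (e ++ l)) (k + i) (k + j).
by rewrite eqn_add2l => /(_ ij); rewrite !upd_st // !st_nth.
Qed.

Lemma run_move_st k e l i j z : size e = k -> i != j -> i != z -> j != z ->
  nth [::] l z = [::] ->
  run B (move (k + i) (k + j) (k + z)) (st (e ++ l))
    (st (e ++ set_nth [::] (set_nth [::] l i [::]) j
                (nth [::] l i ++ nth [::] l j)))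
    (26 * (size (nth [::] l i)).+1).
Proof.
move=> he ij iz jz lz.
have := @run_move B (st (e ++ l)) (k + i) (k + j) (k + z).
by rewrite !eqn_add2l !st_nth // !upd_st //; apply.
Qed.

Fixpoint wrec (H : symbol -> word -> word -> word) (b w : word) : word :=
  if w is a :: w' then H a w' (wrec H b w') else b.

(** The recursion stays polynomial because a step lengthens the accumulator by an amount that does
    not depend on the accumulator; a step that doubled it would give exponential growth. The word is
    first reversed onto stack [k + 3], since the recursion starts at its end; the suffix already
    treated is rebuilt on stack [k], with the accumulator on [k + 1]. *)
Lemma cmp_rec k f g H (Q : nat -> nat) :
  cmp B k f -> cmp B k g -> (forall a, cmp B k.+2 (H a)) -> polym Q ->
  (forall a e w acc, B -> size e = k ->
     size (H a (e ++ [:: w; acc])) <= size acc + Q (total e + size w)) ->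
  cmp B k (fun e => wrec (fun a w acc => H a (e ++ [:: w; acc])) (g e) (f e)).
Proof.
move=> cf [pg [G [mG hg]]] cH mQ growth.
have [pf [F [mF hf]]] := cmp_weaken (leq_addl 2 k) cf.
have /choice[pP hpP] : forall a, exists pP : program * (nat -> nat),
    polym pP.2 /\ forall e, size e = k.+2.+2 ->
      run B pP.1 (st e) (st (rcons e (H a (take k.+2 e)))) (pP.2 (total e)).
  move=> a; have /(cmp_weaken (leq_addl 2 k.+2)) [p [P hpP]] := cH a.
  by exists (p, P).
pose PH n := sumn [seq (pP a).2 n | a <- symbols].
have mPH : polym PH.
  rewrite /PH; elim: symbols => [|a l IH] /=; first polym_auto.
  by apply: polym_add => //; case: (hpP a).
have hPH a n : (pP a).2 n <= PH n by rewrite /PH; case: a => /=; lia.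
pose body a := Seq (pP a).1 (Seq (clear (k + 1)) (Seq
  (move (k + 4) (k + 1) (k + 5)) (Seq (Push (k + 0) a) (Pop (k + 3))))).
pose loop := While (k + 3) nonempty (case_prog (k + 3) body).
exists (Seq pg (Seq (move (k + 0) (k + 1) (k + 2)) (Seq pf (Seq
  (rev_move (k + 2) (k + 3)) (Seq loop (Seq (clear (k + 0))
  (move (k + 1) (k + 0) (k + 2)))))))).
(* [X] bounds the word recursed on, [A] every accumulator, and [C] the cost of one iteration. *)
pose X n := F (n + G n).
pose A n := G n + X n * Q (n + X n).
pose C n := PH (n + X n + A n) + 28 * (A n).+1 + 20.
exists (fun n => G n + (26 * (G n).+1 + (X n + (13 * (X n).+1 +
  ((X n * C n).+1 + (2 * (X n).+1 + 26 * (A n).+1)))))).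
have mX : polym X by apply: (polym_comp mF); polym_auto.
have mA : polym A.
  have mQX : polym (fun n => Q (n + X n)) by apply: (polym_comp mQ); polym_auto.
  by rewrite /A; polym_auto.
have mC : polym C.
  have : polym (fun n => PH (n + X n + A n)).
    by apply: (polym_comp mPH); polym_auto.
  by move=> ?; rewrite /C; polym_auto.
split=> [|e he]; first polym_auto.
set n := total e; set R := wrec _ (g e).
have Gle : B -> size (g e) <= G n.
  by move=> b; apply: run_result_size b (hg e he).
have he2 : size (e ++ [:: [::]; g e]) = k.+2 by rewrite size_cat he addn2.
have hfe := hf _ he2; rewrite take_size_cat // in hfe.
have totX : B -> F (total (e ++ [:: [::]; g e])) <= X n.
  move=> b; apply: (proj1 mF); rewrite total_cat leq_add2l /total /= addn0.
  exact: Gle.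
have Xle : B -> size (f e) <= X n.
  by move=> b; apply: leq_trans (run_result_size b hfe) (totX b).
have Rle w : B -> size (R w) <= G n + size w * Q (n + size w).
  move=> b; elim: w => [|a w IH] /=; first by rewrite mul0n addn0; apply: Gle.
  apply: leq_trans (growth _ _ _ _ b he) _.
  rewrite mulSn addnA [G n + _]addnC -addnA addnC leq_add //.
    by apply: (proj1 mQ); rewrite leq_add2l.
  apply: leq_trans IH _; rewrite leq_add2l leq_mul2l.
  by apply/orP; right; apply: (proj1 mQ); rewrite leq_add2l.
have RleA w : B -> size w <= X n -> size (R w) <= A n.
  move=> b hw; apply: leq_trans (Rle w b) _; rewrite leq_add2l leq_mul //.
  by apply: (proj1 mQ); rewrite leq_add2l.
(* Invariant: [y] is the unread part in reversed order, [w] the suffix already read, and the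
   accumulator is the value on [w]. *)
have hloop y w : (B -> size y + size w <= X n) ->
    run B loop (st (e ++ [:: w; R w; [::]; y]))
      (st (e ++ [:: catrev y w; R (catrev y w); [::]; [::]]))
      (size y * C n).+1.
  elim: y w => [|a y IH] w hyw.
    by apply: run_while_end; rewrite st_nth.
  have hyw' : B -> size y + size (a :: w) <= X n.
    by move=> /hyw /=; rewrite addnS.
  pose w' := a :: w; have RwE : R w' = H a (e ++ [:: w; R w]) by [].
  apply: (@run_le _ _ _ _ ((PH (n + X n + A n) + (2 * (A n).+1 +
    (26 * (A n).+1 + (1 + 1)))) + 9 + (size y * C n).+1).+1).
    have hC : C n = PH (n + X n + A n) + 28 * (A n).+1 + 20 by [].
    by move=> _; rewrite /= mulSn; lia.
  apply: run_while_step (IH w' hyw'); first by rewrite st_nth.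
  apply: (@run_case _ _ _ _ _ _ a); first by rewrite st_nth.
  have szw : B -> size w <= X n by move=> /hyw /=; lia.
  have [_ hpa] := hpP a; set e4 := e ++ [:: w; R w; [::]; a :: y].
  have he4 : size e4 = k.+2.+2 by rewrite size_cat he !addnS addn0.
  have := hpa _ he4; have -> : take k.+2 e4 = e ++ [:: w; R w].
    by rewrite /e4 -addn2 -he -[[:: w, _ & _]]/([:: w; R w] ++ _) catA
      take_size_cat // size_cat.
  rewrite -RwE -cats1 -catA /= => Hpa; apply: run_seq.
    apply: run_le Hpa => b; apply: leq_trans (hPH a _); apply: (proj1 (proj1 (hpP a))).
    rewrite total_cat /total /= addn0 -addnA leq_add2l.
    move: (RleA _ b (szw b)) (hyw b) => /=; lia.
  apply: run_seq.
    apply: run_le (run_clear_st [:: w; R w; [::]; a :: y; R w'] 1 he) => b.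
    by rewrite leq_mul2l ltnS /= RleA // szw.
  apply: run_seq.
    have := @run_move_st k e [:: w; [::]; [::]; a :: y; R w'] 4 1 5 he
      erefl erefl erefl erefl.
    apply: run_le => b; rewrite leq_mul2l ltnS.
    by apply: RleA => //; move: (hyw b) => /=; lia.
  rewrite /= cats0; apply: run_seq.
    have := run_push B (k + 0) a (st (e ++ [:: w; R w'; [::]; a :: y; [::]])).
    rewrite upd_st // st_nth //=; apply.
  have := run_pop B (k + 3) (st (e ++ [:: w'; R w'; [::]; a :: y; [::]])).
  rewrite upd_st // st_nth //= => Hp.
  by rewrite (st_trim _ [:: w'; R w'; [::]; y]).
apply: run_seq (hg e he) _; rewrite -cats1; apply: run_seq.
  have := @run_move_st k e [:: g e] 0 1 2 he erefl erefl erefl erefl.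
  by apply: run_le => b; rewrite leq_mul2l ltnS /= Gle.
rewrite /= cats0; apply: run_seq; first by apply: run_le hfe => b; apply: totX.
rewrite -cats1 -catA /=; apply: run_seq.
  have := @run_rev_move_st k e [:: [::]; g e; f e] 2 3 he erefl.
  by apply: run_le => b; rewrite leq_mul2l ltnS /= Xle.
rewrite /= catrevE cats0; apply: run_seq.
  have := hloop (rev (f e)) [::]; rewrite size_rev addn0 => /(_ Xle).
  by apply: run_le => b; rewrite ltnS leq_mul2r Xle // orbT.
rewrite catrevE cats0 revK; apply: run_seq.
  apply: run_le (run_clear_st [:: f e; R (f e); [::]; [::]] 0 he) => b.
  by rewrite leq_mul2l ltnS /= Xle.
have := @run_move_st k e [:: [::]; R (f e); [::]; [::]] 1 0 2 he
  erefl erefl erefl erefl.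
rewrite /= cats0 -!cats1 -[[:: [::]; [::]; [::]]]/(rcons [:: [::]; [::]] [::]).
rewrite -[[:: R (f e); [::]; [::]; [::]]]/(rcons [:: R (f e); [::]; [::]] [::]).
rewrite -st_trim -[[:: R (f e); [::]; [::]]]/(rcons [:: R (f e); [::]] [::]).
rewrite -st_trim -[[:: R (f e); [::]]]/(rcons [:: R (f e)] [::]) -st_trim.
by apply: run_le => b; rewrite leq_mul2l ltnS RleA // Xle.
Qed.

End Computable.

(** * Word functions and unary arithmetic *)

Section WordFunctions.
Variable B : Prop.

Lemma cmp_wrec k f g h (Q : nat -> nat) :
  cmp B k f -> cmp B k g ->
  (forall a, cmp B k.+2
     (fun e => h a (take k e) (nth [::] e k) (nth [::] e k.+1))) ->
  polym Q ->
  (forall a e w acc, B -> size e = k ->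
     size (h a e w acc) <= size acc + Q (total e + size w)) ->
  cmp B k (fun e => wrec (fun a => h a e) (g e) (f e)).
Proof.
move=> cf cg ch mQ hQ.
have E (e : seq word) (w acc : word) : size e = k ->
    [/\ take k (e ++ [:: w; acc]) = e, nth [::] (e ++ [:: w; acc]) k = w
      & nth [::] (e ++ [:: w; acc]) k.+1 = acc].
  move=> he; rewrite take_size_cat // !nth_cat he ltnn subnn ltnNge leqnSn /=.
  by rewrite subSnn.
apply: cmp_ext (cmp_rec cf cg ch mQ _) => [e he|a e w acc b he]; last first.
  by have [-> -> ->] := E e w acc he; apply: hQ.
elim: (f e) => //= a w IH.
by rewrite IH; have [-> -> ->] := E e w (wrec (fun a => h a e) (g e) w) he.
Qed.

Lemma cmp_take k f : cmp B k f -> cmp B k.+2 (fun e => f (take k e)).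
Proof. by apply: cmp_weaken; lia. Qed.

Lemma cmp_cat k f g : cmp B k f -> cmp B k g -> cmp B k (fun e => f e ++ g e).
Proof.
move=> cf cg; pose h (a : symbol) (e : seq word) (w acc : word) := a :: acc.
apply: (@cmp_ext _ _ (fun e => wrec (fun a => h a e) (g e) (f e))).
  by move=> e _; elim: (f e) => //= a w ->.
apply: (@cmp_wrec _ _ _ h (fun=> 1)) => //; [|exact: polym_const|].
- by move=> a; apply: cmp_cons; apply: cmp_nth.
- by move=> a e w acc _ _; rewrite addn1.
Qed.

Lemma cmp_const k w : cmp B k (fun=> w).
Proof. by elim: w => [|a w IH]; [exact: cmp_nil | exact: cmp_cons]. Qed.

Fixpoint take_while (p : pred symbol) (w : word) : word :=
  if w is a :: w' then if p a then a :: take_while p w' else [::] else [::].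

Fixpoint drop_while (p : pred symbol) (w : word) : word :=
  if w is a :: w' then if p a then drop_while p w' else w else [::].

Lemma cmp_take_while p k f : cmp B k f -> cmp B k (fun e => take_while p (f e)).
Proof.
move=> cf.
pose h a (e : seq word) (w acc : word) := if p a then a :: acc else [::].
apply: (@cmp_ext _ _ (fun e => wrec (fun a => h a e) [::] (f e))).
  by move=> e _; elim: (f e) => //= a w ->.
apply: (@cmp_wrec _ _ _ h (fun=> 1)) => //; first exact: cmp_nil; last 2 first.
- exact: polym_const.
- by move=> a e w acc _ _; rewrite /h; case: ifP => _ /=; lia.
move=> a; rewrite /h; case: (p a); last exact: cmp_nil.
by apply: cmp_cons; apply: cmp_nth.
Qed.

Lemma cmp_drop_while p k f : cmp B k f -> cmp B k (fun e => drop_while p (f e)).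
Proof.
move=> cf.
pose h a (e : seq word) (w acc : word) := if p a then acc else a :: w.
apply: (@cmp_ext _ _ (fun e => wrec (fun a => h a e) [::] (f e))).
  by move=> e _; elim: (f e) => //= a w ->.
apply: (@cmp_wrec _ _ _ h S) => //; first exact: cmp_nil; last 2 first.
- by apply: polym_succ; exact: polym_id.
- by move=> a e w acc _ _; rewrite /h; case: ifP => _ /=; lia.
move=> a; rewrite /h; case: (p a); first exact: cmp_nth.
by apply: cmp_cons; apply: cmp_nth.
Qed.

Definition unary (n : nat) : word := nseq n SOne.

Lemma cmp_size_unary k f : cmp B k f -> cmp B k (fun e => unary (size (f e))).
Proof.
move=> cf; pose h (a : symbol) (e : seq word) (w acc : word) := SOne :: acc.
apply: (@cmp_ext _ _ (fun e => wrec (fun a => h a e) [::] (f e))).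
  by move=> e _; elim: (f e) => //= a w ->.
apply: (@cmp_wrec _ _ _ h (fun=> 1)) => //; first exact: cmp_nil; last 2 first.
- exact: polym_const.
- by move=> a e w acc _ _; rewrite addn1.
by move=> a; apply: cmp_cons; apply: cmp_nth.
Qed.

(** Numbers are held in unary. Under [B := True] this confines them to polynomial size, which
    suffices for indices of variables and positions. *)
Definition ncmp k (F : seq word -> nat) := cmp B k (fun e => unary (F e)).

Lemma ncmp_ext k F G : (forall e, size e = k -> F e = G e) ->
  ncmp k F -> ncmp k G.
Proof. by move=> FG; apply: cmp_ext => e he; rewrite FG. Qed.

Lemma ncmp_size k f : cmp B k f -> ncmp k (fun e => size (f e)).
Proof. exact: cmp_size_unary. Qed.

Lemma ncmp_const k c : ncmp k (fun=> c).
Proof. exact: cmp_const. Qed.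

Lemma ncmp_add k F G : ncmp k F -> ncmp k G -> ncmp k (fun e => F e + G e).
Proof.
move=> cF cG; apply: cmp_ext (cmp_cat cF cG) => e _.
by rewrite /unary nseqD.
Qed.

Lemma ncmp_mull c k F : ncmp k F -> ncmp k (fun e => c * F e).
Proof.
move=> cF; elim: c => [|c IH]; first exact: ncmp_const.
by apply: ncmp_ext (ncmp_add cF IH) => e _; rewrite mulSn.
Qed.

Lemma ncmp_take k F : ncmp k F -> ncmp k.+2 (fun e => F (take k e)).
Proof. exact: (@cmp_take k (fun e => unary (F e))). Qed.

End WordFunctions.

(** * The reduction along an additive interpretation *)

Import Order.TTheory GRing.Theory Num.Theory.

Definition is_one a := symbol_eq a SOne.
Definition is_digit a := symbol_eq a SZero || symbol_eq a SOne.

(** Recursion on a word carries a single word as accumulator, so a stack of numbers has to be packed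
    into it; [SZero] closes each unary entry. *)
Definition push (b : nat) (s : word) : word := unary b ++ SZero :: s.
Definition top (s : word) : nat := size (take_while is_one s).
Definition pop (s : word) : word := behead (drop_while is_one s).

Lemma top_push b s : top (push b s) = b.
Proof. by rewrite /top; elim: b => //= b ->. Qed.

Lemma pop_push b s : pop (push b s) = s.
Proof. by rewrite /pop; elim: b. Qed.

Lemma size_drop_while p w : size (drop_while p w) <= size w.
Proof. by elim: w => //= a w IH; case: ifP => _ //; apply: ltnW. Qed.

Lemma size_take_while p w : size (take_while p w) <= size w.
Proof. by elim: w => //= a w IH; case: ifP. Qed.

Lemma size_pop s : size (pop s) <= size s.
Proof.
by rewrite size_behead (leq_trans (leq_pred _)) ?size_drop_while.
Qed.

(* The block of variables attached to the position of a suffix [w]. *)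
Definition pos_block (w : word) : nat := (2 * size w).+1.

(** Prefix notation is evaluated from the end with a stack: when an operator is reached, the two
    topmost entries are the blocks of its arguments. Signs and digits leave the stack alone. *)
Definition stk_step a (w acc : word) : word :=
  match a with
  | SVar => push (2 * top w) acc
  | SCst => push (pos_block w) acc
  | SAdd | SMul => push (pos_block w) (pop (pop acc))
  | SEqn => pop (pop acc)
  | _ => acc
  end.

Definition stk : word -> word := wrec stk_step [::].

Lemma stkE a w : stk (a :: w) = stk_step a w (stk w).
Proof. by []. Qed.

Section KarpWords.
Variable B : Prop.

Lemma ncmp_top k f : cmp B k f -> ncmp B k (fun e => top (f e)).
Proof. by move=> cf; apply: ncmp_size; apply: cmp_take_while. Qed.

Lemma cmp_pop k f : cmp B k f -> cmp B k (fun e => pop (f e)).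
Proof. by move=> cf; apply: cmp_behead; apply: cmp_drop_while. Qed.

Lemma cmp_push k F f : ncmp B k F -> cmp B k f ->
  cmp B k (fun e => push (F e) (f e)).
Proof. by move=> cF cf; apply: cmp_cat => //; apply: cmp_cons. Qed.

Lemma ncmp_pos_block k f : cmp B k f -> ncmp B k (fun e => pos_block (f e)).
Proof.
move=> cf; apply: ncmp_ext (ncmp_add (ncmp_mull 2 (ncmp_size cf))
  (ncmp_const B k 1)) => e _.
by rewrite addn1.
Qed.

Lemma cmp_stk k f : cmp B k f -> cmp B k (fun e => stk (f e)).
Proof.
move=> cf; apply: (@cmp_wrec _ _ _ _ (fun a _ => stk_step a)
  (fun n => (2 * n).+2)) => //; first exact: cmp_nil.
- have cw : cmp B k.+2 (fun e => nth [::] e k) by apply: cmp_nth; lia.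
  have ca : cmp B k.+2 (fun e => nth [::] e k.+1) by apply: cmp_nth; lia.
  have cp := ncmp_pos_block cw.
  case=> //=; do ?[exact: cp | apply: cmp_push | apply: cmp_pop
    | apply: ncmp_mull | apply: ncmp_top] => //.
- by polym_auto.
move=> a e w acc _ _.
have h1 := size_pop acc; have h2 := size_pop (pop acc).
have h3 := size_take_while is_one w.
case: a => //=; rewrite ?size_cat /= ?size_nseq /top /pos_block; lia.
Qed.

Definition int_head (w : word) : word :=
  (if is_sym SNeg (ohead w) then SNeg else SPos)
    :: take_while is_digit (behead w).
Definition int_tail (w : word) : word := drop_while is_digit (behead w).

Lemma cmp_int_head k f : cmp B k f -> cmp B k (fun e => int_head (f e)).
Proof.
move=> cf; have ct := cmp_take_while is_digit (cmp_behead cf).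
apply: cmp_ext (cmp_if (is_sym SNeg) cf (cmp_cons SNeg ct) (cmp_cons SPos ct)).
by move=> e _; rewrite /int_head; case: ifP.
Qed.

Lemma cmp_int_tail k i f : cmp B k f ->
  cmp B k (fun e => iter i int_tail (f e)).
Proof.
by move=> cf; elim: i => //= i IH; apply: cmp_drop_while; apply: cmp_behead.
Qed.

End KarpWords.

(** Numerals carry no end marker: they stop at the first symbol that is not a digit. Whatever may
    follow a number, a term, a system or nothing, has this property. *)
Definition no_digit (w : word) : bool :=
  if w is a :: _ then ~~ is_digit a else true.

Lemma take_while_cat p u w : all p u -> (if w is a :: _ then ~~ p a else true) ->
  take_while p (u ++ w) = u.
Proof.
move=> + hw; elim: u => /= [_|a u IH /andP[-> /IH ->] //].
by case: w hw => //= a w /negPf ->.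
Qed.

Lemma drop_while_cat p u w : all p u -> (if w is a :: _ then ~~ p a else true) ->
  drop_while p (u ++ w) = w.
Proof.
move=> + hw; elim: u => /= [_|a u IH /andP[-> /IH ->] //].
by case: w hw => //= a w /negPf ->.
Qed.

Lemma encode_pos_digits p : all is_digit (encode_pos p).
Proof. by elim: p. Qed.

Lemma encode_nat_digits n : all is_digit (encode_nat n).
Proof. by rewrite /encode_nat; case: bin_of_nat => // p; apply: encode_pos_digits. Qed.

Lemma int_head_cat z w : no_digit w -> int_head (encode_int z ++ w) = encode_int z.
Proof.
move=> hw; rewrite /int_head /encode_int /= take_while_cat ?encode_nat_digits //.
by case: (Order.le _ _).
Qed.

Lemma int_tail_cat z w : no_digit w -> int_tail (encode_int z ++ w) = w.
Proof.
by move=> hw; rewrite /int_tail /= drop_while_cat ?encode_nat_digits.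
Qed.

Lemma no_digit_ints (c : seq int) w : no_digit w ->
  no_digit (flatten (map encode_int c) ++ w).
Proof. by case: c => //= z c _; case: (Order.le _ _). Qed.

Lemma int_tail_iter (c : seq int) w i : no_digit w -> i <= size c ->
  iter i int_tail (flatten (map encode_int c) ++ w) =
  flatten (map encode_int (drop i c)) ++ w.
Proof.
move=> hw; elim: i => [|i IH] hi; first by rewrite drop0.
rewrite iterS (IH (ltnW hi)) (drop_nth (0%R : int)) //= -catA int_tail_cat //.
exact: no_digit_ints.
Qed.

Lemma int_head_nth (c : seq int) w i : no_digit w -> i < size c ->
  int_head (iter i int_tail (flatten (map encode_int c) ++ w)) =
  encode_int (nth 0%R c i).
Proof.
move=> hw hi; rewrite int_tail_iter // 1?ltnW // (drop_nth (0%R : int)) //= -catA.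
by rewrite int_head_cat //; apply: no_digit_ints.
Qed.

Lemma no_digit_term m (t : term (m.-tuple int)) w :
  no_digit (encode_term t ++ w).
Proof. by case: t. Qed.

Lemma top_var i w : no_digit w -> top (nseq i SOne ++ w) = i.
Proof.
move=> hw; rewrite /top take_while_cat ?size_nseq ?all_nseq ?orbT //.
by case: w hw => //= a w; rewrite negb_or => /andP[].
Qed.

(** [l] is the length of what follows the term. The head symbol is discounted because a block is
    attached to the suffix behind the symbol that creates it. *)
Definition term_pos m (t : term (m.-tuple int)) (l : nat) : nat :=
  (2 * (l + (size (encode_term t)).-1)).+1.

Definition term_block m (t : term (m.-tuple int)) (l : nat) : nat :=
  if t is TVar i then 2 * i else term_pos t l.

Lemma stk_digits u w : all is_digit u -> stk (u ++ w) = stk w.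
Proof. by elim: u => //= a u IH /andP[ha /IH <-]; case: a ha. Qed.

Lemma stk_int z w : stk (encode_int z ++ w) = stk w.
Proof.
rewrite /encode_int /stk /=; case: (Order.le _ _) => /=;
  by rewrite -/(stk _) stk_digits ?encode_nat_digits.
Qed.

Lemma stk_ints (c : seq int) w :
  stk (flatten (map encode_int c) ++ w) = stk w.
Proof.
elim: c => // z c IH.
have -> : flatten (map encode_int (z :: c)) =
  encode_int z ++ flatten (map encode_int c) by [].
by rewrite -catA stk_int.
Qed.

Lemma encode_term_cat m (t : term (m.-tuple int)) w :
  encode_term t ++ w =
  match t with
  | TVar i => SVar :: (nseq i SOne ++ w)
  | TCst c => SCst :: (flatten (map encode_int c) ++ w)
  | TAdd t1 t2 => SAdd :: (encode_term t1 ++ (encode_term t2 ++ w))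
  | TMul t1 t2 => SMul :: (encode_term t1 ++ (encode_term t2 ++ w))
  end.
Proof. by case: t => //= t1 t2; rewrite -catA. Qed.

Lemma size_encode_term_gt0 m (t : term (m.-tuple int)) : 0 < size (encode_term t).
Proof. by case: t. Qed.

Lemma term_posE m (t : term (m.-tuple int)) a u w :
  encode_term t ++ w = a :: u -> term_pos t (size w) = pos_block u.
Proof.
move=> E; have := congr1 size E; have := size_encode_term_gt0 t.
rewrite size_cat /= /term_pos /pos_block; lia.
Qed.

Lemma stk_term m (t : term (m.-tuple int)) w : no_digit w ->
  stk (encode_term t ++ w) = push (term_block t (size w)) (stk w).
Proof.
elim: t w => [i|c|t1 IH1 t2 IH2|t1 IH1 t2 IH2] w hw; have E := encode_term_cat;
  rewrite E stkE /stk_step.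
- by rewrite top_var // stk_digits // all_nseq orbT.
- by rewrite stk_ints /term_block (term_posE (E m (TCst c) w)).
- by rewrite IH1 ?no_digit_term // IH2 // !pop_push /term_block
    (term_posE (E m (TAdd t1 t2) w)).
- by rewrite IH1 ?no_digit_term // IH2 // !pop_push /term_block
    (term_posE (E m (TMul t1 t2) w)).
Qed.

(** * Renaming of variables and constants in systems *)

Section Systems.
Local Open Scope ring_scope.

Fixpoint map_term (C D : Type) (rv : nat -> nat) (rc : C -> D) (t : term C) :=
  match t with
  | TVar i => TVar (rv i)
  | TCst c => TCst (rc c)
  | TAdd t1 t2 => TAdd (map_term rv rc t1) (map_term rv rc t2)
  | TMul t1 t2 => TMul (map_term rv rc t1) (map_term rv rc t2)
  end.

Definition map_system (C D : Type) rv (rc : C -> D) (S : system C) : system D :=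
  [seq (map_term rv rc e.1, map_term rv rc e.2) | e <- S].

Fixpoint term_bound (C : Type) (t : term C) : nat :=
  match t with
  | TVar i => i.+1
  | TCst _ => 0%N
  | TAdd t1 t2 | TMul t1 t2 => maxn (term_bound t1) (term_bound t2)
  end.

Definition system_bound (C : Type) (S : system C) : nat :=
  foldr (fun e n => maxn (maxn (term_bound e.1) (term_bound e.2)) n) 0%N S.

Lemma eval_map (A : naRing) (C D : Type) rv (rc : C -> D) (val : D -> A) u t :
  eval val u (map_term rv rc t) = eval (val \o rc) (u \o rv) t.
Proof. by elim: t => //= t1 -> t2 ->. Qed.

Lemma satisfies_map (A : naRing) (C D : Type) rv (rc : C -> D) (val : D -> A)
    u S :
  satisfies val u (map_system rv rc S) <-> satisfies (val \o rc) (u \o rv) S.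
Proof. by elim: S => //= e S IH; rewrite !eval_map IH. Qed.

Lemma eval_ext (A : naRing) (C : Type) (val val' : C -> A) u u' t :
  val =1 val' -> (forall i, (i < term_bound t)%N -> u i = u' i) ->
  eval val u t = eval val' u' t.
Proof.
move=> vv; elim: t => [i|c|t1 IH1 t2 IH2|t1 IH1 t2 IH2] /= h.
- exact: h.
- exact: vv.
- by rewrite IH1 ?IH2 // => i hi; apply: h; rewrite leq_max hi ?orbT.
- by rewrite IH1 ?IH2 // => i hi; apply: h; rewrite leq_max hi ?orbT.
Qed.

Lemma satisfies_ext (A : naRing) (C : Type) (val val' : C -> A) u u' S :
  val =1 val' -> (forall i, (i < system_bound S)%N -> u i = u' i) ->
  satisfies val u S <-> satisfies val' u' S.
Proof.
move=> vv; elim: S => //= e S IH h.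
rewrite IH => [|i hi]; last by apply: h; rewrite leq_max hi orbT.
have h1 : eval val u e.1 = eval val' u' e.1.
  by apply: eval_ext => // i hi; apply: h; rewrite !leq_max hi.
have h2 : eval val u e.2 = eval val' u' e.2.
  by apply: eval_ext => // i hi; apply: h; rewrite !leq_max hi orbT.
by rewrite h1 h2.
Qed.

Lemma satisfies_cat (A : naRing) (C : Type) (val : C -> A) u S1 S2 :
  satisfies val u (S1 ++ S2) <-> satisfies val u S1 /\ satisfies val u S2.
Proof. by elim: S1 => /= [|e S1 ->]; tauto. Qed.

Lemma encode_system_cat m (S1 S2 : system (m.-tuple int)) :
  encode_system (S1 ++ S2) = encode_system S1 ++ encode_system S2.
Proof. by rewrite /encode_system map_cat flatten_cat. Qed.

Lemma encode_system_cons m e (S : system (m.-tuple int)) :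
  encode_system (e :: S) =
  SEqn :: (encode_term e.1 ++ (encode_term e.2 ++ encode_system S)).
Proof. by rewrite /encode_system /= -catA. Qed.

End Systems.

(** * Blocks of variables and instances of defining systems *)

Section Reduction.
Local Open Scope ring_scope.
Variables (O A : naRing) (d m : nat) (hs : d.-tuple O) (gs : m.-tuple A).
Hypothesis gs_gen : generates gs.

Definition coordinates (x : A) : m.-tuple int := projT1 (cid (gs_gen x)).

Lemma coordinatesK x : int_comb gs (coordinates x) = x.
Proof. by rewrite /coordinates; case: cid. Qed.

Variables (n Kb : nat).
Hypothesis n_le_Kb : (n < Kb)%N.

(** A block has [Kb] variables: the first [n] hold a tuple, and the others are room for the
    existential variables of one instance of a defining system. *)
Definition tup (u : nat -> A) b : n.-tuple A :=
  [tuple u (Kb * b + j)%N | j < n].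

Definition blk (v : nat -> A) b : n.-tuple A := [tuple v (b * n + j)%N | j < n].

Definition specifies q (S : system A) (R : seq (n.-tuple A) -> Prop) :=
  forall v0, R [seq blk v0 b | b <- iota 0 q] <->
    exists v, (forall x, (x < q * n)%N -> v x = v0 x) /\ satisfies id v S.

(** Existential variables keep their number as offset in the block [aux]. For [q > 0] this offset is
    at least [n], so they do not meet the tuple of that block, and [aux] may itself be one of the
    arguments. *)
Definition loc q (bs : nat -> nat) aux x : nat :=
  (if x < q * n then Kb * bs (x %/ n) + x %% n else Kb * aux + x)%N.

Definition instantiate q S bs aux : system (m.-tuple int) :=
  map_system (loc q bs aux) coordinates S.

Lemma satisfies_instantiate q S bs aux u :
  satisfies (int_comb gs) u (instantiate q S bs aux) <->
  satisfies id (u \o loc q bs aux) S.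
Proof.
rewrite satisfies_map; apply: satisfies_ext => // x.
exact: coordinatesK.
Qed.

Lemma blk_loc q bs aux u :
  [seq blk (u \o loc q bs aux) b | b <- iota 0 q] =
  [seq tup u (bs b) | b <- iota 0 q].
Proof.
apply/eq_in_map => b; rewrite mem_iota /= add0n => hb.
apply: eq_from_tnth => j; rewrite !tnth_mktuple /= /loc.
have n_gt0 : (0 < n)%N by case: (n) j => // -[].
have -> : (b * n + j < q * n)%N.
  apply: (@leq_trans (b.+1 * n)); last by rewrite leq_mul2r hb orbT.
  by rewrite mulSn addnC ltn_add2r.
by rewrite divnMDl // divn_small // addn0 modnMDl modn_small.
Qed.

Lemma instantiate_sound q S R bs aux u : specifies q S R ->
  satisfies (int_comb gs) u (instantiate q S bs aux) ->
  R [seq tup u (bs b) | b <- iota 0 q].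
Proof.
move=> hS /satisfies_instantiate h; rewrite -(blk_loc q bs aux).
by apply/hS; exists (u \o loc q bs aux).
Qed.

Definition set_block (u : nat -> A) p (g : nat -> A) : nat -> A :=
  fun y => if (y %/ Kb == p)%N then g (y %% Kb)%N else u y.

Lemma set_block_at u p g j : (j < Kb)%N -> set_block u p g (Kb * p + j)%N = g j.
Proof.
move=> hj; have Kb0 : (0 < Kb)%N by apply: leq_trans hj.
by rewrite /set_block mulnC divnMDl // divn_small // addn0 eqxx modnMDl modn_small.
Qed.

Lemma set_block_ne u p g b j : (j < Kb)%N -> b != p ->
  set_block u p g (Kb * b + j)%N = u (Kb * b + j)%N.
Proof.
move=> hj bp; have Kb0 : (0 < Kb)%N by apply: leq_trans hj.
by rewrite /set_block mulnC divnMDl // divn_small // addn0 (negPf bp).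
Qed.

Lemma ltn_ordKb (j : 'I_n) : (j < Kb)%N.
Proof. exact: leq_trans (ltn_ord j) (ltnW n_le_Kb). Qed.

Lemma tup_ext u u' b b' :
  (forall j, (j < Kb)%N -> u (Kb * b + j)%N = u' (Kb * b' + j)%N) ->
  tup u b = tup u' b'.
Proof.
by move=> h; apply: eq_from_tnth => j; rewrite !tnth_mktuple h ?ltn_ordKb.
Qed.

Lemma tup_set_block u p (a : n.-tuple A) g :
  (forall j, (j < n)%N -> g j = nth 0 a j) -> tup (set_block u p g) p = a.
Proof.
move=> h; apply: eq_from_tnth => j; rewrite tnth_mktuple set_block_at ?ltn_ordKb //.
by rewrite h // (tnth_nth 0).
Qed.

Lemma tup_set_block_ne u p g b : b != p -> tup (set_block u p g) b = tup u b.
Proof. by move=> bp; apply: tup_ext => j hj; rewrite set_block_ne. Qed.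

(** Values chosen later for other blocks must not spoil the equations, hence the quantification over
    every [u'] that agrees with [u1] on the argument tuples and on the block [p]. This block
    receives the tuple [a] together with the witnesses. *)
Lemma instantiate_complete q S R bs p u (a : n.-tuple A) :
  (0 < q)%N -> specifies q S R -> (system_bound S <= Kb)%N ->
  R [seq tup (set_block u p (nth 0 a)) (bs b) | b <- iota 0 q] ->
  exists u1, [/\ forall b j, b != p -> (j < Kb)%N ->
                   u1 (Kb * b + j)%N = u (Kb * b + j)%N,
                 tup u1 p = a
    & forall u', (forall b, (b < q)%N -> tup u' (bs b) = tup u1 (bs b)) ->
      (forall j, (j < Kb)%N -> u' (Kb * p + j)%N = u1 (Kb * p + j)%N) ->
      satisfies (int_comb gs) u' (instantiate q S bs p)].
Proof.
move=> q_gt0 hS SKb; rewrite -(blk_loc q bs p).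
set u0 := set_block u p (nth 0 a); move=> /hS[v [hv satv]].
pose g j := if (j < n)%N then nth 0 a j else v j.
exists (set_block u p g); split.
- by move=> b j bp hj; rewrite set_block_ne.
- by apply: tup_set_block => j hj; rewrite /g hj.
move=> u' h1 h2; apply/satisfies_instantiate.
apply/(satisfies_ext (u' := v) (val' := id)) => // x hx.
have xKb : (x < Kb)%N by apply: leq_trans hx SKb.
rewrite /= /loc; case: ifP => xq; last first.
  rewrite h2 // set_block_at // /g.
  suff -> : (x < n)%N = false by [].
  by apply: contraFF xq => /leq_trans; apply; rewrite leq_pmull.
have n_gt0 : (0 < n)%N by case: (n) xq => //; rewrite muln0.
have hb : (x %/ n < q)%N by rewrite ltn_divLR.
have hj : (x %% n < n)%N by rewrite ltn_mod.
have := congr1 (fun T => tnth T (Ordinal hj)) (h1 _ hb).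
rewrite !tnth_mktuple /= => ->; rewrite hv // /= /loc xq /u0.
have hjK : (x %% n < Kb)%N by apply: leq_trans hj (ltnW n_le_Kb).
have [->|bp] := eqVneq (bs (x %/ n)%N) p.
  by rewrite !set_block_at // /g hj.
by rewrite !set_block_ne.
Qed.

Section Emission.
Variable B : Prop.

Lemma cmp_instantiate k q S Fs F :
  (forall b, ncmp B k (Fs b)) -> ncmp B k F ->
  cmp B k (fun e => encode_system (instantiate q S (fun b => Fs b e) (F e))).
Proof.
move=> cFs cF.
have cterm t : cmp B k (fun e => encode_term
    (map_term (loc q (fun b => Fs b e) (F e)) coordinates t)).
  elim: t => [x|c|t1 IH1 t2 IH2|t1 IH1 t2 IH2] /=.
  - rewrite /loc; apply: cmp_cons; case: (x < q * n)%N.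
      exact: (ncmp_add (ncmp_mull Kb (cFs _)) (ncmp_const B k _)).
    exact: (ncmp_add (ncmp_mull Kb cF) (ncmp_const B k _)).
  - exact: cmp_const.
  - by apply: cmp_cons; apply: cmp_cat.
  - by apply: cmp_cons; apply: cmp_cat.
elim: S => [|e S IH]; first exact: cmp_nil.
rewrite /=; apply: cmp_ext (cmp_cons SEqn (cmp_cat (cterm e.1)
  (cmp_cat (cterm e.2) IH))) => e' _.
by rewrite encode_system_cons.
Qed.

End Emission.

(** * Constants and the equations written for each symbol *)

Variables (X : set (n.-tuple A)) (phi : n.-tuple A -> O).
Variables (SX SE SA SM : system A).

Definition isX (s : seq (n.-tuple A)) : Prop := if s is [:: x] then X x else False.
Definition isE (s : seq (n.-tuple A)) : Prop :=
  if s is [:: x; y] then [/\ X x, X y & phi x = phi y] else False.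
Definition isA (s : seq (n.-tuple A)) : Prop :=
  if s is [:: x; y; z] then [/\ X x, X y, X z & phi x + phi y = phi z]
  else False.
Definition isM (s : seq (n.-tuple A)) : Prop :=
  if s is [:: x; y; z] then
    [/\ X x, X y, X z & na_mul (phi x) (phi y) = phi z]
  else False.

Hypotheses (hX : specifies 1 SX isX) (hE : specifies 2 SE isE)
  (hA : specifies 3 SA isA) (hM : specifies 3 SM isM).
Hypotheses (bX : (system_bound SX <= Kb)%N) (bE : (system_bound SE <= Kb)%N)
  (bA : (system_bound SA <= Kb)%N) (bM : (system_bound SM <= Kb)%N).
Hypothesis phi_surj : forall b : O, exists2 x, X x & phi x = b.

(* The constants of [O] are the combinations of the tuples [xs i]. *)
Variable xs : 'I_d -> n.-tuple A.
Definition cst_tuple (c : d.-tuple int) : n.-tuple A :=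
  [tuple \sum_(i < d) tnth (xs i) j *~ tnth c i | j < n].
Hypothesis xs_X : forall c, X (cst_tuple c).
Hypothesis xs_phi : forall c, phi (cst_tuple c) = int_comb hs c.

(** Multiplying a binary numeral by a program is avoided: a coordinate of the constant of [O]
    becomes a coordinate of a constant of [A], so its digits are merely copied. *)
Definition unit_tuple (c : seq int) (i l : nat) : m.-tuple int :=
  [tuple (if l' == l :> nat then nth 0 c i else 0) | l' < m].

Definition coef (j : 'I_n) (i : 'I_d) (l : 'I_m) : int :=
  tnth (coordinates (tnth (xs i) j)) l.

(** The fixed factor [coef j i l] is realized by repeating a summand. Negative factors are moved to
    the other side of the equation: [-%R] selects the summands on the left, [id] those on the
    right. *)
Definition occurrences (F : int -> int) (j : 'I_n) : seq ('I_d * 'I_m) :=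
  flatten [seq nseq (if 0 <= F (coef j il.1 il.2) then `|coef j il.1 il.2|%N
    else 0%N) il | il <- enum {: 'I_d * 'I_m}].

Definition cst_sum (c : seq int) (L : seq ('I_d * 'I_m))
    (t : term (m.-tuple int)) :=
  foldr (fun (il : 'I_d * 'I_m) t => TAdd (TCst (unit_tuple c il.1 il.2)) t) t L.

Definition cst_system (c : seq int) (b : nat) : system (m.-tuple int) :=
  [seq (cst_sum c (occurrences -%R j) (TVar (Kb * b + j)%N),
        cst_sum c (occurrences id j) (TCst (nseq_tuple m 0))) | j <- enum 'I_n].

Lemma eval_cst_sum u c L t :
  eval (int_comb gs) u (cst_sum c L t) =
  \sum_(il <- L) tnth gs il.2 *~ nth 0 c il.1 + eval (int_comb gs) u t.
Proof.
elim: L => [|il L IH] /=; first by rewrite big_nil add0r.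
rewrite big_cons IH addrA; congr (_ + _ + _).
rewrite /int_comb (bigD1 il.2) //= tnth_mktuple eqxx big1 ?addr0 // => l hl.
by rewrite tnth_mktuple ifN ?mulr0z.
Qed.

Lemma sum_occurrences F j (f : 'I_d * 'I_m -> A) :
  \sum_(il <- occurrences F j) f il =
  \sum_il f il *+ (if 0 <= F (coef j il.1 il.2) then `|coef j il.1 il.2|%N
    else 0%N).
Proof.
rewrite /occurrences big_flatten /= big_map big_enum /=; apply: eq_bigr => il _.
by rewrite big_nseq iter_addr_0.
Qed.

Lemma satisfies_cst u c b :
  satisfies (int_comb gs) u (cst_system c b) <-> tup u b =
    [tuple \sum_(i < d) tnth (xs i) j *~ nth 0 c i | j < n].
Proof.
have E j : \sum_(i < d) tnth (xs i) j *~ nth 0 c i =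
    \sum_(il <- occurrences id j) tnth gs il.2 *~ nth 0 c il.1 -
    \sum_(il <- occurrences -%R j) tnth gs il.2 *~ nth 0 c il.1.
  rewrite !sum_occurrences -sumrB /=.
  rewrite [RHS](eq_bigr (fun il => tnth gs il.2 *~ coef j il.1 il.2
    *~ nth 0 c il.1)).
    rewrite -(pair_bigA _ (fun i l => tnth gs l *~ coef j i l *~ nth 0 c i)) /=.
    apply: eq_bigr => i _; rewrite -[in LHS](coordinatesK (tnth (xs i) j)).
    by rewrite /int_comb -mulrz_suml.
  move=> [i l] _ /=; rewrite -!mulrzA [_ * nth 0 c i]mulrC !mulrzA.
  set z := tnth gs l *~ _; case: (coef j i l) => k /=.
    by case: k => [|k]; rewrite ?mulr0n ?subr0 // oppr_ge0 /= subr0.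
  by rewrite sub0r.
pose rhs := [tuple \sum_(i < d) tnth (xs i) j *~ nth 0 c i | j < n].
have E' (j : 'I_n) : u (Kb * b + j)%N = tnth rhs j <->
    eval (int_comb gs) u (cst_sum c (occurrences -%R j) (TVar (Kb * b + j)%N)) =
    eval (int_comb gs) u (cst_sum c (occurrences id j) (TCst (nseq_tuple m 0))).
  rewrite !eval_cst_sum tnth_mktuple E /= [int_comb gs _]big1 => [|l _].
    by split=> [->|H]; [rewrite addr0 addrC subrK | rewrite -[in RHS](addr0 (bigop _ _ _)) -H addrAC subrr add0r].
  by rewrite tnth_nseq mulr0z.
rewrite /cst_system; split=> [h|h].
  apply: eq_from_tnth => j; rewrite tnth_mktuple; apply/E'.
  have : j \in enum 'I_n by rewrite mem_enum.
  elim: (enum _) h => //= j' l IH [h1 h2]; rewrite inE => /orP[/eqP->|] //.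
  exact: IH.
elim: (enum _) => //= j l IH; split=> //; apply/E'.
by rewrite /rhs -h tnth_mktuple.
Qed.

Definition sum_word (w : word) (L : seq ('I_d * 'I_m)) (t : word) : word :=
  foldr (fun (il : 'I_d * 'I_m) acc => SAdd :: SCst :: nseq il.2 SPos ++
    (int_head (iter il.1 int_tail w) ++ (nseq (m - il.2.+1) SPos ++ acc))) t L.

Definition cst_word (w : word) (b : nat) : word :=
  flatten [seq SEqn ::
    (sum_word w (occurrences -%R j) (SVar :: unary (Kb * b + j)%N) ++
     sum_word w (occurrences id j) (SCst :: nseq m SPos)) | j <- enum 'I_n].

(** Zero is encoded by its sign alone, as it has no binary digits; this is why zero coordinates are
    written as [SPos]. *)
Lemma flatten_zero k : flatten (nseq k (encode_int 0)) = nseq k SPos.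
Proof. by elim: k => //= k <-. Qed.

Lemma encode_unit_tuple c i (l : 'I_m) :
  flatten (map encode_int (unit_tuple c i l)) =
  nseq l SPos ++ (encode_int (nth 0 c i) ++ nseq (m - l.+1) SPos).
Proof.
have -> : unit_tuple c i l = nseq l 0 ++ nth 0 c i :: nseq (m - l.+1) 0 :> seq _.
  apply: (@eq_from_nth _ 0) => [|j].
    by rewrite size_tuple size_cat /= !size_nseq addnS -addSn subnKC.
  rewrite size_tuple => hj.
  rewrite -(tnth_nth 0 _ (Ordinal hj)) tnth_mktuple /= nth_cat size_nseq.
  case: (ltngtP j l) => [jl|jl|->]; last by rewrite subnn.
    by rewrite nth_nseq jl.
  by rewrite -(subnKC jl) addSnnS addKn /= nth_nseq if_same.
rewrite map_cat flatten_cat map_cons /= !map_nseq.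
by rewrite !flatten_zero.
Qed.

Lemma encode_cst_sum (c : d.-tuple int) w L t : no_digit w ->
  sum_word (flatten (map encode_int c) ++ w) L (encode_term t) =
  encode_term (cst_sum c L t).
Proof.
move=> hw; elim: L => // il L IH; set u := flatten _ ++ w.
have -> : sum_word u (il :: L) (encode_term t) = SAdd :: SCst ::
    (nseq il.2 SPos ++ (int_head (iter il.1 int_tail u) ++
      (nseq (m - il.2.+1) SPos ++ sum_word u L (encode_term t)))) by [].
rewrite IH int_head_nth ?size_tuple //=.
by rewrite encode_unit_tuple -!catA.
Qed.

Lemma encode_cst_system (c : d.-tuple int) w b : no_digit w ->
  cst_word (flatten (map encode_int c) ++ w) b = encode_system (cst_system c b).
Proof.
move=> hw; rewrite /cst_word /cst_system /encode_system -map_comp.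
congr flatten; apply: eq_map => j /=; rewrite -!(encode_cst_sum _ _ _ hw) /=.
congr (_ :: _ ++ sum_word _ _ (_ :: _)).
by rewrite map_nseq flatten_zero.
Qed.

(** The equations of a symbol depend only on the suffix behind it, which determines its own block
    and, through [stk], the blocks of its arguments. So one pass over the input is enough. *)
Definition emit (a : symbol) (w : word) : word :=
  match a with
  | SVar => encode_system (instantiate 1 SX (fun=> 2 * top w)%N (pos_block w))
  | SCst => cst_word w (pos_block w)
  | SAdd => encode_system (instantiate 3 SA (nth 0%N
      [:: top (stk w); top (pop (stk w)); pos_block w]) (pos_block w))
  | SMul => encode_system (instantiate 3 SM (nth 0%N
      [:: top (stk w); top (pop (stk w)); pos_block w]) (pos_block w))
  | SEqn => encode_system (instantiate 2 SE (nth 0%N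
      [:: top (stk w); top (pop (stk w))]) (pos_block w))
  | _ => [::]
  end.

Definition reduce : word -> word := wrec (fun a w acc => emit a w ++ acc) [::].

Lemma reduceE a w : reduce (a :: w) = emit a w ++ reduce w.
Proof. by []. Qed.

Lemma cmp_sum_word B k f g L : cmp B k f -> cmp B k g ->
  cmp B k (fun e => sum_word (f e) L (g e)).
Proof.
move=> cf cg; elim: L => // il L IH.
apply: (@cmp_cons _ SAdd); apply: (@cmp_cons _ SCst).
apply: cmp_cat; first exact: cmp_const.
apply: cmp_cat; first by apply: cmp_int_head; apply: cmp_int_tail.
by apply: cmp_cat; first exact: cmp_const.
Qed.

Lemma cmp_emit B k a f : cmp B k f -> cmp B k (fun e => emit a (f e)).
Proof.
move=> cf; have cp := ncmp_pos_block cf; have cs := cmp_stk cf.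
have c1 := ncmp_top cs; have c2 := ncmp_top (cmp_pop cs).
have c3 b : ncmp B k (fun e => nth 0%N
    [:: top (stk (f e)); top (pop (stk (f e))); pos_block (f e)] b).
  by case: b => [|[|[|b]]] //=; rewrite nth_nil; exact: ncmp_const.
have c4 b : ncmp B k (fun e => nth 0%N
    [:: top (stk (f e)); top (pop (stk (f e)))] b).
  by case: b => [|[|b]] //=; rewrite nth_nil; exact: ncmp_const.
case: a => /=; do ?[exact: cmp_nil].
- rewrite /cst_word; elim: (enum _) => [|j l IH] /=; first exact: cmp_nil.
  apply: (@cmp_cons _ SEqn); apply: cmp_cat => //; apply: cmp_cat.
    apply: cmp_sum_word => //; apply: cmp_cons.
    exact: ncmp_add (ncmp_mull _ cp) (ncmp_const _ _ _).
  by apply: cmp_sum_word => //; exact: cmp_const.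
- apply: cmp_instantiate => // _.
  by apply: ncmp_mull; apply: ncmp_top.
- exact: cmp_instantiate c3 cp.
- exact: cmp_instantiate c3 cp.
- exact: cmp_instantiate c4 cp.
Qed.

Lemma cmp_reduce B : cmp B 1 (fun e => reduce (nth [::] e 0)).
Proof.
have /choice[Q hQ] : forall a, exists Q, polym Q /\
    forall w, B -> (size (emit a w) <= Q (size w))%N.
  move=> a; have c0 : cmp B 1 (fun e => nth [::] e 0) by apply: cmp_nth.
  have [Q mQ hQ] := cmp_size (cmp_emit a c0); exists Q; split=> // w b.
  by have := hQ [:: w] b erefl; rewrite /total /= addn0.
apply: (@cmp_wrec _ _ _ _ (fun a _ w acc => emit a w ++ acc)
  (fun n => sumn [seq Q a n | a <- symbols])) => //.
- exact: cmp_nth.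
- exact: cmp_nil.
- by move=> a; apply: cmp_cat; [apply: cmp_emit; apply: cmp_nth | apply: cmp_nth].
- elim: symbols => [|a l IH] /=; first polym_auto.
  by apply: polym_add => //; case: (hQ a).
move=> a e w acc b he; rewrite size_cat addnC leq_add2l.
have [[mQ _] hQa] := hQ a; apply: leq_trans (hQa w b) _.
apply: leq_trans (mQ _ (total e + size w)%N (leq_addl _ _)) _.
by case: a {mQ hQa} => /=; lia.
Qed.

(** The output of [reduce] described on terms instead of words: solvability is studied here, and
    [reduce_system] carries the result over to the program. *)
Fixpoint translate (t : term (d.-tuple int)) (l : nat) : system (m.-tuple int) :=
  match t with
  | TVar i => instantiate 1 SX (fun=> 2 * i)%N (term_pos t l)
  | TCst c => cst_system c (term_pos t l)
  | TAdd t1 t2 => let l1 := (size (encode_term t2) + l)%N in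
      instantiate 3 SA (nth 0%N
        [:: term_block t1 l1; term_block t2 l; term_pos t l]) (term_pos t l) ++
      (translate t1 l1 ++ translate t2 l)
  | TMul t1 t2 => let l1 := (size (encode_term t2) + l)%N in
      instantiate 3 SM (nth 0%N
        [:: term_block t1 l1; term_block t2 l; term_pos t l]) (term_pos t l) ++
      (translate t1 l1 ++ translate t2 l)
  end.

Fixpoint translate_system (S : system (d.-tuple int)) : system (m.-tuple int) :=
  if S is e :: S' then
    let l := size (encode_system S') in
    let l1 := (size (encode_term e.2) + l)%N in
    instantiate 2 SE (nth 0%N [:: term_block e.1 l1; term_block e.2 l])
      (2 * (size (encode_term e.1) + l1)).+1 ++
    (translate e.1 l1 ++ (translate e.2 l ++ translate_system S'))
  else [::].

Lemma reduce_digits u w : all is_digit u -> reduce (u ++ w) = reduce w.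
Proof. by elim: u => //= a u IH /andP[ha /IH <-]; case: a ha. Qed.

Lemma reduce_ints (c : seq int) w :
  reduce (flatten (map encode_int c) ++ w) = reduce w.
Proof.
elim: c => // z c IH.
have -> : flatten (map encode_int (z :: c)) =
  encode_int z ++ flatten (map encode_int c) by [].
rewrite -catA -IH /encode_int /reduce /=; case: (Order.le _ _) => /=;
  by rewrite -/(reduce _) reduce_digits ?encode_nat_digits.
Qed.

Lemma reduce_term t w : no_digit w ->
  reduce (encode_term t ++ w) =
  encode_system (translate t (size w)) ++ reduce w.
Proof.
elim: t w => [i|c|t1 IH1 t2 IH2|t1 IH1 t2 IH2] w hw; have E := encode_term_cat;
  rewrite E reduceE /emit [translate _ _]/=.
- rewrite top_var // -(term_posE (E d (TVar i) w)).
  by rewrite (reduce_digits w (u := nseq i SOne)) // all_nseq orbT.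
- by rewrite encode_cst_system // reduce_ints -(term_posE (E d (TCst c) w)).
- rewrite !encode_system_cat -!catA IH1 ?no_digit_term // IH2 //.
  by rewrite -(term_posE (E d (TAdd t1 t2) w)) !stk_term ?no_digit_term //
    !(top_push, pop_push) size_cat.
- rewrite !encode_system_cat -!catA IH1 ?no_digit_term // IH2 //.
  by rewrite -(term_posE (E d (TMul t1 t2) w)) !stk_term ?no_digit_term //
    !(top_push, pop_push) size_cat.
Qed.

Lemma reduce_system S :
  reduce (encode_system S) = encode_system (translate_system S).
Proof.
elim: S => // e S IH.
have hS : no_digit (encode_system S) by case: (S).
rewrite encode_system_cons reduceE reduce_term ?no_digit_term // reduce_term //.
rewrite IH /emit !stk_term ?no_digit_term // !(top_push, pop_push).
have -> : translate_system (e :: S) =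
    let l := size (encode_system S) in
    let l1 := (size (encode_term e.2) + l)%N in
    instantiate 2 SE (nth 0%N [:: term_block e.1 l1; term_block e.2 l])
      (2 * (size (encode_term e.1) + l1)).+1 ++
    (translate e.1 l1 ++ (translate e.2 l ++ translate_system S)) by [].
by rewrite !encode_system_cat /pos_block !size_cat.
Qed.

(** * Soundness and completeness of the translation *)

Lemma translate_sound u t l :
  satisfies (int_comb gs) u (translate t l) ->
  X (tup u (term_block t l)) /\
  phi (tup u (term_block t l)) =
    eval (int_comb hs) (fun i => phi (tup u (2 * i))) t.
Proof.
elim: t l => [i|c|t1 IH1 t2 IH2|t1 IH1 t2 IH2] l.
- by move=> /(instantiate_sound hX) /=; split.
- move=> /satisfies_cst; have -> : [tuple \sum_(i < d) tnth (xs i) j *~ nth 0 c i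
    | j < n] = cst_tuple c.
    apply: eq_from_tnth => j; rewrite !tnth_mktuple; apply: eq_bigr => i _.
    by rewrite -(tnth_nth 0 c).
  by rewrite /term_block => ->; split; [exact: xs_X | exact: xs_phi].
- move=> /satisfies_cat[/(instantiate_sound hA) /= [X1 X2 X3 E]].
  move=> /satisfies_cat[/IH1[_ E1] /IH2[_ E2]]; split=> //=.
  by rewrite -E1 -E2.
- move=> /satisfies_cat[/(instantiate_sound hM) /= [X1 X2 X3 E]].
  move=> /satisfies_cat[/IH1[_ E1] /IH2[_ E2]]; split=> //=.
  by rewrite -E1 -E2.
Qed.

Lemma translate_system_sound u S :
  satisfies (int_comb gs) u (translate_system S) ->
  satisfies (int_comb hs) (fun i => phi (tup u (2 * i))) S.
Proof.
elim: S => //= e S IH /satisfies_cat[/(instantiate_sound hE) /= [_ _ E]].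
move=> /satisfies_cat[/translate_sound[_ E1]].
move=> /satisfies_cat[/translate_sound[_ E2] /IH hS]; split=> //.
by rewrite -E1 -E2.
Qed.

Definition agree (P : pred nat) (u u' : nat -> A) : Prop :=
  forall b j, P b -> (j < Kb)%N -> u (Kb * b + j)%N = u' (Kb * b + j)%N.

(* Even blocks hold the variables of [O], and the odd block [2 p + 1] belongs
   to the position [p]. *)
Definition within l h b := ~~ odd b || (l <= b./2 < h)%N.
Definition outside l h b := ~~ odd b || ~~ (l <= b./2 < h)%N.

Definition represents (v : nat -> O) u : Prop :=
  forall i, X (tup u (2 * i)) /\ phi (tup u (2 * i)) = v i.

Lemma agree_tup P u u' b : agree P u u' -> P b -> tup u b = tup u' b.
Proof. by move=> h Pb; apply: tup_ext => j hj; apply: h. Qed.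

Lemma represents_agree v l h u u' : agree (outside l h) u u' ->
  represents v u' -> represents v u.
Proof.
move=> huu hv i; rewrite (agree_tup huu) //.
by rewrite /outside mul2n odd_double.
Qed.

Lemma agree_trans P u1 u2 u3 : agree P u1 u2 -> agree P u2 u3 -> agree P u1 u3.
Proof. by move=> h1 h2 b j Pb hj; rewrite h1 ?h2. Qed.

Lemma agree_sub (P Q : pred nat) u u' :
  subpred P Q -> agree Q u u' -> agree P u u'.
Proof. by move=> PQ h b j /PQ Pb hj; apply: h. Qed.

Lemma within_outside_sub l h l' h' : (h' <= l)%N || (h <= l')%N ->
  subpred (within l h) (outside l' h').
Proof. by move=> lh b; rewrite /within /outside; case: odd => //=; lia. Qed.

Lemma outside_sub l h l' h' : (l <= l')%N -> (h' <= h)%N ->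
  subpred (outside l h) (outside l' h').
Proof. by move=> lh hh b; rewrite /outside; case: odd => //=; lia. Qed.

Lemma within_sub l h l' h' : (l <= l')%N -> (h' <= h)%N ->
  subpred (within l' h') (within l h).
Proof. by move=> lh hh b; rewrite /within; case: odd => //=; lia. Qed.

Lemma within_term_block (t : term (d.-tuple int)) l h : (l + size (encode_term t) <= h)%N ->
  within l h (term_block t l).
Proof.
have := size_encode_term_gt0 t.
case: t => [i _ _|c|t1 t2|t1 t2]; rewrite /within /term_block /term_pos ?mul2n
  ?odd_double //= uphalf_double; move: (size _) => k; lia.
Qed.

(** The assignment for a term is built from those of its subterms one after the other. Asking for
    stability under all changes outside the positions of [t] ensures that a later choice does not
    undo an earlier one. *)
Definition translated v t l u : Prop :=
  forall u', agree (within l (l + size (encode_term t))) u' u ->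
  [/\ satisfies (int_comb gs) u' (translate t l), X (tup u' (term_block t l))
    & phi (tup u' (term_block t l)) = eval (int_comb hs) v t].

(** Positions are counted from the end of the word: [t2] occupies the lowest ones, then comes [t1],
    and the operator has the position [p] past both. The three sets of blocks are disjoint except
    for the even ones, which no step modifies. *)
Lemma translate_op S R (op : O -> O -> O) v t1 t2 l h u0 :
  specifies 3 S R -> (system_bound S <= Kb)%N ->
  (forall x y z, R [:: x; y; z] <->
     [/\ X x, X y, X z & op (phi x) (phi y) = phi z]) ->
  let l1 := (size (encode_term t2) + l)%N in
  let p := (2 * (size (encode_term t1) + l1)).+1 in
  (size (encode_term t1) + l1 < h)%N ->
  (forall t l u0, (t = t1 \/ t = t2) -> represents v u0 -> exists u,
    agree (outside l (l + size (encode_term t))) u u0 /\ translated v t l u) ->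
  represents v u0 -> exists u,
  agree (outside l h) u u0 /\
  forall u', agree (within l h) u' u ->
  [/\ satisfies (int_comb gs) u' (instantiate 3 S (nth 0%N
        [:: term_block t1 l1; term_block t2 l; p]) p ++
      (translate t1 l1 ++ translate t2 l)), X (tup u' p)
    & phi (tup u' p) = op (eval (int_comb hs) v t1) (eval (int_comb hs) v t2)].
Proof.
move=> hS bS hR l1 p ph IH hu0.
have [u2 [a2 tr2]] := IH t2 l u0 (or_intror erefl) hu0.
have hu2 := represents_agree a2 hu0.
have [u1 [a1 tr1]] := IH t1 l1 u2 (or_introl erefl) hu2.
have [a aX aE] := phi_surj
  (op (eval (int_comb hs) v t1) (eval (int_comb hs) v t2)).
have odd_p : odd p by rewrite /p /= mul2n odd_double.
have half_p : p./2 = (size (encode_term t1) + l1)%N.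
  by rewrite /p /= mul2n uphalf_double.
have wp l' h' : (h' <= size (encode_term t1) + l1)%N -> forall b,
    within l' h' b -> b != p.
  move=> hl b wb; apply: contraTneq wb => ->.
  by rewrite /within odd_p half_p /=; lia.
have e1 : (l1 + size (encode_term t1) <= size (encode_term t1) + l1)%N by lia.
have e2 : (l + size (encode_term t2) <= size (encode_term t1) + l1)%N.
  by rewrite /l1; lia.
have bp1 : term_block t1 l1 != p by apply: wp e1 _ (within_term_block (leqnn _)).
have bp2 : term_block t2 l != p by apply: wp e2 _ (within_term_block (leqnn _)).
have a12 : agree (within l (l + size (encode_term t2))) u1 u2.
  apply: agree_sub a1; apply: within_outside_sub.
  by rewrite /l1; lia.
have [_ X1 E1] := tr1 u1 (fun _ _ _ _ => erefl).
have [_ X2 E2] := tr2 u1 a12.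
set bs := nth 0%N _.
have /(@instantiate_complete 3 S R bs p u1 a isT hS bS) :
    R [seq tup (set_block u1 p (nth 0 a)) (bs b) | b <- iota 0 3].
  rewrite /= (tup_set_block_ne _ _ bp1) (tup_set_block_ne _ _ bp2) (@tup_set_block _ _ a) //.
  by apply/hR; split=> //; rewrite E1 E2 aE.
move=> [u [au tu su]].
have aup (Q : pred nat) : (forall b, Q b -> b != p) -> agree Q u u1.
  by move=> Qp b j /Qp bp hj; rewrite au.
exists u; split.
  apply: agree_trans (aup _ _) _.
    move=> b; apply: contraTneq => ->.
    by rewrite /outside odd_p half_p /= /l1; lia.
  apply: agree_trans (agree_sub _ a1) (agree_sub _ a2).
    by apply: outside_sub; rewrite /l1; lia.
  by apply: outside_sub; lia.
move=> u' hu'.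
have ws1 : subpred (within l1 (l1 + size (encode_term t1))) (within l h).
  by apply: within_sub; rewrite /l1; lia.
have ws2 : subpred (within l (l + size (encode_term t2))) (within l h).
  by apply: within_sub; lia.
have au1 : agree (within l1 (l1 + size (encode_term t1))) u' u1.
  by apply: agree_trans (agree_sub ws1 hu') (aup _ (wp _ _ e1)).
have au2 : agree (within l (l + size (encode_term t2))) u' u2.
  by apply: agree_trans (agree_trans (agree_sub ws2 hu') (aup _ (wp _ _ e2))) a12.
have [s1 X1' E1'] := tr1 u' au1; have [s2 X2' E2'] := tr2 u' au2.
have wpp : within l h p by rewrite /within odd_p half_p /= ph /l1; lia.
have tup_p : tup u' p = a by rewrite (agree_tup hu' wpp) tu.
split; rewrite ?tup_p //; apply/satisfies_cat; split; last first.
  by apply/satisfies_cat.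
apply: su => [b hb|j hj]; last exact: hu'.
apply: (agree_tup hu').
have w1 := ws1 _ (within_term_block (leqnn (l1 + size (encode_term t1)))).
have w2 : within l h (term_block t2 l) by apply: within_term_block; lia.
by case: b hb => [|[|[|b]]].
Qed.

Lemma within_pos l h p : (l <= p < h)%N -> within l h (2 * p).+1.
Proof. by rewrite /within /= mul2n odd_double uphalf_double. Qed.

Lemma outside_pos l h p b : (l <= p < h)%N -> outside l h b -> b != (2 * p).+1.
Proof.
move=> hp; apply: contraTneq => ->.
by rewrite /outside /= mul2n odd_double uphalf_double hp.
Qed.

Lemma term_pos_range (t : term (d.-tuple int)) l :
  (l <= l + (size (encode_term t)).-1 < l + size (encode_term t))%N.
Proof. by have := size_encode_term_gt0 t; lia. Qed.

Lemma translate_complete v t l u0 : represents v u0 -> exists u,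
  agree (outside l (l + size (encode_term t))) u u0 /\ translated v t l u.
Proof.
elim: t l u0 => [i|c|t1 IH1 t2 IH2|t1 IH1 t2 IH2] l u0 hu0.
- set t := TVar i; have pr := term_pos_range t l.
  have ip : (2 * i)%N != term_pos t l by rewrite /term_pos; lia.
  have [X0 E0] := hu0 i.
  have : isX [seq tup (set_block u0 (term_pos t l) (nth 0 (cst_tuple (nseq_tuple d 0))))
      ((fun=> 2 * i)%N b) | b <- iota 0 1].
    by rewrite /= tup_set_block_ne.
  move=> /(@instantiate_complete 1 SX isX _ _ u0 _ isT hX bX)[u [au tu su]].
  exists u; split=> [b j /(outside_pos pr) bp hj|u' hu']; first exact: au.
  have wi : within l (l + size (encode_term t)) (2 * i)%N.
    by rewrite /within mul2n odd_double.
  have -> : tup u' (term_block t l) = tup u0 (2 * i)%N.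
    rewrite (agree_tup hu' wi); apply: tup_ext => j hj.
    exact: au.
  split=> //; apply: su => [b _|j hj]; first exact: agree_tup hu' wi.
  by apply: hu' => //; apply: within_pos pr.
- set t := TCst c; have pr := term_pos_range t l.
  exists (set_block u0 (term_pos t l) (nth 0 (cst_tuple c))).
  split=> [b j /(outside_pos pr) bp hj|u' hu']; first exact: set_block_ne.
  have E : tup u' (term_block t l) = cst_tuple c.
    by rewrite (agree_tup hu' (within_pos pr)) (@tup_set_block _ _ (cst_tuple c)).
  split; rewrite ?E //=; apply/satisfies_cst; rewrite -[term_pos _ _]/(term_block t l) E.
  apply: eq_from_tnth => j; rewrite !tnth_mktuple; apply: eq_bigr => i _.
  by rewrite -(tnth_nth 0 c).
- have IH t' l' u' : t' = t1 \/ t' = t2 -> represents v u' -> exists u,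
      agree (outside l' (l' + size (encode_term t'))) u u' /\ translated v t' l' u.
    by move=> [->|->]; [apply: IH1 | apply: IH2].
  have E : (size (encode_term t1) + (size (encode_term t2) + l))%N =
    (l + (size (encode_term (TAdd t1 t2))).-1)%N by rewrite /= size_cat; lia.
  have lt : (size (encode_term t1) + (size (encode_term t2) + l) <
    l + size (encode_term (TAdd t1 t2)))%N by rewrite /= size_cat; lia.
  have := @translate_op SA isA +%R v t1 t2 l _ u0 hA bA (fun _ _ _ => iff_refl _)
    lt IH hu0.
  by rewrite /= E.
- have IH t' l' u' : t' = t1 \/ t' = t2 -> represents v u' -> exists u,
      agree (outside l' (l' + size (encode_term t'))) u u' /\ translated v t' l' u.
    by move=> [->|->]; [apply: IH1 | apply: IH2].
  have E : (size (encode_term t1) + (size (encode_term t2) + l))%N =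
    (l + (size (encode_term (TMul t1 t2))).-1)%N by rewrite /= size_cat; lia.
  have lt : (size (encode_term t1) + (size (encode_term t2) + l) <
    l + size (encode_term (TMul t1 t2)))%N by rewrite /= size_cat; lia.
  have := @translate_op SM isM (@na_mul O) v t1 t2 l _ u0 hM bM
    (fun _ _ _ => iff_refl _) lt IH hu0.
  by rewrite /= E.
Qed.

Lemma translate_system_complete v S u0 : represents v u0 ->
  satisfies (int_comb hs) v S -> exists u,
  agree (outside 0 (size (encode_system S))) u u0 /\
  forall u', agree (within 0 (size (encode_system S))) u' u ->
    satisfies (int_comb gs) u' (translate_system S).
Proof.
move=> hu0; elim: S => [_|e S IH [Ee /IH[uS [aS sS]]]]; first by exists u0.
set l := size (encode_system S) in aS sS *.
set l1 := (size (encode_term e.2) + l)%N.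
set l2 := (size (encode_term e.1) + l1)%N.
have Esize : size (encode_system (e :: S)) = l2.+1.
  by rewrite encode_system_cons /= !size_cat.
have [u2 [a2 tr2]] := translate_complete e.2 l (represents_agree aS hu0).
have hu2 := represents_agree a2 (represents_agree aS hu0).
have [u1 [a1 tr1]] := translate_complete e.1 l1 hu2.
have a12 : agree (within l (l + size (encode_term e.2))) u1 u2.
  by apply: agree_sub a1; apply: within_outside_sub; rewrite /l1; lia.
have a1S : agree (within 0 l) u1 uS.
  apply: agree_trans (agree_sub _ a1) (agree_sub _ a2);
    by apply: within_outside_sub; rewrite /l1; lia.
have [_ X1 E1] := tr1 u1 (fun _ _ _ _ => erefl).
have [_ X2 E2] := tr2 u1 a12.
have pr : (0 <= l2 < l2.+1)%N by rewrite ltnSn.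
set p := (2 * l2).+1.
have wp l' h' : (h' <= l2)%N -> forall b, within l' h' b -> b != p.
  move=> hl b wb; apply: contraTneq wb => ->.
  by rewrite /within /p /= mul2n odd_double uphalf_double /=; lia.
have e1 : (l1 + size (encode_term e.1) <= l2)%N by rewrite /l2; lia.
have e2 : (l + size (encode_term e.2) <= l2)%N by rewrite /l2 /l1; lia.
have e3 : (l <= l2)%N by rewrite /l2 /l1; lia.
have w1 := within_term_block (leqnn (l1 + size (encode_term e.1))).
have w2 := within_term_block (leqnn (l + size (encode_term e.2))).
set bs := nth 0%N [:: term_block e.1 l1; term_block e.2 l].
have : isE [seq tup (set_block u1 p (nth 0 (cst_tuple (nseq_tuple d 0)))) (bs b)
    | b <- iota 0 2].
  rewrite /= (tup_set_block_ne _ _ (wp _ _ e1 _ w1)).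
  by rewrite (tup_set_block_ne _ _ (wp _ _ e2 _ w2)); split; rewrite ?E1 ?E2.
move=> /(@instantiate_complete 2 SE isE _ _ u1 _ isT hE bE)[u [au tu su]].
have aup (Q : pred nat) : (forall b, Q b -> b != p) -> agree Q u u1.
  by move=> Qp b j /Qp bp hj; rewrite au.
rewrite Esize; exists u; split.
  apply: agree_trans (aup _ (fun b => outside_pos pr)) _.
  apply: agree_trans (agree_sub _ a1) _.
    by apply: outside_sub; rewrite // /l1 /l2; lia.
  apply: agree_trans (agree_sub _ a2) (agree_sub _ aS);
    by apply: outside_sub; rewrite // /l2 /l1; lia.
move=> u' hu'.
have ws l' h' : (h' <= l2)%N -> subpred (within l' h') (within 0 l2.+1).
  by move=> hh; apply: within_sub => //; apply: leq_trans hh _.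
have agu l' h' : (h' <= l2)%N -> agree (within l' h') u' u1.
  move=> hh; apply: agree_trans (agree_sub (ws _ _ hh) hu') (aup _ _).
  exact: wp.
have [s1 _ _] := tr1 u' (agu _ _ e1).
have [s2 _ _] := tr2 u' (agree_trans (agu _ _ e2) a12).
have s3 := sS u' (agree_trans (agu _ _ e3) a1S).
have -> : translate_system (e :: S) =
    instantiate 2 SE bs p ++
    (translate e.1 l1 ++ (translate e.2 l ++ translate_system S)) by [].
apply/satisfies_cat; split; last first.
  by apply/satisfies_cat; split=> //; apply/satisfies_cat.
apply: su => [b hb|j hj]; last by apply: hu' => //; apply: within_pos.
have aw b' l' h' : (h' <= l2)%N -> within l' h' b' -> tup u' b' = tup u b'.
  by move=> hh wb; apply: (agree_tup hu'); apply: ws hh _ wb.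
case: b hb => [|[|b]] // _; [exact: aw e1 w1 | exact: aw e2 w2].
Qed.

Lemma represents_exists v : exists u, represents v u.
Proof.
have /choice[r hr] i : exists x, X x /\ phi x = v i.
  by have [x Xx Ex] := phi_surj (v i); exists x.
have Kb0 : (0 < Kb)%N by apply: leq_ltn_trans n_le_Kb.
exists (fun y => nth 0 (r (y %/ Kb)./2) (y %% Kb)%N) => i.
set u := fun y => _; have -> : tup u (2 * i) = r i; last exact: hr.
apply: eq_from_tnth => j; rewrite tnth_mktuple.
rewrite /u [(Kb * _)%N]mulnC divnMDl // divn_small ?ltn_ordKb // addn0 mul2n.
rewrite doubleK.
by rewrite modnMDl modn_small ?ltn_ordKb // (tnth_nth 0).
Qed.

Lemma additive_interpretation_karp :
  karp_reducible (diophantine hs) (diophantine gs).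
Proof.
have [p [P [[mP [c [e hP]]] hp]]] := cmp_reduce True.
(* The program [p] keeps its input on stack 0 and leaves its output on stack 1. *)
exists (Seq p (Seq (clear (0 + 0)) (move (0 + 1) (0 + 0) (0 + 2)))).
(* The bound of [p] counts once for its run and 26 times for moving its output; [28 = 2 + 26] covers
   clearing the input and the constant cost of the move. *)
exists (27 * c + 28)%N, e.+1 => S; exists (translate_system S).
set x := encode _; set n0 := size x.
have := hp [:: x] erefl; rewrite /total /= addn0 => H1.
have sz := run_result_size I H1.
have H2 := @run_clear_st True 0 [::] [:: x; reduce x] 0 erefl.
have H3 := @run_move_st True 0 [::] [:: [::]; reduce x] 1 0 2 erefl
  erefl erefl erefl erefl.
have [t ht hT] := run_seq H1 (run_seq H2 H3).
exists t; split.
- exists (st [:: reduce x ++ [::]; [::]]); split.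
    2: by rewrite /st /= cats0; exact: reduce_system.
  move: ht; rewrite /=; congr exec.
  by apply/funext => -[|[|i]].
- apply: leq_trans (hT I) _.
  have pos : (0 < n0.+1 ^ e)%N by rewrite expn_gt0.
  have h1 := hP n0; have h2 := leq_trans sz (hP n0).
  rewrite expnS -/n0; rewrite -/n0 in h2; set y := (n0.+1 ^ e)%N in pos h1 h2 *.
  have h3 : (y <= n0.+1 * y)%N by rewrite leq_pmull.
  have h4 : (n0.+1 <= n0.+1 * y)%N by rewrite leq_pmulr.
  have h5 : (c * y <= c * (n0.+1 * y))%N by rewrite leq_mul2l h3 orbT.
  set z := (n0.+1 * y)%N in h3 h4 h5 *; rewrite mulnDl -mulnA.
  by rewrite /= -/n0; lia.
- split=> [[v /translate_system_complete hv]|[u /translate_system_sound hu]].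
    have [u0 hu0] := represents_exists v; have [u [_ hu]] := hv _ hu0.
    by exists u; apply: hu.
  by exists (fun i => phi (tup u (2 * i))).
Qed.

End Reduction.

(** * Finitely generated abelian groups *)

Section FinitelyGenerated.
Local Open Scope ring_scope.

Lemma is_subgroupN (V : zmodType) (H : set V) x :
  is_subgroup H -> H x -> H (- x).
Proof. by move=> [H0 HB] Hx; rewrite -sub0r; apply: HB. Qed.

Lemma is_subgroupD (V : zmodType) (H : set V) x y :
  is_subgroup H -> H x -> H y -> H (x + y).
Proof.
move=> sH Hx Hy; rewrite -[y]opprK; apply: (proj2 sH) => //.
exact: is_subgroupN.
Qed.

Lemma is_subgroup_sum (V : zmodType) (H : set V) I (r : seq I) (P : pred I) F :
  is_subgroup H -> (forall i, P i -> H (F i)) -> H (\sum_(i <- r | P i) F i).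
Proof.
move=> sH HF; apply: big_ind => //; first by case: sH.
by move=> x y; apply: is_subgroupD.
Qed.

Lemma is_subgroupMz (V : zmodType) (H : set V) x (z : int) :
  is_subgroup H -> H x -> H (x *~ z).
Proof.
move=> sH Hx; have HMn n : H (x *+ n).
  elim: n => [|n IH]; first by rewrite mulr0n; case: sH.
  by rewrite mulrS; apply: is_subgroupD.
case: z => n; first by rewrite -pmulrn.
by rewrite NegzE mulrNz -pmulrn; apply: is_subgroupN.
Qed.

Definition comb (V : zmodType) n (g : 'I_n -> V) (x : 'rV[int]_n) : V :=
  \sum_i g i *~ x 0 i.

Lemma combD V n g : {morph @comb V n g : x y / x + y}.
Proof.
move=> x y; rewrite /comb -big_split; apply: eq_bigr => i _.
by rewrite mxE mulrzDr.
Qed.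

Lemma combB V n g : {morph @comb V n g : x y / x - y}.
Proof.
move=> x y; rewrite /comb -sumrB; apply: eq_bigr => i _.
by rewrite !mxE mulrzBr.
Qed.

Lemma comb_morph (V W : zmodType) (f : V -> W) n (g : 'I_n -> V) x :
  (forall y z, f (y - z) = f y - f z) -> f (comb g x) = comb (f \o g) x.
Proof.
move=> fB; pose fA : {additive V -> W} :=
  HB.pack f (GRing.isZmodMorphism.Build V W f fB).
transitivity (\sum_i fA (g i *~ x 0 i)); first exact: (raddf_sum fA).
by apply: eq_bigr => i _; exact: (raddfMz fA).
Qed.

(** The maps in question are additive on the subgroup of scalars and arbitrary elsewhere, so
    additivity cannot be assumed on all of [V]. *)
Lemma comb_morph_in (V W : zmodType) (H : set V) (f : V -> W) n (g : 'I_n -> V) c :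
  is_subgroup H -> (forall y z, H y -> H z -> f (y - z) = f y - f z) ->
  (forall i, H (g i)) -> f (comb g c) = comb (f \o g) c.
Proof.
move=> sH fB Hg; have H0 : H 0 by case: sH.
have f0 : f 0 = 0 by rewrite -[in LHS](subrr (0 : V)) fB // subrr.
have fN x : H x -> f (- x) = - f x by move=> Hx; rewrite -sub0r fB // f0 sub0r.
have fD x y : H x -> H y -> f (x + y) = f x + f y.
  by move=> Hx Hy; rewrite -{1}[y]opprK fB ?fN ?opprK //; apply: is_subgroupN.
have fMz x z : H x -> f (x *~ z) = f x *~ z.
  move=> Hx; have fMn k : f (x *+ k) = f x *+ k.
    elim: k => [|k IH]; first by rewrite !mulr0n.
    by rewrite !mulrS fD ?IH //; apply: (is_subgroupMz k sH).
  case: z => z; first by rewrite -!pmulrn.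
  by rewrite NegzE !mulrNz fN ?fMn //; apply: (is_subgroupMz z.+1 sH).
suff [] : H (comb g c) /\ f (comb g c) = comb (f \o g) c by [].
apply: (@big_rec2 _ _ (fun y x => H x /\ f x = y)) => // i y x _ [Hx <-].
have Hgi := is_subgroupMz (c 0 i) sH (Hg i).
by split; [exact: is_subgroupD | rewrite fD // fMz].
Qed.

Lemma mulmx_comb n k (x : 'rV[int]_k) (M : 'M[int]_(k, n)) :
  x *m M = comb (fun i => row i M) x.
Proof.
rewrite mulmx_sum_row; apply: eq_bigr => i _.
by rewrite -[x 0 i in LHS]intz scaler_int.
Qed.

Lemma eq_comb (V : zmodType) n (g g' : 'I_n -> V) x :
  g =1 g' -> comb g x = comb g' x.
Proof. by move=> gg; apply: eq_bigr => i _; rewrite gg. Qed.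

Lemma comb_mulmx (V : zmodType) n k (g : 'I_n -> V) (x : 'rV_k) (M : 'M[int]_(k, n)) :
  comb g (x *m M) = comb (fun i => comb g (row i M)) x.
Proof.
rewrite /comb; under eq_bigr do rewrite mxE mulrz_sumr.
rewrite exchange_big /=; apply: eq_bigr => i _; rewrite mulrz_suml.
by apply: eq_bigr => j _; rewrite mxE mulrC mulrzA.
Qed.

Lemma int_combE (V : zmodType) n (g : n.-tuple V) (c : n.-tuple int) :
  int_comb g c = comb (tnth g) (\row_i tnth c i).
Proof. by apply: eq_bigr => i _; rewrite mxE. Qed.

Lemma generatesE (V : zmodType) n (g : n.-tuple V) :
  generates g <-> forall x, exists c, x = comb (tnth g) c.
Proof.
split=> h x; have [c ->] := h x.
  by exists (\row_i tnth c i); rewrite int_combE.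
exists [tuple c 0 i | i < n]; rewrite int_combE; congr comb.
by apply/rowP => i; rewrite mxE tnth_mktuple.
Qed.

Lemma int_subgroup_principal (I : set int) : is_subgroup I ->
  exists d, I d /\ forall z, I z -> exists q, z = q * d.
Proof.
move=> sI; have [I0 _] := sI.
have [[n [n_gt0 In]]|nI] := pselect (exists n : nat, (0 < n)%N /\ I n%:Z); last first.
  exists 0; split=> // z Iz; exists 0; rewrite mul0r; apply: contrapT => z0.
  apply: nI; exists `|z|%N; split; first by rewrite absz_gt0; apply/eqP.
  by case: z Iz {z0} => // k; rewrite NegzE => /(is_subgroupN sI); rewrite opprK.
have exn : exists n, `[< (0 < n)%N /\ I n%:Z >] by exists n; apply/asboolP.
case: (ex_minnP exn) => d /asboolP[d_gt0 Id] dmin.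
exists d%:Z; split=> // z Iz; exists (z %/ d%:Z)%Z.
have Ir : I (z %% d%:Z)%Z.
  rewrite /modz; apply: (proj2 sI) => //; rewrite mulrC -mulrzz.
  exact: is_subgroupMz.
have d0 : d%:Z != 0 by lia.
have := divz_eq z d%:Z; suff -> : (z %% d%:Z)%Z = 0 by rewrite addr0.
apply: contrapT => r0; have r_ge0 := modz_ge0 z d0.
have r_lt : (z %% d%:Z < d%:Z)%Z by apply: ltz_pmod; lia.
case E : (z %% d)%Z Ir r_ge0 r_lt r0 => [k|k] // Ik _ kd k0.
have := dmin k; suff : `[< (0 < k)%N /\ I k%:Z >] by move=> h /(_ h); lia.
by apply/asboolP; split=> //; lia.
Qed.

(** The first coordinates of [H] form a principal ideal. Subtracting a multiple of an element whose
    first coordinate generates it leaves a vector of [H] with first coordinate zero, to which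
    induction applies. *)
Lemma subgroup_rV_fin_gen n (H : set 'rV[int]_n) : is_subgroup H ->
  exists k (M : 'M[int]_(k, n)), forall x, H x <-> exists c, x = c *m M.
Proof.
elim: n H => [|n IH] H sH.
  exists 0%N, 0 => x; have -> : x = 0 by apply/rowP => -[].
  by split=> _; [exists 0; rewrite mul0mx | case: sH].
have sI : is_subgroup [set z | exists2 x, H x & x 0 0 = z].
  split; first by exists 0; [case: sH | rewrite mxE].
  move=> _ _ [x Hx <-] [y Hy <-]; exists (x - y); first exact: (proj2 sH).
  by rewrite !mxE.
have [d [[x0 Hx0 <-] hd]] := int_subgroup_principal sI.
pose H' : set 'rV[int]_n := fun y => H (row_mx (0 : 'M_(1, 1)) y).
have sH' : is_subgroup H'.
  split; first by rewrite /H' /= row_mx0; case: sH.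
  move=> x y; rewrite /H' /= => Hx Hy.
  have -> : row_mx (0 : 'M_(1, 1)) (x - y) = row_mx 0 x - row_mx 0 y.
    by rewrite opp_row_mx add_row_mx oppr0 addr0.
  exact: (proj2 sH).
have [k [M hM]] := IH H' sH'.
have E c : c *m (row_mx (0 : 'M_(k, 1)) M) = row_mx 0 (c *m M) :> 'rV_(1 + n).
  by rewrite mul_mx_row mulmx0.
exists (1 + k)%N, (col_mx x0 (row_mx (0 : 'M_(k, 1)) M)) => x; split=> [Hx|[c ->]].
  have [q hq] := hd (x 0 0) (ex_intro2 _ _ x Hx erefl).
  pose y := x - x0 *~ q.
  have Hy : H y by apply: (proj2 sH) => //; apply: is_subgroupMz.
  have y0 : y = row_mx (0 : 'M_(1, 1)) (rsubmx (y : 'rV_(1 + n))).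
    have l0 : lsubmx (y : 'rV_(1 + n)) = 0.
      apply/rowP => i; rewrite !mxE ord1; have -> : lshift n (0 : 'I_1) = 0.
        exact: val_inj.
      by rewrite hq -scaler_int mxE intz subrr.
    by rewrite -l0 hsubmxK.
  have : H' (rsubmx (y : 'rV_(1 + n))) by rewrite /H' /= -y0.
  move=> /hM[c hc]; exists (row_mx q%:M c).
  rewrite mul_row_col mul_scalar_mx E -hc -y0 /y.
  by rewrite -[q in q *: _]intz scaler_int addrC subrK.
rewrite -[c]hsubmxK mul_row_col.
apply: is_subgroupD => //.
  have -> : lsubmx c = (lsubmx c 0 0)%:M.
    by apply/matrixP => i j; rewrite !ord1 !mxE eqxx mulr1n.
  rewrite mul_scalar_mx -[X in X *: _]intz scaler_int; exact: is_subgroupMz.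
by rewrite E; apply/(hM _); exists (rsubmx c).
Qed.

Lemma subgroup_fin_gen (V : zmodType) (H : set V) : fin_gen V -> is_subgroup H ->
  exists k (h : 'I_k -> V), forall x, H x <-> exists c, x = comb h c.
Proof.
move=> [n [g /generatesE hg]] sH.
pose H' : set 'rV[int]_n := fun x => H (comb (tnth g) x).
have [|k [M hM]] := @subgroup_rV_fin_gen _ H'.
  split; last by move=> x y; rewrite /H' /= combB; apply: (proj2 sH).
  rewrite /H' /= /comb big1; first by case: sH.
  by move=> i _; rewrite mxE.
exists k, (fun i => comb (tnth g) (row i M)) => x; split=> [Hx|[c ->]].
  have [y xy] := hg x; have : H' y by rewrite /H' /= -xy.
  by move=> /hM[c yc]; exists c; rewrite -comb_mulmx -yc.
rewrite -comb_mulmx; have /(_ (c *m M)) [_ ] := hM; apply; by exists c.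
Qed.

(* The order [d j] of the generator [g j] is [0] when it is infinite. *)
Lemma fin_gen_structure (V : zmodType) : fin_gen V ->
  exists n (g : 'I_n -> V) (d : 'I_n -> nat),
    (forall x, exists c, x = comb g c) /\
    (forall c, comb g c = 0 <-> forall i, (d i %| c 0%R i)%Z).
Proof.
move=> [n [g /generatesE hg]].
have [|k [M hM]] := @subgroup_rV_fin_gen n (fun c => comb (tnth g) c = 0).
  split; last by move=> x y; rewrite combB => -> ->; rewrite subr0.
  by rewrite /comb big1 // => i _; rewrite mxE.
have [L Lu [R Ru [d _ ME]]] := int_Smith_normal_form M.
pose D : 'M[int]_(k, n) := \matrix_(i, j) (d`_i *+ (i == j :> nat)).
have D0 (i : 'I_k) (j : 'I_n) : (i == j :> nat) = false -> D i j = 0 by rewrite mxE => ->.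
have D1 (i : 'I_k) (j : 'I_n) : (i == j :> nat) -> D i j = d`_i by rewrite mxE => ->.
(* Beyond the [k] rows of relations there is no diagonal entry, and the generator is free. *)
pose d' (j : 'I_n) := if (j < k)%N then `|(d`_j)%R|%N else 0%N.
pose g' (j : 'I_n) := comb (tnth g) (row j R).
have g'E c : comb g' c = comb (tnth g) (c *m R) by rewrite comb_mulmx.
exists n, g', d'; split=> [x|c].
  have [c ->] := hg x; exists (c *m invmx R).
  by rewrite g'E -mulmxA mulVmx // mulmx1.
rewrite g'E hM; split=> [[y hy] j|h].
  have -> : c = y *m L *m D.
    apply: (can_inj (mulmxK Ru)); rewrite hy ME -!mulmxA; congr (_ *m _).
  rewrite /d' mxE; case: ltnP => jk; last first.
    rewrite big1 // => i _.
    by rewrite D0 ?mulr0 // ltn_eqF // (leq_trans _ jk).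
  rewrite (bigD1 (Ordinal jk)) //= D1 // big1 => [|i ij].
    by rewrite addr0; apply: dvdz_mull; apply: dvdnn.
  rewrite D0 ?mulr0 //; apply/negbTE.
  by apply: contra ij => /eqP ij; apply/eqP/val_inj.
pose y : 'rV[int]_k := \row_i (if insub (val i) is Some j
  then (c 0%R j %/ (d`_i)%R)%Z else 0).
exists (y *m invmx L); rewrite ME !mulmxA mulmxKV //; congr (_ *m _).
apply/rowP => j; rewrite -/D mxE; have := h j; rewrite /d'; case: ltnP => jk.
  move=> hj; rewrite (bigD1 (Ordinal jk)) //= D1 // big1 => [|i ij].
    rewrite addr0 mxE (_ : insub _ = Some j); last exact: (valK j).
    by rewrite divzK //; move: hj; rewrite /dvdz /=.
  rewrite D0 ?mulr0 //; apply/negbTE.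
  by apply: contra ij => /eqP ij; apply/eqP/val_inj.
rewrite dvd0z => /eqP ->; rewrite big1 // => i _.
by rewrite D0 ?mulr0 // ltn_eqF // (leq_trans _ jk).
Qed.

(** * Coordinates and torsion *)

Section Structure.
Variables (V : zmodType) (n : nat) (g : 'I_n -> V) (d : 'I_n -> nat).
Hypothesis g_gen : forall x, exists c, x = comb g c.
Hypothesis g_rel : forall c, comb g c = 0 <-> forall i, (d i %| c 0%R i)%Z.

(** A choice of coordinates: they are determined only modulo [d i], so additivity is available just
    where [d i = 0]. *)
Definition gcoord (x : V) : 'rV[int]_n := projT1 (cid (g_gen x)).

Lemma gcoordK x : comb g (gcoord x) = x.
Proof. by rewrite /gcoord; case: cid. Qed.

Lemma comb_eq c c' :
  comb g c = comb g c' <-> forall i, (d i %| c 0%R i - c' 0%R i)%Z.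
Proof.
split=> [E i|h].
  have := proj1 (g_rel (c - c')); rewrite combB E subrr => /(_ erefl i).
  by rewrite !mxE.
apply/eqP; rewrite -subr_eq0 -combB; apply/eqP/g_rel => i.
by rewrite !mxE h.
Qed.

Lemma free_coordB i x y : d i = 0%N ->
  gcoord (x - y) 0 i = gcoord x 0 i - gcoord y 0 i.
Proof.
move=> di; have : comb g (gcoord (x - y)) = comb g (gcoord x - gcoord y).
  by rewrite combB !gcoordK.
by move=> /comb_eq/(_ i); rewrite di dvd0z !mxE subr_eq0 => /eqP.
Qed.

Definition torsion : set V := fun x => forall i, d i = 0%N -> gcoord x 0 i = 0.

Lemma torsion_subgroup : is_subgroup torsion.
Proof.
split; last by move=> x y hx hy i di; rewrite free_coordB // hx ?hy ?subrr.
by move=> i di; rewrite -{1}(subrr 0) free_coordB // subrr.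
Qed.

Lemma finite_torsion : finite_set torsion.
Proof.
pose D := \max_i d i.
pose F (f : {ffun 'I_n -> 'I_D.+1}) := comb g (\row_i (f i : nat)%:Z).
apply: sub_finite_set (finite_image F (finite_finset (X := setT))) => x hx.
exists [ffun i => inord `|(gcoord x 0%R i %% d i)%Z|] => //.
rewrite -[RHS]gcoordK; apply/comb_eq => i; rewrite mxE ffunE.
have [di|di] := posnP (d i).
  by rewrite di hx // mod0z absz0 inordK // subrr.
have d0 : (d i)%:Z != 0 by lia.
rewrite inordK.
  rewrite gez0_abs ?modz_ge0 // /modz addrAC subrr add0r -mulNr.
  by apply: dvdz_mull; apply: dvdnn.
have := ltz_pmod (gcoord x 0 i) (d := d i) _; have := modz_ge0 (gcoord x 0 i) d0.
have : (d i <= D)%N by exact: leq_bigmax.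
move: (gcoord x 0%R i %% d i)%Z => z h1 h2 h3.
have : z < d i by apply: h3; lia.
lia.
Qed.

End Structure.

Lemma fin_gen_ffun (V : zmodType) n : fin_gen V -> fin_gen {ffun 'I_n -> V}.
Proof.
move=> [m [g /generatesE hg]].
pose G (ij : 'I_n * 'I_m) : {ffun 'I_n -> V} :=
  [ffun i => if i == ij.1 then tnth g ij.2 else 0].
exists #|{: 'I_n * 'I_m}|, [tuple G (enum_val k) | k < #|{: 'I_n * 'I_m}|].
apply/generatesE => x; have /choice[c hc] i := hg (x i).
exists (\row_k c (enum_val k).1 0 (enum_val k).2).
rewrite /comb (reindex (enum_rank : 'I_n * 'I_m -> _)) /=; last first.
  by apply: onW_bij; apply: enum_rank_bij.
under eq_bigr do rewrite tnth_mktuple mxE enum_rankK.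
rewrite -(pair_bigA _ (fun i j => G (i, j) *~ c i 0 j)) /=.
apply/ffunP => i; rewrite sum_ffunE (bigD1 i) //= [X in _ + X]big1 => [|i' ii].
  rewrite addr0 sum_ffunE hc; apply: eq_bigr => j _.
  by rewrite ffunMzE ffunE eqxx.
rewrite sum_ffunE big1 // => j _.
by rewrite ffunMzE ffunE eq_sym (negPf ii) mul0rz.
Qed.

End FinitelyGenerated.

(** * Finite generation of rings of algebraic integers *)

Section NumberField.
Local Open Scope ring_scope.

Lemma eigenvalue_integral (F : fieldType) n (C : 'M[int]_n) (v : 'rV[F]_n) x :
  v != 0 -> v *m map_mx intr C = x *: v -> integralOver (intr : int -> F) x.
Proof.
move=> v0 vC; exists (char_poly C); first exact: char_poly_monic.
rewrite map_char_poly -eigenvalue_root_char.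
by apply/eigenvalueP; exists v.
Qed.

Lemma rat_matrix_common_den m n (M : 'M[rat]_(m, n)) :
  exists (N : nat) (C : 'M[int]_(m, n)),
    (0 < N)%N /\ map_mx intr C = N%:R *: M.
Proof.
pose N := \prod_i \prod_j denq (M i j).
have N_gt0 : 0 < N by apply: prodr_gt0 => i _; apply: prodr_gt0.
have hM i j : exists c : int, c%:~R = N%:~R * M i j.
  rewrite /N (bigD1 i) //= (bigD1 j) //=.
  exists (numq (M i j) * \prod_(j0 < n | j0 != j) denq (M i j0)
    * \prod_(i0 < m | i0 != i) \prod_j0 denq (M i0 j0)).
  by rewrite !intrM numqE; ring.
exists `|N|%N, (\matrix_(i, j) projT1 (cid (hM i j))); split.
  by rewrite absz_gt0 gt_eqF.
apply/matrixP => i j; rewrite !mxE; case: cid => c /= ->.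
by rewrite natr_absz ger0_norm // ltW.
Qed.

Variable K : fieldExtType rat.
Let n := \dim {:K}.
Let b : n.-tuple K := vbasis {:K}.

Let b_basis : basis_of {:K} b.
Proof. exact: vbasisP. Qed.

Definition kcoord (z : K) : 'rV[rat]_n := \row_j coord b j z.
Definition mulmat (x : K) : 'M[rat]_n := \matrix_(i, j) coord b j (x * b`_i).

Lemma kcoordK z : z = \sum_i kcoord z 0 i *: b`_i.
Proof.
rewrite [LHS](coord_basis b_basis) ?memvf //.
by apply: eq_bigr => i _; rewrite mxE.
Qed.

Lemma kcoord_mul x z : kcoord (x * z) = kcoord z *m mulmat x.
Proof.
apply/rowP => j; rewrite !mxE {1}(kcoordK z) mulr_sumr linear_sum /=.
by apply: eq_bigr => i _; rewrite -scalerAr linearZ /= !mxE.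
Qed.

Lemma row_mulmat x i : row i (mulmat x) = kcoord (x * b`_i).
Proof. by apply/rowP => j; rewrite !mxE. Qed.

Lemma mulmatM x y : mulmat (x * y) = mulmat x *m mulmat y.
Proof.
apply/row_matrixP => i; rewrite row_mul !row_mulmat [x * y]mulrC -mulrA.
exact: kcoord_mul.
Qed.

Lemma mulmatD x y : mulmat (x + y) = mulmat x + mulmat y.
Proof. by apply/matrixP => i j; rewrite !mxE mulrDl linearD. Qed.

Lemma mulmatZ c x : mulmat (c *: x) = c *: mulmat x.
Proof. by apply/matrixP => i j; rewrite !mxE -scalerAl linearZ. Qed.

Lemma mulmat1 : mulmat 1 = 1%:M.
Proof.
by apply/matrixP => i j; rewrite !mxE mul1r coord_free ?(basis_free b_basis).
Qed.

Lemma mulmat_int (z : int) : mulmat z%:~R = z%:~R%:M.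
Proof.
by rewrite -[z%:~R in LHS](rmorph_int (in_alg K)) mulmatZ mulmat1 scalemx1.
Qed.

Definition ktrace (x : K) : rat := \tr (mulmat x).

Lemma ktraceD x y : ktrace (x + y) = ktrace x + ktrace y.
Proof. by rewrite /ktrace mulmatD mxtraceD. Qed.

Lemma ktraceZ c x : ktrace (c *: x) = c * ktrace x.
Proof. by rewrite /ktrace mulmatZ mxtraceZ. Qed.

Lemma ktrace1 : ktrace 1 = n%:R.
Proof. by rewrite /ktrace mulmat1 mxtrace1. Qed.

Lemma n_gt0 : (0 < n)%N.
Proof. exact: adim_gt0. Qed.

(** The eigenvalues of multiplication by [x] are roots of a monic integer polynomial that
    annihilates [x], hence algebraic integers. The trace is their sum, and it is rational, hence an
    integer. *)
Lemma ktrace_integral (x : K) : integralOver (intr : int -> K) x ->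
  ktrace x \is a Num.int.
Proof.
move=> [p p_monic px0].
pose M : 'M[algC]_n := map_mx ratr (mulmat x).
have eig lam : root (char_poly M) lam -> lam \in Aint.
  rewrite -eigenvalue_root_char => /eigenvalueP[v vM v0].
  suff E q : v *m map_mx ratr (mulmat (map_poly intr q).[x]) =
      (map_poly intr q).[lam] *: v.
    have := E p; rewrite (rootP px0) -[0 : K]/(0%:~R) mulmat_int.
    rewrite map_scalar_mx rmorph_int mul_mx_scalar scale0r => /esym/eqP.
    rewrite scaler_eq0 (negPf v0) orbF => pl0.
    apply: (root_monic_Aint (p := map_poly intr p)) => //.
      exact: monic_map.
    by apply/polyOverP => i; rewrite coef_map /= intr_int.
  elim/poly_ind: q => [|q c IH].
    rewrite !rmorph0 !horner0 -[0 : K]/(0%:~R) mulmat_int map_scalar_mx.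
    by rewrite rmorph_int mul_mx_scalar !scale0r.
  rewrite !rmorphD !rmorphM /= !map_polyX !map_polyC /= !hornerD !hornerM.
  rewrite !hornerX !hornerC mulmatD mulmatM map_mxD map_mxM mulmxDr mulmxA IH.
  rewrite -scalemxAl vM mulmat_int map_scalar_mx rmorph_int mul_mx_scalar.
  by rewrite scalerA -scalerDl.
have [s Es] : {s : seq algC | char_poly M = \prod_(z <- s) ('X - z%:P)}.
  have [s Es] := closed_field_poly_normal (char_poly M); exists s.
  by rewrite Es (monicP (char_poly_monic M)) scale1r.
have sz : size s = n.
  by have := size_char_poly M; rewrite Es size_prod_XsubC => -[].
have sA : {in s, forall z, z \in Aint}.
  move=> z zs; apply: eig; rewrite Es root_prod_XsubC; exact: zs.
have trE : ratr (ktrace x) = \sum_(z <- s) z.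
  have := char_poly_trace M n_gt0; rewrite Es -{1}sz coefPn_prod_XsubC; last first.
    by rewrite sz -lt0n n_gt0.
  by move=> /oppr_inj ->; rewrite /ktrace /M trace_map_mx.
have : ratr (ktrace x) \is a @Num.int algC.
  apply: Cint_rat_Aint; first exact: Crat_rat.
  by rewrite trE big_seq; apply: rpred_sum => z zs; apply: sA.
move=> /intrP[m hm]; apply/intrP; exists m.
by apply: (fmorph_inj (ratr : rat -> algC)); rewrite [LHS]hm rmorph_int.
Qed.

(** Let [N] clear the denominators of the matrix of multiplication by [x]. The vector of basis
    elements is then an eigenvector over [K] of an integer matrix, with eigenvalue [N x]. *)
Lemma integral_multiple (x : K) : exists2 N : nat, (0 < N)%N &
  integralOver (intr : int -> K) (x *+ N).
Proof.
have [N [C [N_gt0 hC]]] := rat_matrix_common_den (mulmat x).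
exists N => //.
apply: (@eigenvalue_integral _ _ C^T (\row_i b`_i)).
  apply/negP => /eqP/rowP b0; have /(_ (Ordinal n_gt0)) := b0; rewrite !mxE.
  move=> b00; have := basis_not0 b_basis (mem_nth 0 (_ : 0 < size b)%N).
  by rewrite b00 => /(_ _)/negP; apply; rewrite ?size_tuple ?n_gt0.
apply/rowP => i; rewrite !mxE mulrnAl [x * _]kcoordK -sumrMnl.
apply: eq_bigr => j _; rewrite !mxE -(rmorph_int (in_alg K)).
have := congr1 (fun M : 'M_n => M i j) hC; rewrite !mxE => ->.
by rewrite mulr_algr scalerMnl mulr_natl.
Qed.

Lemma algintP (x : K) :
  reflect (integralOver (intr : int -> K) x) (x \in algint K).
Proof. by rewrite unfold_in; apply: asboolP. Qed.

(** Traces against integral multiples of a basis embed the integers of [K] in a free group of finite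
    rank. The embedding is injective: for a nonzero [x] in the kernel, [x x^-1 = 1] would have trace
    zero, but its trace is the degree of [K]. *)
Lemma ring_of_integers_fin_gen : fin_gen (naRing_of (ringOfIntegers K)).
Proof.
have /choice[N hN] (i : 'I_n) : exists N : nat,
    (0 < N)%N /\ integralOver (intr : int -> K) (b`_i *+ N).
  by have [N N_gt0 hN] := integral_multiple b`_i; exists N.
pose e (i : 'I_n) := b`_i *+ N i.
have [T TE] : exists T : K -> 'rV[int]_n, forall x i, x \in algint K ->
    (T x 0 i)%:~R = ktrace (x * e i).
  exists (fun x => \row_i Num.floor (ktrace (x * e i))) => x i /algintP hx.
  rewrite mxE; apply/floorK/ktrace_integral.
  by apply: integral_mul => //; case: (hN i).
have T_inj x : x \in algint K -> T x = 0 -> x = 0.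
  move=> hx T0; have tr0 y : ktrace (x * y) = 0.
    rewrite (kcoordK y) mulr_sumr.
    elim/big_rec: _ => [|i z _ IH].
      by rewrite /ktrace -[0 : K]/(0%:~R) mulmat_int mxtrace_scalar mul0rn.
    rewrite ktraceD IH addr0 -scalerAr ktraceZ.
    have := TE x i hx; rewrite T0 mxE /e -scaler_nat -scalerAr.
    rewrite ktraceZ => /esym/eqP.
    rewrite mulf_eq0 pnatr_eq0 -leqn0 leqNgt (proj1 (hN i)) /= => /eqP ->.
    by rewrite mulr0.
  apply: contrapT => x0; have := tr0 x^-1.
  rewrite mulfV; last exact/eqP.
  by rewrite ktrace1 => /eqP; rewrite pnatr_eq0 -leqn0 leqNgt n_gt0.
have TB x y : x \in algint K -> y \in algint K -> T (x - y) = T x - T y.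
  move=> hx hy; apply/rowP => i; apply: (@intr_inj rat).
  rewrite TE ?rpredB // !mxE intrB !TE // mulrBl.
  by rewrite ktraceD -[- (y * _)]scaleN1r ktraceZ mulN1r.
pose H : set 'rV[int]_n := fun y => exists2 x, x \in algint K & T x = y.
have sH : is_subgroup H.
  split; first by exists 0; rewrite ?rpred0 // -{1}(subrr (0 : K)) TB ?rpred0 // subrr.
  move=> _ _ [x hx <-] [y hy <-]; exists (x - y); first exact: rpredB.
  by rewrite TB.
have [k [M hM]] := subgroup_rV_fin_gen sH.
have /choice[w hw] i : exists w : ringOfIntegers K, T (roi_val w) = row i M.
  have /hM[x hx Tx] : exists c, row i M = c *m M by exists (delta_mx 0 i); rewrite rowE.
  by exists (RingOfIntegers hx).
exists k, [tuple w i | i < k]; apply/generatesE => x.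
have /hM[c hc] : H (T (roi_val x)) by exists (roi_val x); first exact: roi_valP.
exists c; apply: val_inj => /=; apply/eqP; rewrite -subr_eq0; apply/eqP.
apply: T_inj; first by rewrite rpredB ?roi_valP.
rewrite TB ?roi_valP // hc.
rewrite (@comb_morph _ _ (fun x : ringOfIntegers K => T (roi_val x))).
  rewrite mulmx_comb; apply/eqP; rewrite subr_eq0; apply/eqP/eq_comb => i.
  by rewrite /= tnth_mktuple hw.
by move=> y z; rewrite /= TB ?roi_valP.
Qed.

End NumberField.

(** * Scalars of the multiplication and their character *)

Section Products.
Local Open Scope ring_scope.
Variable A : naRing.
Implicit Types x y z : A.

Lemma na_mulBl z : {morph (fun x => na_mul x z) : x y / x - y}.
Proof.
by move=> x y; apply: (addIr (na_mul y z)); rewrite -na_mulDl !subrK.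
Qed.

Lemma na_mulBr z : {morph na_mul z : x y / x - y}.
Proof.
by move=> x y; apply: (addIr (na_mul z y)); rewrite -na_mulDr !subrK.
Qed.

Lemma na_mul0 x : na_mul 0 x = 0.
Proof. by rewrite -[in LHS](subrr x) na_mulBl subrr. Qed.

Lemma na_mulr0 x : na_mul x 0 = 0.
Proof. by rewrite -[in LHS](subrr x) na_mulBr subrr. Qed.

Lemma na_mul_combl n (g : 'I_n -> A) c z :
  na_mul (comb g c) z = comb (fun i => na_mul (g i) z) c.
Proof. by apply: (comb_morph (f := fun x => na_mul x z)) => x y; rewrite na_mulBl. Qed.

Lemma na_mul_combr n (g : 'I_n -> A) c z :
  na_mul z (comb g c) = comb (fun i => na_mul z (g i)) c.
Proof. by apply: (comb_morph (f := na_mul z)) => x y; rewrite na_mulBr. Qed.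

End Products.

Section Scalars.
Local Open Scope ring_scope.
Variables (A : naRing) (m : nat) (a : 'I_m -> A).
Hypothesis a_gen : forall x, exists c, x = comb a c.

Local Notation ext := {ffun 'I_(m + m) -> A}.
Local Notation "x ** y" := (na_mul x y) (at level 40).

Definition lpart (x : ext) i : A := x (lshift m i).
Definition rpart (x : ext) j : A := x (rshift m j).

(** Elements of [A ^ 2] are presented by integer matrices [c] through [prods]. A family [f] defines
    a map on [A ^ 2] when its pairing vanishes on the relations, the [c] with [prods c = 0]. *)
Definition pairing (V : zmodType) (f : 'I_m -> 'I_m -> V) (c : 'M[int]_m) : V :=
  \sum_i \sum_j f i j *~ c i j.

Definition prods (c : 'M[int]_m) : A := pairing (fun i j => a i ** a j) c.
Definition lprods (x : ext) (c : 'M[int]_m) : A :=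
  pairing (fun i j => lpart x i ** a j) c.

(* Such an [x] is a scalar of the multiplication: on [A ^ 2] it acts by
   [a i ** a j |-> lpart x i ** a j]. *)
Definition scalar (x : ext) : Prop :=
  (forall i j, lpart x i ** a j = a i ** rpart x j) /\
  (forall c, prods c = 0 -> lprods x c = 0).

Definition acoord (x : A) : 'rV[int]_m := projT1 (cid (a_gen x)).

Lemma acoordK x : comb a (acoord x) = x.
Proof. by rewrite /acoord; case: cid. Qed.

Definition lmat (x : ext) : 'M[int]_m := \matrix_(i, l) acoord (lpart x i) 0 l.
Definition rmat (x : ext) : 'M[int]_m := \matrix_(j, l) acoord (rpart x j) 0 l.

Lemma mul_lpart x i y : lpart x i ** y = \sum_l (a l ** y) *~ lmat x i l.
Proof.
rewrite -[lpart x i]acoordK na_mul_combl; apply: eq_bigr => l _.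
by rewrite mxE.
Qed.

Lemma mul_rpart x i y : y ** rpart x i = \sum_l (y ** a l) *~ rmat x i l.
Proof.
rewrite -[rpart x i]acoordK na_mul_combr; apply: eq_bigr => l _.
by rewrite mxE.
Qed.

Lemma eq_pairing (V : zmodType) (f g : 'I_m -> 'I_m -> V) c :
  f =2 g -> pairing f c = pairing g c.
Proof. by move=> fg; apply: eq_bigr => i _; apply: eq_bigr => j _; rewrite fg. Qed.

Lemma pairingB V f : {morph @pairing V f : c c' / c - c'}.
Proof.
move=> c c'; rewrite /pairing -sumrB; apply: eq_bigr => i _.
rewrite -sumrB; apply: eq_bigr => j _.
by rewrite !mxE mulrzBr.
Qed.

HB.instance Definition _ V f :=
  GRing.isZmodMorphism.Build 'M[int]_m V (@pairing V f) (@pairingB V f).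

Lemma pairing_suml (V : zmodType) (I : finType) (f : I -> 'I_m -> 'I_m -> V) c :
  pairing (fun i j => \sum_k f k i j) c = \sum_k pairing (f k) c.
Proof.
rewrite /pairing [RHS]exchange_big; apply: eq_bigr => i _.
rewrite [RHS]exchange_big; apply: eq_bigr => j _.
by rewrite mulrz_suml.
Qed.

Lemma pairingDl (V : zmodType) (f g : 'I_m -> 'I_m -> V) c :
  pairing (fun i j => f i j + g i j) c = pairing f c + pairing g c.
Proof.
rewrite /pairing -big_split; apply: eq_bigr => i _; rewrite -big_split.
by apply: eq_bigr => j _; rewrite mulrzDl.
Qed.

Lemma pairing_mull (V : zmodType) (f : 'I_m -> 'I_m -> V) (B c : 'M[int]_m) :
  pairing (fun i j => \sum_l f l j *~ B i l) c = pairing f (B^T *m c).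
Proof.
rewrite /pairing exchange_big [RHS]exchange_big /=; apply: eq_bigr => j _.
under eq_bigr do rewrite mulrz_suml.
rewrite exchange_big /=; apply: eq_bigr => l _; rewrite mxE mulrz_sumr.
by apply: eq_bigr => i _; rewrite mxE mulrzA.
Qed.

Lemma pairing_mulr (V : zmodType) (f : 'I_m -> 'I_m -> V) (B c : 'M[int]_m) :
  pairing (fun i j => \sum_l f i l *~ B j l) c = pairing f (c *m B).
Proof.
rewrite /pairing; apply: eq_bigr => i _.
under eq_bigr do rewrite mulrz_suml.
rewrite exchange_big /=; apply: eq_bigr => l _; rewrite mxE mulrz_sumr.
by apply: eq_bigr => j _; rewrite mulrC mulrzA.
Qed.

Lemma pairing_delta (V : zmodType) (f : 'I_m -> 'I_m -> V) i j :
  pairing f (delta_mx i j) = f i j.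
Proof.
rewrite /pairing (bigD1 i) //= (bigD1 j) //= mxE !eqxx big1 => [|j' jj].
  rewrite big1 ?addr0 // => i' ii; rewrite big1 // => j' _.
  by rewrite mxE (negPf ii).
by rewrite mxE (negPf jj) andbF.
Qed.

(** On coefficient matrices the action through left factors is a multiplication from the left; in
    [lprods_rmat] the same action, taken through right factors, is a multiplication from the
    right. *)
Lemma lprodsE x c : lprods x c = prods ((lmat x)^T *m c).
Proof.
rewrite /prods -pairing_mull; apply: eq_pairing => i j; exact: mul_lpart.
Qed.

Lemma lprods_rmat x c : scalar x -> lprods x c = prods (c *m rmat x).
Proof.
move=> [h _]; rewrite /prods -pairing_mulr; apply: eq_pairing => i j.
by rewrite h mul_rpart.
Qed.

Lemma prodsB : {morph prods : c c' / c - c'}.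
Proof. exact: pairingB. Qed.

(** With [y] written as a right multiplication, commutation is associativity of the matrix product.
    Rewriting [y] underneath [x] changes the matrix by a relation, which [x] respects by its second
    clause. *)
Lemma scalar_comm x y c : scalar x -> scalar y ->
  prods ((lmat x)^T *m ((lmat y)^T *m c)) = prods ((lmat y)^T *m ((lmat x)^T *m c)).
Proof.
move=> sx sy; rewrite -[RHS]lprodsE lprods_rmat // -mulmxA.
apply/eqP; rewrite -subr_eq0 -pairingB -mulmxBr -[pairing _ _]lprodsE.
by apply/eqP/(proj2 sx); rewrite prodsB -lprodsE lprods_rmat // subrr.
Qed.

(* Additive maps from [A ^ 2] to the field are the matrices [w] of their values
   on the [a i ** a j]. *)
Definition functional (w : 'M[algC]_m) : Prop :=
  forall c, prods c = 0 -> pairing w c = 0.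

Lemma functional_eq w c c' : functional w -> prods c = prods c' ->
  pairing w c = pairing w c'.
Proof.
move=> fw E; apply/eqP; rewrite -subr_eq0 -pairingB; apply/eqP/fw.
by rewrite prodsB E subrr.
Qed.

Definition lact (x : ext) (w : 'M[algC]_m) : 'M[algC]_m :=
  map_mx intr (lmat x) *m w.

Lemma pairing_lact x w c : pairing (lact x w) c = pairing w ((lmat x)^T *m c).
Proof.
rewrite -pairing_mull; apply: eq_pairing => i j; rewrite mxE.
by apply: eq_bigr => l _; rewrite mxE mulrzl.
Qed.

Lemma pairing_inj (V : zmodType) (f g : 'I_m -> 'I_m -> V) :
  pairing f =1 pairing g -> f =2 g.
Proof. by move=> fg i j; rewrite -(pairing_delta f) fg pairing_delta. Qed.

Lemma lact_functional x w : scalar x -> functional w -> functional (lact x w).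
Proof.
move=> [_ hx] fw c hc; rewrite pairing_lact; apply: fw.
by rewrite -lprodsE hx.
Qed.

Lemma lact_comm x y w : scalar x -> scalar y -> functional w ->
  lact x (lact y w) = lact y (lact x w).
Proof.
move=> sx sy fw; apply/matrixP; apply: pairing_inj => c.
by rewrite !pairing_lact; apply: functional_eq; rewrite // scalar_comm.
Qed.

Lemma lprodsB x y c : lprods (x - y) c = lprods x c - lprods y c.
Proof.
apply/eqP; rewrite eq_sym subr_eq -pairingDl; apply/eqP/eq_pairing => i j.
by rewrite /lpart !ffunE na_mulBl subrK.
Qed.

Lemma lactB w x y : functional w -> lact (x - y) w = lact x w - lact y w.
Proof.
move=> fw; apply/eqP; rewrite eq_sym subr_eq; apply/eqP/matrixP.
apply: pairing_inj => c.
transitivity (pairing (lact (x - y) w) c + pairing (lact y w) c); last first.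
  by rewrite -pairingDl; apply: eq_pairing => i j; rewrite [RHS]mxE.
rewrite !pairing_lact -raddfD; apply: functional_eq => //.
rewrite -lprodsE; transitivity (lprods (x - y) c + lprods y c).
  by rewrite lprodsB subrK.
by rewrite !lprodsE /prods raddfD.
Qed.

Lemma scalar_subgroup : is_subgroup scalar.
Proof.
split.
  split=> [i j|c _]; first by rewrite /lpart /rpart !ffunE na_mul0 na_mulr0.
  rewrite /lprods /pairing big1 // => i _; rewrite big1 // => j _.
  by rewrite /lpart ffunE na_mul0 mul0rz.
move=> x y [hx kx] [hy ky]; split=> [i j|c hc].
  by rewrite /lpart /rpart !ffunE na_mulBl na_mulBr hx hy.
by rewrite lprodsB kx ?ky ?subrr.
Qed.

Definition scalar1 : ext :=
  [ffun k => match split k with inl i => a i | inr j => a j end].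

Lemma lpart1 i : lpart scalar1 i = a i.
Proof. by rewrite /lpart ffunE -[lshift _ _]/(unsplit (inl i)) unsplitK. Qed.

Lemma rpart1 i : rpart scalar1 i = a i.
Proof. by rewrite /rpart ffunE -[rshift _ _]/(unsplit (inr i)) unsplitK. Qed.

Lemma scalar1P : scalar scalar1.
Proof.
split=> [i j|c hc]; first by rewrite lpart1 rpart1.
by rewrite -[RHS]hc; apply: eq_pairing => i j; rewrite lpart1.
Qed.

Definition scalar_mul (x y : ext) : ext :=
  [ffun k => match split k with
             | inl i => \sum_l lpart y l *~ lmat x i l
             | inr j => \sum_l rpart x l *~ rmat y j l
             end].

Lemma lpartM x y i : lpart (scalar_mul x y) i = \sum_l lpart y l *~ lmat x i l.
Proof. by rewrite {1}/lpart ffunE -[lshift _ _]/(unsplit (inl i)) unsplitK. Qed.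

Lemma rpartM x y j : rpart (scalar_mul x y) j = \sum_l rpart x l *~ rmat y j l.
Proof. by rewrite {1}/rpart ffunE -[rshift _ _]/(unsplit (inr j)) unsplitK. Qed.

Lemma na_mul_suml (g : 'I_m -> A) (z : 'I_m -> int) y :
  (\sum_l g l *~ z l) ** y = \sum_l (g l ** y) *~ z l.
Proof.
have := na_mul_combl g (\row_l z l) y; rewrite /comb.
by under eq_bigr do rewrite mxE; under [in RHS]eq_bigr do rewrite mxE.
Qed.

Lemma na_mul_sumr (g : 'I_m -> A) (z : 'I_m -> int) y :
  y ** (\sum_l g l *~ z l) = \sum_l (y ** g l) *~ z l.
Proof.
have := na_mul_combr g (\row_l z l) y; rewrite /comb.
by under eq_bigr do rewrite mxE; under [in RHS]eq_bigr do rewrite mxE.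
Qed.

Lemma lpart_rpart x y i j : scalar y ->
  lpart x i ** rpart y j = \sum_l (lpart y l ** a j) *~ lmat x i l.
Proof.
by move=> [hy _]; rewrite mul_lpart; apply: eq_bigr => l _; rewrite hy.
Qed.

(** This is what makes products of scalars expressible: the composite is visible in products of the
    left family of [x] with the right family of [y], although [scalar_mul] itself is built from
    integer coordinates. *)
Lemma scalar_mulE x y i j : scalar y ->
  lpart (scalar_mul x y) i ** a j = lpart x i ** rpart y j.
Proof. by move=> sy; rewrite lpartM na_mul_suml lpart_rpart. Qed.

Lemma pairing_lpart_rpart x y c : scalar y ->
  pairing (fun i j => lpart x i ** rpart y j) c =
  prods ((lmat y)^T *m ((lmat x)^T *m c)).
Proof.
move=> sy; rewrite -lprodsE /lprods -pairing_mull; apply: eq_pairing => i j.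
exact: lpart_rpart.
Qed.

Lemma scalar_mulP x y : scalar x -> scalar y -> scalar (scalar_mul x y).
Proof.
move=> [hx kx] sy; have [hy ky] := sy; split=> [i j|c hc].
  rewrite scalar_mulE // rpartM na_mul_sumr mul_rpart.
  by apply: eq_bigr => l _; rewrite hx.
rewrite /lprods (eq_pairing _ (fun i j => scalar_mulE x i j sy)).
rewrite pairing_lpart_rpart // -lprodsE; apply: ky.
by rewrite -lprodsE; apply: kx.
Qed.

(** Functionals only see the action on [A ^ 2], and the hypothesis says that [z] acts there as the
    sum of the composites, even when [z] differs from the sum of the products. *)
Lemma lact_sum_mul (I : finType) (x y : I -> ext) z w :
  (forall k, scalar (y k)) -> functional w ->
  (forall i j, \sum_k lpart (x k) i ** rpart (y k) j = lpart z i ** a j) ->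
  lact z w = \sum_k lact (x k) (lact (y k) w).
Proof.
move=> sy fw E; apply/matrixP; apply: pairing_inj => c.
have -> : pairing (\sum_k lact (x k) (lact (y k) w)) c =
    \sum_k pairing (lact (x k) (lact (y k) w)) c.
  rewrite -pairing_suml; apply: eq_pairing => i j.
  by rewrite summxE.
under eq_bigr do rewrite !pairing_lact.
rewrite -raddf_sum pairing_lact; apply: functional_eq => //.
rewrite -lprodsE /prods raddf_sum /=.
under eq_bigr do rewrite -/(prods _) -pairing_lpart_rpart //.
by rewrite -pairing_suml; apply: eq_pairing => i j; rewrite E.
Qed.

Lemma a_fin_gen : fin_gen A.
Proof.
exists m, [tuple a i | i < m]; apply/generatesE => x; have [c ->] := a_gen x.
by exists c; apply: eq_comb => i; rewrite tnth_mktuple.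
Qed.

Lemma square_sub (H : set A) : is_subgroup H -> (forall i j, H (a i ** a j)) ->
  (@square A `<=` H)%classic.
Proof.
move=> sH Ha; apply: smallest_sub => // _ [x [y ->]].
rewrite -[x]acoordK -[y]acoordK na_mul_combl.
apply: is_subgroup_sum => // i _; apply: is_subgroupMz => //.
rewrite na_mul_combr; apply: is_subgroup_sum => // j _.
by apply: is_subgroupMz.
Qed.

(** Each free coordinate of [A] gives a functional. If all of these vanished, [A ^ 2] would lie in
    the torsion subgroup, which is finite. *)
Lemma nonzero_functional : infinite_set (@square A) ->
  exists2 w, functional w & w != 0.
Proof.
move=> A2_inf; have [n [g [d [g_gen g_rel]]]] := fin_gen_structure a_fin_gen.
apply: contrapT => no_w; apply: A2_inf.
apply: sub_finite_set (finite_torsion g_gen g_rel).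
apply: square_sub (torsion_subgroup g_gen g_rel) _ => p q i di.
pose w : 'M[algC]_m := \matrix_(k, l) (gcoord g_gen (a k ** a l) 0 i)%:~R.
have fE c : pairing w c = (gcoord g_gen (prods c) 0 i)%:~R.
  pose f : A -> algC := fun x => (gcoord g_gen x 0 i)%:~R.
  have fB : {morph f : x y / x - y}.
    by move=> x y; rewrite /f (free_coordB g_gen g_rel) // intrB.
  pose fA : {additive A -> algC} := HB.pack f (GRing.isZmodMorphism.Build A algC f fB).
  transitivity (fA (prods c)); last by [].
  rewrite /prods /pairing (raddf_sum fA); apply: eq_bigr => k _.
  rewrite (raddf_sum fA); apply: eq_bigr => l _.
  by rewrite (raddfMz fA) mxE.
have fw : functional w.
  move=> c hc; rewrite fE hc.
  have := free_coordB g_gen g_rel 0 0 di; rewrite !subr0 => E.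
  by rewrite -[0](subrr 0) (free_coordB g_gen g_rel) // subrr.
have w0 : w = 0 by apply: contrapT => w0; apply: no_w; exists w => //; apply/eqP.
apply: (@intr_inj algC); have := congr1 (fun M : 'M_m => M p q) w0.
by rewrite !mxE.
Qed.

Lemma pairing_mxvec (w : 'M[algC]_m) c :
  pairing w c = (mxvec w *m (map_mx intr (mxvec c))^T) 0 0.
Proof.
rewrite mxE (reindex _ (curry_mxvec_bij _ _)) /= /pairing pair_bigA.
by apply: eq_bigr => [[i j]] _; rewrite /= !mxE !mxvecE mulrzr.
Qed.

(** The relations are finitely generated, so the functionals are the kernel of a matrix [P]. The
    scalars preserve this space, and only on it do they commute; the common eigenvector is therefore
    sought for the restricted matrices. *)
Lemma eigen_functional k (s : 'I_k -> ext) :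
  infinite_set (@square A) -> (forall i, scalar (s i)) ->
  exists w, [/\ functional w, w != 0 &
    forall i, exists lam, lact (s i) w = lam *: w].
Proof.
move=> A2_inf hs.
have [|q [Q hQ]] := @subgroup_rV_fin_gen (m * m)%N (fun c => prods (vec_mx c) = 0).
  by split; [rewrite linear0 /prods raddf0 | move=> x y hx hy; rewrite linearB prodsB hx hy subrr].
pose P : 'M[algC]_(m * m, q) := (map_mx intr Q)^T.
have kerP w : reflect (functional w) (mxvec w <= kermx P)%MS.
  apply: (iffP sub_kermxP) => [wP c hc|fw].
    have /hQ[y hy] : prods (vec_mx (mxvec c)) = 0 by rewrite mxvecK.
    rewrite pairing_mxvec hy map_mxM trmx_mul mulmxA -/P wP mul0mx.
    by rewrite mxE.
  apply/rowP => i; rewrite [RHS]mxE.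
  have <- : pairing w (vec_mx (row i Q)) = 0.
    by apply/fw/hQ; exists (delta_mx 0 i); rewrite -rowE.
  rewrite pairing_mxvec vec_mxK !mxE; apply: eq_bigr => j _.
  by rewrite !mxE.
have [U [U_free UE]] : exists U : 'M_(\rank (kermx P), m * m),
    row_free U /\ (U :=: kermx P)%MS.
  by exists (row_base (kermx P)); split; [exact: row_base_free | exact: eq_row_base].
have [Bm vecB] : exists Bm : 'I_k -> 'M[algC]_(m * m),
    forall w i, mxvec w *m Bm i = mxvec (lact (s i) w).
  exists (fun i => lin_mulmx (map_mx intr (lmat (s i)))) => w i.
  by rewrite mul_vec_lin.
have rowU v : functional (vec_mx (v *m U)).
  by apply/kerP; rewrite vec_mxK -UE submxMl.
have stabU i : (U *m Bm i <= U)%MS.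
  apply/row_subP => j; rewrite row_mul UE -[row j U]vec_mxK vecB; apply/kerP.
  by apply: lact_functional => //; rewrite rowE; apply: rowU.
(* [N i] is the action of [s i] in the basis [U] of the functionals. *)
have [N NE] : exists N, forall i, N i *m U = U *m Bm i.
  by exists (fun i => U *m Bm i *m pinvmx U) => i; apply: mulmxKpV.
have Ncomm : {in [seq N i | i <- enum 'I_k] &, forall M M', comm_mx M M'}.
  move=> _ _ /mapP[i _ ->] /mapP[j _ ->]; apply: (row_free_inj U_free).
  rewrite /= -!mulmxA !NE !mulmxA !NE; apply/row_matrixP => l.
  rewrite -!mulmxA !row_mul !mulmxA -[row l U]vec_mxK !vecB lact_comm //.
  by rewrite rowE; apply: rowU.
have r_gt0 : (0 < \rank (kermx P))%N.
  have [w fw w0] := nonzero_functional A2_inf; rewrite lt0n mxrank_eq0.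
  apply: contra w0 => /eqP k0; have /kerP := fw; rewrite k0 submx0 => /eqP E.
  by rewrite -[w]mxvecK E linear0.
have [v v0 /allP hv] := common_eigenvector r_gt0 Ncomm.
exists (vec_mx (v *m U)); split=> [//||i].
  rewrite -(inj_eq (can_inj mxvecK)) vec_mxK linear0.
  by rewrite -(mul0mx _ U) (inj_eq (row_free_inj U_free)).
have /hv/sub_rVP[lam hlam] : N i \in [seq N i | i <- enum 'I_k].
  by apply: map_f; rewrite mem_enum.
exists lam; apply: (can_inj mxvecK); rewrite -vecB vec_mxK linearZ /= vec_mxK.
by rewrite -mulmxA -NE mulmxA hlam -scalemxAl.
Qed.

(** [lam] is the eigenvalue at a functional that is an eigenvector for generators of the scalars,
    hence for all scalars. Multiplicativity is stated for sums of products because this is the shape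
    of the equations that describe ideals. *)
Lemma scalar_character : infinite_set (@square A) ->
  exists lam : ext -> algC,
  [/\ forall x y, scalar x -> scalar y -> lam (x - y) = lam x - lam y,
      forall (I : finType) (x y : I -> ext) z,
        (forall k, scalar (x k)) -> (forall k, scalar (y k)) -> scalar z ->
        (forall i j, \sum_k lpart (x k) i ** rpart (y k) j = lpart z i ** a j) ->
        lam z = \sum_k lam (x k) * lam (y k),
      lam scalar1 = 1
    & forall x, scalar x -> integralOver (intr : int -> algC) (lam x)].
Proof.
move=> A2_inf; have [k [s hs]] := subgroup_fin_gen (fin_gen_ffun (m + m) a_fin_gen) scalar_subgroup.
have ss i : scalar (s i).
  by apply/hs; exists (delta_mx 0 i); rewrite /comb (bigD1 i) //= mxE !eqxx big1 ?addr0 // => j ji; rewrite mxE (negPf ji).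
have [w [fw w0 hw]] := eigen_functional A2_inf ss.
have /choice[mu hmu] := hw.
have hlam x : exists lam, scalar x -> lact x w = lam *: w.
  have [sx|nsx] := pselect (scalar x); last by exists 0.
  have [c ->] := proj1 (hs x) sx; exists (\sum_i mu i *~ c 0 i) => _.
  rewrite (comb_morph (f := fun x => lact x w)); last first.
    by move=> y z; apply: lactB.
  rewrite /comb scaler_suml; apply: eq_bigr => i _.
  by rewrite /= hmu scalerMzl.
have /choice[lam hlamx] := hlam; exists lam.
have lamE x c : scalar x -> lact x w = c *: w -> lam x = c.
  move=> sx; rewrite hlamx // => /eqP; rewrite -subr_eq0 -scalerBl scaler_eq0.
  by rewrite (negPf w0) orbF subr_eq0 => /eqP.
split.
- move=> x y sx sy; apply: lamE; first exact: (proj2 scalar_subgroup).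
  by rewrite lactB // !hlamx // scalerBl.
- move=> I x y z sx sy sz E; apply: lamE => //.
  rewrite (lact_sum_mul sy fw E) scaler_suml; apply: eq_bigr => i _.
  by rewrite hlamx // /lact -scalemxAr -/(lact _ _) hlamx // scalerA mulrC.
- apply: lamE; first exact: scalar1P.
  rewrite scale1r; apply/matrixP; apply: pairing_inj => c.
  rewrite pairing_lact; apply: functional_eq => //.
  by rewrite -lprodsE; apply: eq_pairing => i j; rewrite lpart1.
(* A nonzero column of [w] is an eigenvector of the integer matrix [lmat x]. *)
- move=> x sx; have [j wj] : exists j, col j w != 0.
    apply: contrapT => nj; case/negP: w0; apply/eqP/matrixP => i j.
    have /colP/(_ i) : col j w = 0.
      by apply: contrapT => /eqP hj; apply: nj; exists j.
    by rewrite !mxE.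
  apply: (@eigenvalue_integral _ _ (lmat x)^T (col j w)^T).
    by rewrite -(inj_eq trmx_inj) trmxK trmx0.
  apply: trmx_inj; rewrite trmx_mul !trmxK map_trmx trmxK linearZ /= trmxK.
  by rewrite colE mulmxA -/(lact x w) hlamx // -scalemxAl.
Qed.

End Scalars.

(** * Interpretation of the ring of integers *)

Section Order.
Local Open Scope ring_scope.
Variables (A : naRing) (m : nat) (a : 'I_m -> A).
Hypothesis a_gen : forall x, exists c, x = comb a c.
Hypothesis A2_inf : infinite_set (@square A).

Local Notation ext := {ffun 'I_(m + m) -> A}.
Local Notation "x ** y" := (na_mul x y) (at level 40).

(** [K] is generated by the values of the character on generators of the scalars. These values span
    a rational space that contains 1 and is closed under products, so it is all of [K]; clearing
    denominators gives the last clause. *)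
Lemma scalar_number_field : exists (K : fieldExtType rat) (nu : ext -> K),
  [/\ forall x y, scalar a x -> scalar a y -> nu (x - y) = nu x - nu y,
      forall (I : finType) (x y : I -> ext) z,
        (forall k, scalar a (x k)) -> (forall k, scalar a (y k)) ->
        scalar a z ->
        (forall i j, \sum_k lpart (x k) i ** rpart (y k) j = lpart z i ** a j) ->
        nu z = \sum_k nu (x k) * nu (y k),
      forall x, scalar a x -> nu x \in algint K
    & forall u, exists2 N, (0 < N)%N & exists2 x, scalar a x & nu x = u *+ N].
Proof.
have [lam [lamB lamM lam1 lam_int]] := scalar_character a_gen A2_inf.
have [k [s hs]] := subgroup_fin_gen (fin_gen_ffun (m + m) (a_fin_gen a_gen))
  (scalar_subgroup a).
have ss i : scalar a (s i).
  apply/hs; exists (delta_mx 0 i); rewrite /comb (bigD1 i) //= mxE !eqxx.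
  by rewrite big1 ?addr0 // => j ji; rewrite mxE (negPf ji).
have [K [iota_ [s1 s1E s1_full]]] := num_field_exists [seq lam (s i) | i <- enum 'I_k].
have gen_ind (P : ext -> Prop) : (forall x y, scalar a x -> scalar a y ->
    P x -> P y -> P (x - y)) -> P 0 -> (forall i, P (s i)) ->
    forall x, scalar a x -> P x.
  move=> PB P0 Ps x sx.
  pose H : set ext := fun x => scalar a x /\ P x.
  have sH : is_subgroup H.
    split; first by split=> //; case: (scalar_subgroup a).
    move=> y z [sy Py] [sz Pz]; split; last exact: PB.
    exact: (proj2 (scalar_subgroup a)).
  have [c xc] := proj1 (hs x) sx.
  suff [] : H x by [].
  rewrite xc; apply: is_subgroup_sum => // i _; exact: is_subgroupMz.
have lam0 : lam 0 = 0.
  have s0 : scalar a 0 by case: (scalar_subgroup a).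
  by have := lamB 0 0 s0 s0; rewrite !subrr.
have /choice[r_ hr] i : exists r, r \in s1 /\ iota_ r = lam (s i).
  have : lam (s i) \in [seq iota_ j | j <- s1] by rewrite s1E map_f // mem_enum.
  by move=> /mapP[u us ->]; exists u.
have /choice[nu hnu] x : exists u, scalar a x -> iota_ u = lam x.
  have [sx|nsx] := pselect (scalar a x); last by exists 0.
  suff [u hu] : exists u, iota_ u = lam x by exists u.
  move: x sx; apply: gen_ind => [x y sx sy [u hu] [v hv]||i].
  - by exists (u - v); rewrite rmorphB hu hv lamB.
  - by exists 0; rewrite rmorph0 lam0.
  - by exists (r_ i); case: (hr i).
have nuE x u : scalar a x -> iota_ u = lam x -> nu x = u.
  by move=> sx hu; apply: (fmorph_inj iota_); rewrite hu hnu.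
have nuB x y : scalar a x -> scalar a y -> nu (x - y) = nu x - nu y.
  move=> sx sy; apply: nuE; first exact: (proj2 (scalar_subgroup a)).
  by rewrite rmorphB !hnu // lamB.
have nuM (I : finType) (x y : I -> ext) z :
    (forall k, scalar a (x k)) -> (forall k, scalar a (y k)) -> scalar a z ->
    (forall i j, \sum_k lpart (x k) i ** rpart (y k) j = lpart z i ** a j) ->
    nu z = \sum_k nu (x k) * nu (y k).
  move=> sx sy sz E; apply: nuE => //; rewrite (lamM _ _ _ _ sx sy sz E) rmorph_sum.
  by apply: eq_bigr => i _; rewrite rmorphM !hnu.
have nu1 : nu (scalar1 a) = 1.
  by apply: nuE; rewrite ?rmorph1 ?lam1 //; apply: scalar1P.
have nu_sub x : scalar a x -> nu x \in <<s1>>%VS.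
  move: x; apply: gen_ind => [x y sx sy hx hy||i].
  - by rewrite nuB // rpredB.
  - by rewrite (nuE 0 0) ?mem0v ?lam0 ?rmorph0 //; case: (scalar_subgroup a).
  - by rewrite (nuE _ (r_ i)) //; [apply: memv_span; case: (hr i) | case: (hr i)].
have s1_nu u : u \in s1 -> exists2 x, scalar a x & nu x = u.
  move=> us; have : iota_ u \in [seq lam (s i) | i <- enum 'I_k].
    by rewrite -s1E map_f.
  by move=> /mapP[i _ hi]; exists (s i) => //; apply: nuE.
have span_full u : u \in <<s1>>%VS.
  suff : (<<1 & s1>> <= <<s1>>)%VS by rewrite s1_full => /subvP; apply; rewrite memvf.
  have sub1 : (1 <= <<s1>>)%VS.
    apply/subvP => _ /vlineP[c ->]; rewrite rpredZ // -nu1.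
    by apply: nu_sub; apply: scalar1P.
  apply: agenv_sub_modl => //; apply/prodvP => u1 v + hv.
  have -> : (1 + <<s1>>)%VS = <<s1>>%VS by apply/addv_idPr.
  move=> hu1; rewrite (coord_span (X := in_tuple s1) hu1).
  rewrite (coord_span (X := in_tuple s1) hv) mulr_suml.
  apply: rpred_sum => i _; rewrite mulr_sumr; apply: rpred_sum => j _.
  rewrite -scalerAl -scalerAr !rpredZ //.
  have [x sx <-] := s1_nu _ (mem_nth 0 (ltn_ord i)).
  have [y sy <-] := s1_nu _ (mem_nth 0 (ltn_ord j)).
  have sxy := scalar_mulP a_gen sx sy.
  have <- : nu (scalar_mul a_gen x y) = nu x * nu y.
    rewrite (nuM 'I_1 (fun=> x) (fun=> y)) ?big_ord1 // => p q.
    by rewrite big_ord1 scalar_mulE.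
  exact: nu_sub.
exists K, nu; split=> //.
- move=> x sx; apply/algintP; have [p p_monic px] := lam_int x sx.
  exists p => //; rewrite -(fmorph_root iota_) hnu //.
  by rewrite -map_poly_comp (eq_map_poly (g := intr)) // => z; rewrite /= rmorph_int.
- move=> u; have hu := span_full u.
  pose q := \row_i coord (in_tuple s1) i u.
  have [N [C [N_gt0 hC]]] := rat_matrix_common_den q.
  have /choice[x hx] (i : 'I_(size s1)) : exists x, scalar a x /\ nu x = s1`_i.
    by have [x sx hx] := s1_nu _ (mem_nth 0 (ltn_ord i)); exists x.
  exists N => //; pose H : set ext := fun x => scalar a x.
  have sH : is_subgroup H by exact: scalar_subgroup.
  have scomb : scalar a (comb x C).
    apply: (@is_subgroup_sum _ H) => // i _; apply: is_subgroupMz => //.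
    by case: (hx i).
  exists (comb x C) => //.
  rewrite (comb_morph_in _ sH nuB) => [|i]; last by case: (hx i).
  rewrite [u in RHS](coord_span (X := in_tuple s1) hu) -sumrMnl.
  apply: eq_bigr => i _; have [_ /= ->] := hx i.
  have := congr1 (fun M : 'rV_(size s1) => M 0 i) hC; rewrite !mxE => E.
  rewrite -scaler_int E scalerMnl; congr (_ *: _); rewrite mulr_natl.
  by [].
Qed.

End Order.

(** * Equations indexed by finite types *)

Section SystemOf.
Local Open Scope ring_scope.
Variable A : naRing.
Implicit Types v : nat -> A.

Definition holds v (e : term A * term A) : Prop :=
  eval id v e.1 = eval id v e.2.

Lemma satisfies_enum (I : finType) v (f : I -> term A * term A) :
  satisfies id v [seq f i | i <- enum I] <-> forall i, holds v (f i).
Proof.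
have E (r : seq I) : satisfies id v [seq f i | i <- r] <->
    forall i, i \in r -> holds v (f i).
  elim: r => [|i r IH] /=; first by split.
  rewrite IH; split=> [[h1 h2] j|h].
    by rewrite inE => /orP[/eqP -> //|]; apply: h2.
  by split=> [|j jr]; apply: h; rewrite inE ?eqxx ?jr ?orbT.
by rewrite E; split=> h i; [apply: h; rewrite mem_enum | move=> _; apply: h].
Qed.

Lemma satisfies_flatten (I : finType) v (F : I -> system A) :
  satisfies id v (flatten [seq F i | i <- enum I]) <->
  forall i, satisfies id v (F i).
Proof.
have E (r : seq I) : satisfies id v (flatten [seq F i | i <- r]) <->
    forall i, i \in r -> satisfies id v (F i).
  elim: r => [|i r IH] /=; first by split.
  rewrite satisfies_cat IH; split=> [[h1 h2] j|h].
    by rewrite inE => /orP[/eqP -> //|]; apply: h2.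
  by split=> [|j jr]; apply: h; rewrite inE ?eqxx ?jr ?orbT.
by rewrite E; split=> h i; [apply: h; rewrite mem_enum | move=> _; apply: h].
Qed.

Definition sum_term (I : finType) (F : I -> term A) : term A :=
  foldr (@TAdd A) (TCst 0) [seq F i | i <- enum I].

Lemma eval_sum_term (I : finType) v (F : I -> term A) :
  eval id v (sum_term F) = \sum_i eval id v (F i).
Proof.
rewrite /sum_term -big_enum /=; elim: (enum I) => [|i r IH] /=.
  by rewrite big_nil.
by rewrite big_cons IH.
Qed.

End SystemOf.

(** * Scalars and ideals as systems of equations *)

Section Interpretation.
Local Open Scope ring_scope.
Variables (A : naRing) (m : nat) (a : 'I_m -> A).
Hypothesis a_gen : forall x, exists c, x = comb a c.

Local Notation n := (m + m)%N.
Local Notation ext := {ffun 'I_n -> A}.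
Local Notation "x ** y" := (na_mul x y) (at level 40).

Variables (K : fieldExtType rat) (nu : ext -> K).
Hypothesis nuB :
  forall x y, scalar a x -> scalar a y -> nu (x - y) = nu x - nu y.
Hypothesis nuM : forall (I : finType) (x y : I -> ext) z,
  (forall k, scalar a (x k)) -> (forall k, scalar a (y k)) -> scalar a z ->
  (forall i j, \sum_k lpart (x k) i ** rpart (y k) j = lpart z i ** a j) ->
  nu z = \sum_k nu (x k) * nu (y k).

Definition block (v : nat -> A) (b : nat) : ext := [ffun k : 'I_n => v (b * n + k)%N].

Definition assign (B : nat -> ext) : nat -> A :=
  fun x => if insub (x %% n)%N is Some k then B (x %/ n)%N k else 0.

Lemma assign_at B b (k : 'I_n) : assign B (b * n + k)%N = B b k.
Proof.
have n_gt0 : (0 < n)%N by apply: leq_ltn_trans (ltn_ord k).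
rewrite /assign modnMDl divnMDl // modn_small // divn_small // addn0.
by rewrite valK.
Qed.

Lemma block_assign B : block (assign B) = B.
Proof. by apply/funext => b; apply/ffunP => k; rewrite ffunE assign_at. Qed.

Definition lvar b (i : 'I_m) : term A := TVar (b * n + lshift m i)%N.
Definition rvar b (i : 'I_m) : term A := TVar (b * n + rshift m i)%N.

Lemma eval_lvar v b i : eval id v (lvar b i) = lpart (block v b) i.
Proof. by rewrite /lpart ffunE. Qed.

Lemma eval_rvar v b i : eval id v (rvar b i) = rpart (block v b) i.
Proof. by rewrite /rpart ffunE. Qed.

(** Respecting all relations among the products is respecting generators of them, one equation for
    each. The integer coefficients are absorbed by the constants, since the multiplication is
    biadditive. *)
Lemma scalar_system : exists S : nat -> system A,
  forall v b, satisfies id v (S b) <-> scalar a (block v b).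
Proof.
have [|q [Q hQ]] := @subgroup_rV_fin_gen (m * m)%N (fun c => prods a (vec_mx c) = 0).
  split; first by rewrite linear0 /prods raddf0.
  by move=> x y hx hy; rewrite linearB prodsB hx hy subrr.
pose S1 b := [seq (TMul (lvar b ij.1) (TCst (a ij.2)),
                   TMul (TCst (a ij.1)) (rvar b ij.2)) | ij <- enum {: 'I_m * 'I_m}].
pose S2 b := [seq (sum_term (fun ij : 'I_m * 'I_m => TMul (lvar b ij.1)
    (TCst (a ij.2 *~ vec_mx (row l Q) ij.1 ij.2))), TCst (0 : A)) | l <- enum 'I_q].
exists (fun b => S1 b ++ S2 b) => v b; rewrite satisfies_cat !satisfies_enum.
have E1 : (forall ij : 'I_m * 'I_m, holds v (TMul (lvar b ij.1) (TCst (a ij.2)),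
      TMul (TCst (a ij.1)) (rvar b ij.2))) <->
    forall i j, lpart (block v b) i ** a j = a i ** rpart (block v b) j.
  by split=> h => [i j|[i j]]; [have := h (i, j) | have := h i j];
    rewrite /holds -?eval_lvar -?eval_rvar.
have E2 l : holds v (sum_term (fun ij : 'I_m * 'I_m => TMul (lvar b ij.1)
    (TCst (a ij.2 *~ vec_mx (row l Q) ij.1 ij.2))), TCst (0 : A)) <->
    lprods a (block v b) (vec_mx (row l Q)) = 0.
  have E ij : eval id v (TMul (lvar b ij.1)
      (TCst (a ij.2 *~ vec_mx (row l Q) ij.1 ij.2))) =
      (lpart (block v b) ij.1 ** a ij.2) *~ vec_mx (row l Q) ij.1 ij.2.
    rewrite -[LHS]/(eval id v (lvar b ij.1) ** _) eval_lvar.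
    have := na_mul_combr (fun _ : 'I_1 => a ij.2)
      (const_mx (vec_mx (row l Q) ij.1 ij.2)) (lpart (block v b) ij.1).
    by rewrite /comb !big_ord1 !mxE.
  rewrite /holds eval_sum_term /lprods /pairing pair_bigA.
  by rewrite (eq_bigr _ (fun ij _ => E ij)).
rewrite E1; split=> [[h1 h2]|[h1 h2]]; split=> //.
  move=> c hc; have /hQ[y hy] : prods a (vec_mx (mxvec c)) = 0 by rewrite mxvecK.
  rewrite -[c]mxvecK hy mulmx_comb (comb_morph (f := vec_mx)); last first.
    by move=> u w; rewrite linearB.
  rewrite (comb_morph (f := lprods a (block v b))); last first.
    by move=> u w; rewrite /lprods raddfB.
  by rewrite /comb big1 // => l _; have /E2 /= -> := h2 l; rewrite mul0rz.
move=> l; apply/E2/h2/hQ; exists (delta_mx 0 l); exact: rowE.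
Qed.

Section Ideal.
(* An ideal of the order [nu @` scalar]. *)
Variable q : set K.
Hypothesis q_subgroup : is_subgroup q.
Hypothesis q_ideal : forall x u, scalar a x -> q u -> q (nu x * u).

Definition in_ideal (x : ext) : Prop := scalar a x /\ q (nu x).

(** The [s k] generate the preimage of [q] as a group, so integral multiples of [scalar1] serve as
    the [t k]. Conversely, any scalars [t k] give an element of the ideal [q]. *)
Lemma ideal_generators : exists r (s : 'I_r -> ext),
  (forall k, scalar a (s k)) /\
  forall z, in_ideal z <-> scalar a z /\ exists t : 'I_r -> ext,
    (forall k, scalar a (t k)) /\
    forall i j, \sum_k lpart (t k) i ** rpart (s k) j = lpart z i ** a j.
Proof.
have sI : is_subgroup in_ideal.
  have [s0 sB] := scalar_subgroup a; split.
    have nu0 : nu 0 = 0 by have := nuB s0 s0; rewrite !subrr.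
    by split; rewrite ?nu0 //; case: q_subgroup.
  move=> x y [sx qx] [sy qy]; split; first exact: sB.
  by rewrite nuB //; apply: (proj2 q_subgroup).
have [r [s hs]] := subgroup_fin_gen (fin_gen_ffun n (a_fin_gen a_gen)) sI.
have ss k : in_ideal (s k).
  apply/hs; exists (delta_mx 0 k); rewrite /comb (bigD1 k) //= mxE !eqxx.
  by rewrite big1 ?addr0 // => j jk; rewrite mxE (negPf jk).
exists r, s; split=> [k|z]; first by case: (ss k).
split=> [Iz|[sz [t [st_ E]]]].
  split; first by case: Iz.
  have [c zc] := proj1 (hs z) Iz.
  exists (fun k => scalar1 a *~ c 0 k); split=> [k|i j].
    by apply: (is_subgroupMz _ (scalar_subgroup a)); apply: scalar1P.
  rewrite zc (comb_morph (f := fun x : ext => lpart x i)) => [|x y]; last first.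
    by rewrite /lpart !ffunE.
  rewrite na_mul_combl; apply: eq_bigr => k _; have [[hsk _] _] := ss k.
  rewrite /= hsk /lpart ffunMzE -/(lpart _ _) lpart1.
  have := na_mul_combl (fun _ : 'I_1 => a i) (const_mx (c 0 k)) (rpart (s k) j).
  by rewrite /comb !big_ord1 !mxE.
split=> //; rewrite (nuM st_ _ sz E) => [|k]; last by case: (ss k).
by apply: is_subgroup_sum => // k _; apply: q_ideal => //; case: (ss k).
Qed.

End Ideal.

Hypothesis nu_int : forall x, scalar a x -> nu x \in algint K.
Variable N : nat.
Hypothesis N_gt0 : (0 < N)%N.
Hypothesis nu_multiple : forall u, u \in algint K ->
  exists x, scalar a x /\ nu x = u *+ N.

Definition multiples : set K := fun u => exists2 o, o \in algint K & u = o *+ N.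
Definition zero_ideal : set K := fun u => u = 0.

Lemma multiples_subgroup : is_subgroup multiples.
Proof.
split; first by exists 0; rewrite ?rpred0 // mul0rn.
by move=> _ _ [x hx ->] [y hy ->]; exists (x - y); rewrite ?rpredB // mulrnBl.
Qed.

Lemma multiples_ideal x u : scalar a x -> multiples u -> multiples (nu x * u).
Proof.
move=> sx [o ho ->]; exists (nu x * o); last by rewrite mulrnAr.
by rewrite rpredM // nu_int.
Qed.

Lemma zero_subgroup : is_subgroup zero_ideal.
Proof. by split=> // _ _ -> ->; rewrite /zero_ideal subr0. Qed.

Lemma zero_ideal_ideal x u : scalar a x -> zero_ideal u -> zero_ideal (nu x * u).
Proof. by move=> _ ->; rewrite /zero_ideal mulr0. Qed.

Definition tuple_of (x : ext) : n.-tuple A := [tuple x k | k < n].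
Definition ext_of (t : n.-tuple A) : ext := [ffun k => tnth t k].

Lemma tuple_ofK x : ext_of (tuple_of x) = x.
Proof. by apply/ffunP => k; rewrite ffunE tnth_mktuple. Qed.

Lemma blkE v b : blk n v b = tuple_of (block v b).
Proof. by apply: eq_from_tnth => k; rewrite !tnth_mktuple ffunE. Qed.

(* Blocks [0, 1, 2] hold elements of [multiples], block [3] an element of the
   kernel of [nu], and the blocks [4 (k + 1) + z] the witnesses of block [z]. *)
Definition kind (z : nat) : set K := if z == 3 then zero_ideal else multiples.

Lemma kind_generators z : exists r (s : 'I_r -> ext),
  (forall k, scalar a (s k)) /\
  forall x, in_ideal (kind z) x <-> scalar a x /\ exists t : 'I_r -> ext,
    (forall k, scalar a (t k)) /\
    forall i j, \sum_k lpart (t k) i ** rpart (s k) j = lpart x i ** a j.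
Proof.
rewrite /kind; case: (z == 3); apply: ideal_generators.
- exact: zero_subgroup.
- exact: zero_ideal_ideal.
- exact: multiples_subgroup.
- exact: multiples_ideal.
Qed.

Lemma kind_system z : (z < 4)%N -> exists S : system A,
  (forall v, satisfies id v S -> in_ideal (kind z) (block v z)) /\
  (forall x, in_ideal (kind z) x -> exists t : nat -> ext, forall v,
    block v z = x -> (forall k, block v (4 * k.+1 + z)%N = t k) ->
    satisfies id v S).
Proof.
move=> z4; have [r [s [ss hs]]] := kind_generators z.
have [Ssc hSsc] := scalar_system.
pose w k := (4 * k.+1 + z)%N.
pose eqs := [seq (sum_term (fun k : 'I_r => TMul (lvar (w k) ij.1)
    (TCst (rpart (s k) ij.2))), TMul (lvar z ij.1) (TCst (a ij.2)))
  | ij <- enum {: 'I_m * 'I_m}].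
have eqsE v : satisfies id v eqs <-> forall i j,
    \sum_(k < r) lpart (block v (w k)) i ** rpart (s k) j = lpart (block v z) i ** a j.
  rewrite /eqs satisfies_enum.
  have E i j : holds v (sum_term (fun k : 'I_r => TMul (lvar (w k) i)
      (TCst (rpart (s k) j))), TMul (lvar z i) (TCst (a j))) <->
    \sum_(k < r) lpart (block v (w k)) i ** rpart (s k) j = lpart (block v z) i ** a j.
    rewrite /holds eval_sum_term -[eval id v (TMul (lvar z i) _)]/(eval id v (lvar z i) ** _) eval_lvar.
    rewrite (eq_bigr (fun k : 'I_r => lpart (block v (w k)) i ** rpart (s k) j)) // => k _.
    by rewrite -[LHS]/(eval id v (lvar (w k) i) ** _) eval_lvar.
  by split=> [h i j|h [i j]]; [exact/E/(h (i, j)) | exact/E].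
exists (Ssc z ++ flatten [seq Ssc (w k) | k : 'I_r <- enum 'I_r] ++ eqs).
split=> [v|x /hs[sx [t [st_ E]]]].
  move=> /satisfies_cat[/hSsc sz /satisfies_cat[/satisfies_flatten hw /eqsE he]].
  apply/hs; split=> //; exists (fun k => block v (w k)); split=> // k.
  exact/hSsc/hw.
exists (fun k => if insub k is Some k' then t k' else 0) => v vz vw.
have vwE (k : 'I_r) : block v (w k) = t k by rewrite /w vw valK.
apply/satisfies_cat; split; first by apply/hSsc; rewrite vz.
apply/satisfies_cat; split.
  by apply/satisfies_flatten => k; apply/hSsc; rewrite vwE.
apply/eqsE => i j; rewrite vz -E; apply: eq_bigr => k _.
by rewrite vwE.
Qed.

(** Common frame of the defining systems: the first [q] blocks are given, those from [q] to 3 are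
    existential, [zs] selects the blocks that must lie in their ideal, and [E] is the relation
    between the four. *)
Lemma block_specification q (zs : pred nat) (ES : system A)
    (E : ext -> ext -> ext -> ext -> Prop) (R : seq (n.-tuple A) -> Prop) :
  (q <= 4)%N ->
  (forall v, satisfies id v ES <->
     E (block v 0) (block v 1) (block v 2) (block v 3)) ->
  (forall B : nat -> ext, R [seq tuple_of (B b) | b <- iota 0 q] <->
     exists B' : nat -> ext, [/\ forall b, (b < q)%N -> B' b = B b,
       forall z, (z < 4)%N -> zs z -> in_ideal (kind z) (B' z)
       & E (B' 0%N) (B' 1%N) (B' 2%N) (B' 3%N)]) ->
  exists S, specifies q S R.
Proof.
move=> q4 hES hR.
have /choice[Sz hSz] (z : 'I_4) := kind_system (ltn_ord z).
pose S := flatten [seq (if zs z then Sz z else [::]) | z : 'I_4 <- enum 'I_4] ++ ES.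
exists S => v0; under eq_map do rewrite blkE.
rewrite hR; split=> [[B' [BB hB hE]]|[v [vv0 /satisfies_cat[/satisfies_flatten sz sE]]]]; last first.
  exists (block v); split=> [b bq|z z4 zz|]; last exact/hES.
    apply/ffunP => k; rewrite !ffunE vv0 //.
    apply: (@leq_trans (b.+1 * n)); last by rewrite leq_mul2r bq orbT.
    by rewrite mulSn addnC ltn_add2r.
  have := sz (Ordinal z4); rewrite /= zz.
  by have [h _] := hSz (Ordinal z4); apply: h.
have /choice[t ht] (z : 'I_4) : exists t : nat -> ext, zs z -> forall v,
    block v z = B' z -> (forall k, block v (4 * k.+1 + z)%N = t k) ->
    satisfies id v (Sz z).
  have [zz|] := boolP (zs z); last by exists (fun=> 0).
  have [_ /(_ (B' z) (hB z (ltn_ord z) zz))[t ht]] := hSz z.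
  by exists t.
(* Block [4 (k + 1) + z] has remainder [z] and quotient [k + 1], whence [.-1]. *)
pose B'' b := if (b < 4)%N then B' b else t (inord (b %% 4)) (b %/ 4).-1.
have B4 (z : 'I_4) : B'' z = B' z by rewrite /B'' ltn_ord.
exists (assign B''); split=> [x xq|].
  have n_gt0 : (0 < n)%N by case: (n) xq => //; rewrite muln0.
  have bq : (x %/ n < q)%N by rewrite ltn_divLR.
  have kn : (x %% n < n)%N by rewrite ltn_mod.
  rewrite {1 2}(divn_eq x n); have := assign_at B'' (x %/ n) (Ordinal kn).
  rewrite /= => ->; rewrite /B'' (leq_trans bq q4) BB // ffunE.
  by [].
apply/satisfies_cat; split; last first.
  apply/hES; rewrite block_assign.
  exact: hE.
apply/satisfies_flatten => z; case: ifP => // zz.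
apply: ht => // [|k]; rewrite block_assign ?B4 //.
have -> : B'' (4 * k.+1 + z)%N =
    t (inord ((4 * k.+1 + z) %% 4)) ((4 * k.+1 + z) %/ 4).-1.
  by rewrite /B'' ltnNge mulnS -addnA leq_addr.
by rewrite mulnC modnMDl divnMDl // modn_small // divn_small // addn0 inord_val.
Qed.

Lemma mulrn_N_inj (u v : K) : u *+ N = v *+ N -> u = v.
Proof.
move=> /eqP; rewrite -subr_eq0 -mulrnBl -scaler_nat scaler_eq0 pnatr_eq0.
by rewrite -leqn0 leqNgt N_gt0 subr_eq0 => /eqP.
Qed.

Lemma nuD x y : scalar a x -> scalar a y -> nu (x + y) = nu x + nu y.
Proof.
move=> sx sy; have [s0 sB] := scalar_subgroup a.
have nu0 : nu 0 = 0 by have := nuB s0 s0; rewrite !subrr.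
have sNy : scalar a (- y) by rewrite -sub0r; apply: sB.
by rewrite -{1}[y]opprK nuB // -[- y]sub0r nuB // nu0 sub0r opprK.
Qed.

Lemma nu_mul x y z : scalar a x -> scalar a y -> scalar a z ->
  (forall i j, lpart x i ** rpart y j = lpart z i ** a j) -> nu z = nu x * nu y.
Proof.
move=> sx sy sz E.
rewrite (nuM (I := 'I_1) (x := fun=> x) (y := fun=> y)) ?big_ord1 // => i j.
by rewrite big_ord1.
Qed.

Lemma scalarD x y : scalar a x -> scalar a y -> scalar a (x + y).
Proof. exact: (is_subgroupD (scalar_subgroup a)). Qed.

Lemma scalarMn x k : scalar a x -> scalar a (x *+ k).
Proof. exact: (is_subgroupMz k (scalar_subgroup a)). Qed.

Lemma nuMn x k : scalar a x -> nu (x *+ k) = nu x *+ k.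
Proof.
move=> sx; elim: k => [|k IH]; last by rewrite !mulrS nuD ?IH //; apply: scalarMn.
have [s0 _] := scalar_subgroup a.
by rewrite !mulr0n; have := nuB s0 s0; rewrite !subrr.
Qed.

Local Notation O := (naRing_of (ringOfIntegers K)).

Definition representatives : set (n.-tuple A) := fun t => in_ideal multiples (ext_of t).

Lemma quotient_exists : exists phi : n.-tuple A -> O,
  forall t, representatives t -> roi_val (phi t) *+ N = nu (ext_of t).
Proof.
suff /choice[phi hphi] : forall t, exists o : O, representatives t ->
    roi_val o *+ N = nu (ext_of t) by exists phi.
move=> t; have [[_ [o ho E]]|nt] := pselect (representatives t).
  by exists (RingOfIntegers ho).
by exists 0.
Qed.

Section Quotient.
Variable phi : n.-tuple A -> O.
Hypothesis phiE : forall t, representatives t -> roi_val (phi t) *+ N = nu (ext_of t).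

Lemma phi_surj b : exists2 x, representatives x & phi x = b.
Proof.
have [x [sx nux]] := nu_multiple (roi_valP b).
have Xx : representatives (tuple_of x).
  split; rewrite tuple_ofK //; exists (roi_val b) => //; exact: roi_valP.
exists (tuple_of x) => //; apply: val_inj => /=.
by apply: mulrn_N_inj; rewrite phiE // tuple_ofK.
Qed.

Lemma dom_specification : exists S, specifies 1 S (isX representatives).
Proof.
apply: (@block_specification 1 (pred1 0%N) [::] (fun _ _ _ _ => True)) => // B.
rewrite /= /representatives tuple_ofK; split=> [h|[B' [BB h _]]].
  by exists B; split=> // z _ /eqP ->.
by rewrite -BB //; apply: (h 0%N).
Qed.

Definition var_eqs (b : seq nat) (c : seq nat) : system A :=
  [seq (sum_term (fun i : 'I_(size b) => TVar (nth 0%N b i * n + k)%N),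
        sum_term (fun i : 'I_(size c) => TVar (nth 0%N c i * n + k)%N))
  | k : 'I_n <- enum 'I_n].

Lemma satisfies_var_eqs v b c : satisfies id v (var_eqs b c) <->
  \sum_(i < size b) block v (nth 0%N b i) = \sum_(i < size c) block v (nth 0%N c i).
Proof.
rewrite /var_eqs satisfies_enum.
have E (d : seq nat) (k : 'I_n) : eval id v
    (sum_term (fun i : 'I_(size d) => TVar (nth 0%N d i * n + k)%N)) =
    (\sum_(i < size d) block v (nth 0%N d i)) k.
  rewrite eval_sum_term sum_ffunE; apply: eq_bigr => i _.
  by rewrite ffunE.
split=> h; first by apply/ffunP => k; rewrite -!E; apply: h.
by move=> k; rewrite /holds !E h.
Qed.

(** Equality under [phi] is equality up to the kernel of [nu], so the witness in block 3 is the
    difference of the two representatives. *)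
Lemma eq_specification : exists S, specifies 2 S (isE representatives phi).
Proof.
apply: (@block_specification 2 (fun z => z != 2)%N (var_eqs [:: 0] [:: 1; 3])
  (fun x y _ q => x = y + q)) => // [v|B].
  by rewrite satisfies_var_eqs /= big_ord1 !big_ord_recl big_ord0 /= addr0.
have [s0 sB] := scalar_subgroup a.
rewrite /= /representatives !tuple_ofK; split=> [[X0 X1 E]|[B' [BB h E]]].
  have sx := proj1 X0; have sy := proj1 X1.
  exists (fun b => if b == 3 then B 0%N - B 1%N else B b).
  split=> [[|[|b]] //|[|[|[|[|z]]]] // _ _|] /=; last by rewrite addrC subrK.
  split; first exact: sB.
  rewrite /zero_ideal nuB // -[B 0%N]tuple_ofK -[B 1%N]tuple_ofK.
  by rewrite -!phiE ?E ?subrr //; rewrite /representatives tuple_ofK.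
have X0 := h 0%N isT isT; have X1 := h 1%N isT isT; have [sq q0] := h 3%N isT isT.
rewrite BB // in X0 E; rewrite BB // in X1 E; split=> //.
apply: val_inj; apply: mulrn_N_inj; rewrite !phiE /representatives ?tuple_ofK //.
by rewrite E nuD ?q0 ?addr0 //; case: X1.
Qed.

Lemma add_specification : exists S, specifies 3 S (isA representatives phi).
Proof.
apply: (@block_specification 3 xpredT (var_eqs [:: 0; 1] [:: 2; 3])
  (fun x y z q => x + y = z + q)) => // [v|B].
  by rewrite satisfies_var_eqs /= !big_ord_recl !big_ord0 /= !addr0.
have [s0 sB] := scalar_subgroup a.
rewrite /= /representatives !tuple_ofK; split=> [[X0 X1 X2 E]|[B' [BB h E]]].
  have sx := proj1 X0; have sy := proj1 X1; have sz := proj1 X2.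
  exists (fun b => if b == 3 then B 0%N + B 1%N - B 2%N else B b).
  split=> [[|[|[|b]]] //|[|[|[|[|z]]]] // _ _|] /=; last by rewrite [RHS]addrC subrK.
  split; first by apply: sB => //; apply: scalarD.
  rewrite /zero_ideal nuB ?nuD //; last exact: scalarD.
  rewrite -[B 0%N]tuple_ofK -[B 1%N]tuple_ofK -[B 2%N]tuple_ofK.
  rewrite -!phiE ?tuple_ofK -?E; rewrite /representatives ?tuple_ofK //.
  by rewrite -mulrnDl -mulrnBl -[_ - _]/(_ - roi_val (_ + _)) subrr mul0rn.
have X0 := h 0%N isT isT; have X1 := h 1%N isT isT.
have X2 := h 2%N isT isT; have [sq q0] := h 3%N isT isT.
rewrite (BB 0%N isT) in X0 E; rewrite (BB 1%N isT) in X1 E.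
rewrite (BB 2%N isT) in X2 E; split=> //.
apply: val_inj; apply: mulrn_N_inj.
rewrite [LHS]mulrnDl !phiE /representatives ?tuple_ofK //.
rewrite -nuD ?E ?nuD ?q0 ?addr0 //; [case: X2 | case: X0 | case: X1] => //.
Qed.

(** If [nu x = N o] and [nu y = N o'], then [nu x nu y = N (N o o')]: the representative of the
    product has to be multiplied by [N]. Block 3 absorbs the kernel. *)
Definition mul_eqs : system A :=
  [seq (TMul (lvar 0 ij.1) (rvar 1 ij.2),
        TAdd (TMul (lvar 2 ij.1) (TCst (a ij.2 *+ N)))
             (TMul (lvar 3 ij.1) (TCst (a ij.2)))) | ij <- enum {: 'I_m * 'I_m}].

Lemma na_mulrn (x y : A) k : x ** (y *+ k) = (x ** y) *+ k.
Proof.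
by elim: k => [|k IH]; rewrite ?mulr0n ?na_mulr0 // !mulrS na_mulDr IH.
Qed.

Lemma na_mulnl (x y : A) k : (x *+ k) ** y = (x ** y) *+ k.
Proof.
by elim: k => [|k IH]; rewrite ?mulr0n ?na_mul0 // !mulrS na_mulDl IH.
Qed.

Lemma mul_specification : exists S, specifies 3 S (isM representatives phi).
Proof.
apply: (@block_specification 3 xpredT mul_eqs (fun x y z q =>
  forall i j, lpart x i ** rpart y j = lpart (z *+ N + q) i ** a j)) => // [v|B].
  rewrite /mul_eqs satisfies_enum.
  have E i j : holds v (TMul (lvar 0 i) (rvar 1 j),
      TAdd (TMul (lvar 2 i) (TCst (a j *+ N))) (TMul (lvar 3 i) (TCst (a j)))) <->
      lpart (block v 0) i ** rpart (block v 1) j =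
      lpart (block v 2 *+ N + block v 3) i ** a j.
    rewrite /holds.
    have -> : eval id v (TMul (lvar 0 i) (rvar 1 j)) =
        eval id v (lvar 0 i) ** eval id v (rvar 1 j) by [].
    have -> : eval id v (TAdd (TMul (lvar 2 i) (TCst (a j *+ N)))
        (TMul (lvar 3 i) (TCst (a j)))) = (eval id v (lvar 2 i) ** (a j *+ N)) +
        (eval id v (lvar 3 i) ** a j) by [].
    rewrite !eval_lvar eval_rvar na_mulrn.
    have -> : lpart (block v 2 *+ N + block v 3) i =
        lpart (block v 2) i *+ N + lpart (block v 3) i.
      by rewrite /lpart ffunE ffunMnE.
    by rewrite na_mulDl na_mulnl.
  by split=> [h i j|h [i j]]; [exact/E/(h (i, j)) | exact/E].
have [s0 sB] := scalar_subgroup a.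
rewrite /= /representatives !tuple_ofK; split=> [[X0 X1 X2 E]|[B' [BB h E]]].
  have sx := proj1 X0; have sy := proj1 X1; have sz := proj1 X2.
  have sxy := scalar_mulP a_gen sx sy.
  exists (fun b => if b == 3 then scalar_mul a_gen (B 0%N) (B 1%N) - B 2%N *+ N
    else B b).
  split=> [[|[|[|b]]] //|[|[|[|[|z]]]] // _ _|] /=.
    split; first by apply: sB => //; apply: scalarMn.
    rewrite /zero_ideal nuB //; last exact: scalarMn.
    rewrite (nu_mul sx sy sxy) => [|i j]; last by rewrite scalar_mulE.
    rewrite nuMn // -[B 0%N]tuple_ofK -[B 1%N]tuple_ofK -[B 2%N]tuple_ofK.
    rewrite -!phiE ?tuple_ofK -?E; rewrite /representatives ?tuple_ofK //.
    by rewrite mulrnAl mulrnAr subrr.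
  by move=> i j; rewrite addrC subrK scalar_mulE.
have X0 := h 0%N isT isT; have X1 := h 1%N isT isT.
have X2 := h 2%N isT isT; have [sq q0] := h 3%N isT isT.
rewrite (BB 0%N isT) in X0 E; rewrite (BB 1%N isT) in X1 E.
rewrite (BB 2%N isT) in X2 E; split=> //.
have sx := proj1 X0; have sy := proj1 X1; have sz := proj1 X2.
apply: val_inj; apply: mulrn_N_inj; apply: mulrn_N_inj.
have := nu_mul sx sy (scalarD (scalarMn N sz) sq) E.
rewrite nuD ?nuMn ?q0 ?addr0 //; last exact: scalarMn.
rewrite -[B 0%N in RHS]tuple_ofK -[B 1%N in RHS]tuple_ofK -[B 2%N in LHS]tuple_ofK.
rewrite -!phiE; rewrite /representatives ?tuple_ofK // => ->.
by rewrite mulrnAl mulrnAr.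
Qed.

End Quotient.

End Interpretation.

(** * From systems over blocks to e-definable sets *)

Section EDefinable.
Local Open Scope ring_scope.
Variables (A : naRing) (n : nat).

Lemma specifies_definable q p (S : system A) R (X : set (p.-tuple A)) :
  p = (q * n)%N -> specifies q S R ->
  (forall w : p.-tuple A, X w <-> R [seq blk n (nth 0 w) b | b <- iota 0 q]) ->
  e_definable X.
Proof.
move=> pE hS hX; exists S => w; rewrite hX (hS (nth 0 w)).
split=> -[v [hv sv]]; exists v; split=> //.
  by move=> i; rewrite hv -?pE // (tnth_nth 0).
by move=> x; rewrite -pE => hx; have := hv (Ordinal hx); rewrite (tnth_nth 0).
Qed.

Lemma blk_cat p (x : n.-tuple A) (y : p.-tuple A) b :
  blk n (nth 0 [tuple of x ++ y]) b.+1 = blk n (nth 0 y) b.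
Proof.
apply: eq_from_tnth => k; rewrite !tnth_mktuple /= nth_cat size_tuple mulSn.
by rewrite -addnA ltnNge leq_addr /= addKn.
Qed.

Lemma blk_cat0 p (x : n.-tuple A) (y : p.-tuple A) :
  blk n (nth 0 [tuple of x ++ y]) 0 = x.
Proof.
apply: eq_from_tnth => k; rewrite !tnth_mktuple /= nth_cat size_tuple.
by rewrite ltn_ord (tnth_nth 0).
Qed.

Lemma blk0 (x : n.-tuple A) : blk n (nth 0 x) 0 = x.
Proof. by apply: eq_from_tnth => k; rewrite tnth_mktuple (tnth_nth 0). Qed.

Lemma split_tuple p (w : (n + p).-tuple A) :
  exists (x : n.-tuple A) (y : p.-tuple A), w = [tuple of x ++ y].
Proof.
have sx : size (take n w) == n by rewrite size_takel ?size_tuple ?leq_addr.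
have sy : size (drop n w) == p by rewrite size_drop size_tuple addKn.
exists (Tuple sx), (Tuple sy); apply: val_inj => /=; by rewrite cat_take_drop.
Qed.

Variables (B : naRing) (X : set (n.-tuple A)) (phi : n.-tuple A -> B).

Lemma definable1 S : specifies 1 S (isX X) -> e_definable X.
Proof.
move=> hS; apply: specifies_definable hS _ => [|w]; first by rewrite mul1n.
by rewrite /= blk0.
Qed.

Lemma definable2 S : specifies 2 S (isE X phi) ->
  e_definable [set w : (n + n).-tuple A | exists x y : n.-tuple A,
    [/\ X x, X y, w = [tuple of x ++ y] & phi x = phi y]]%classic.
Proof.
move=> hS; apply: specifies_definable hS _ => [|w]; first by rewrite mul2n addnn.
rewrite /=; split=> [[x [y [Xx Xy -> E]]]|].
  by rewrite blk_cat0 blk_cat blk0.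
have [x [y ->]] := split_tuple w; rewrite blk_cat0 blk_cat blk0 => -[Xx Xy E].
by exists x, y.
Qed.

Lemma definable3 S (op : B -> B -> B) R : specifies 3 S R ->
  (forall x y z, R [:: x; y; z] <->
     [/\ X x, X y, X z & op (phi x) (phi y) = phi z]) ->
  e_definable [set w : (n + (n + n)).-tuple A |
    exists x y z : n.-tuple A,
    [/\ X x, X y, X z, w = [tuple of x ++ (y ++ z)]
      & op (phi x) (phi y) = phi z]]%classic.
Proof.
move=> hS hR; apply: specifies_definable hS _ => [|w]; first by rewrite !mulSn addn0.
rewrite /=; split=> [[x [y [z [Xx Xy Xz -> E]]]]|].
  by rewrite blk_cat0 !blk_cat blk_cat0 blk0; apply/hR.
have [x [yz ->]] := split_tuple w; have [y [z ->]] := split_tuple yz.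
rewrite blk_cat0 !blk_cat blk_cat0 blk0 => /hR[Xx Xy Xz E].
by exists x, y, z.
Qed.

End EDefinable.

(** * Rings with infinite square *)

Section InfiniteSquare.
Local Open Scope ring_scope.

(** One [N] serves all integral [u] because the integers of [K] are finitely generated as a group:
    it is the product of the multipliers of the generators. *)
Lemma common_multiple (K : fieldExtType rat) (V : zmodType) (H : set V)
    (nu : V -> K) :
  is_subgroup H -> (forall x y, H x -> H y -> nu (x - y) = nu x - nu y) ->
  (forall u, exists2 N, (0 < N)%N & exists2 x, H x & nu x = u *+ N) ->
  exists2 N, (0 < N)%N &
    forall u, u \in algint K -> exists x, H x /\ nu x = u *+ N.
Proof.
move=> sH nuB hN; have [d [w /generatesE hw]] := ring_of_integers_fin_gen K.
have /choice[Nf hNf] (i : 'I_d) : exists N, (0 < N)%N /\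
    exists x, H x /\ nu x = roi_val (tnth w i) *+ N.
  by have [N N0 [x Hx E]] := hN (roi_val (tnth w i)); exists N; split=> //; exists x.
pose N := (\prod_i Nf i)%N; exists N; first by apply: prodn_gt0 => i; case: (hNf i).
have /choice[x hx] (i : 'I_d) : exists x, H x /\ nu x = roi_val (tnth w i) *+ N.
  have [_ [x [Hx E]]] := hNf i.
  exists (x *~ (\prod_(j < d | j != i) Nf j)%N); split.
    exact: is_subgroupMz.
  have := comb_morph_in (g := fun _ : 'I_1 => x)
    (const_mx (\prod_(j < d | j != i) Nf j)%N%:Z) sH nuB (fun=> Hx).
  rewrite /comb !big_ord1 !mxE => ->; rewrite /= E -!pmulrn -mulrnA /N.
  by rewrite [in RHS](bigD1 i).
move=> u hu; have [c Ec] := hw (RingOfIntegers hu).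
exists (comb x c); split; first by apply: is_subgroup_sum => // i _; apply: is_subgroupMz => //; case: (hx i).
rewrite (comb_morph_in _ sH nuB) => [|i]; last by case: (hx i).
have := congr1 (@roi_val K) Ec => /= ->.
rewrite (comb_morph (f := @roi_val K)) //.
rewrite /comb -sumrMnl; apply: eq_bigr => i _; have [_ /= ->] := hx i.
by rewrite !pmulrn -!mulrzA mulrC.
Qed.

Theorem infinite_square (A : naRing) : fin_gen A -> infinite_set (@square A) ->
  exists K : fieldExtType rat,
    let O := naRing_of (ringOfIntegers K) in
    [/\ e_interpretable O A, fin_gen O
      & forall (d : nat) (hs : d.-tuple O) (m : nat) (gs : m.-tuple A),
          generates hs -> generates gs ->
          karp_reducible (diophantine hs) (diophantine gs)].
Proof.
move=> [m [a0 /generatesE a_gen]] A2_inf.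
have [K [nu [nuB nuM nu_int nu_mult]]] := scalar_number_field a_gen A2_inf.
have [N N_gt0 hN] := common_multiple (scalar_subgroup (tnth a0)) nuB nu_mult.
exists K; set O := naRing_of _ => O'.
have [phi phiE] := quotient_exists (tnth a0) nu N.
have surj := phi_surj N_gt0 hN phiE.
have [SX hX] := dom_specification a_gen nuB nuM nu_int N.
have [SE hE] := eq_specification a_gen nuB nuM nu_int N_gt0 phiE.
have [SA hA] := add_specification a_gen nuB nuM nu_int N_gt0 phiE.
have [SM hM] := mul_specification a_gen nuB nuM nu_int N_gt0 phiE.
split; last 1 first.
- move=> d hs m' gs hs_gen gs_gen.
  (* A block must exceed the width [m + m] of a tuple and hold the variables of each of the four
     systems. *)
  pose Kb := (m + m + (system_bound SX + (system_bound SE +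
    (system_bound SA + system_bound SM)))).+1%N.
  have /choice[x hx] (i : 'I_d) : exists x, scalar (tnth a0) x /\
      nu x = roi_val (tnth hs i) *+ N by apply: hN; apply: roi_valP.
  pose xs i := tuple_of (x i).
  have Xxs c : representatives (tnth a0) nu N (cst_tuple xs c) /\
      phi (cst_tuple xs c) = int_comb hs c.
    have sS := scalar_subgroup (tnth a0).
    have hxs i : scalar (tnth a0) (x i) by case: (hx i).
    pose y := comb x (\row_i tnth c i).
    have sy : scalar (tnth a0) y.
      by apply: is_subgroup_sum => // i _; apply: is_subgroupMz.
    have yE : cst_tuple xs c = tuple_of y.
      apply: eq_from_tnth => k; rewrite !tnth_mktuple /y /comb sum_ffunE.
      by apply: eq_bigr => i _; rewrite tnth_mktuple ffunMzE mxE.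
    have nuy : nu y = roi_val (int_comb hs c) *+ N.
      rewrite (comb_morph_in _ sS nuB) // int_combE (comb_morph (f := @roi_val K)) //.
      rewrite /comb -sumrMnl; apply: eq_bigr => i _; have [_ /= ->] := hx i.
      by rewrite !pmulrn -!mulrzA mulrC.
    have Xy : representatives (tnth a0) nu N (tuple_of y).
      split; rewrite tuple_ofK //; exists (roi_val (int_comb hs c)) => //.
      exact: roi_valP.
    rewrite yE; split=> //; apply: val_inj => /=.
    by apply: (mulrn_N_inj N_gt0); rewrite phiE // tuple_ofK.
  have nKb : (m + m < Kb)%N by rewrite /Kb ltnS leq_addr.
  apply: (additive_interpretation_karp gs_gen nKb hX hE hA hM _ _ _ _ surj
    (fun c => proj1 (Xxs c)) (fun c => proj2 (Xxs c)));
    by rewrite /Kb; lia.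
- exists (m + m)%N, (representatives (tnth a0) nu N), phi; split=> //.
  + exact: definable1 hX.
  + exact: definable2 hE.
  + exact: definable3 hA _.
  + exact: definable3 hM _.
- exact: ring_of_integers_fin_gen.
Qed.

End InfiniteSquare.

(** * Systems over a ring with finite square *)

Section IntegerSystems.
Local Open Scope ring_scope.

Lemma det_bound r (M : 'M[int]_r) (b : nat) : (forall i j, (`|M i j| <= b%:Z)) ->
  `| \det M| <= (r`! * b ^ r)%N%:Z.
Proof.
move=> hM; rewrite /determinant; apply: le_trans (ler_norm_sum _ _ _) _.
apply: (@le_trans _ _ (\sum_(s : 'S_r) (b ^ r)%N%:Z)).
  apply: ler_sum => s _; rewrite normrM normrX normrN1 expr1n mul1r normr_prod.
  apply: (@le_trans _ _ (\prod_(i < r) b%:Z)).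
    by apply: ler_prod => i _; rewrite normr_ge0 hM.
  by rewrite prodr_const card_ord -!natz natrX.
by rewrite sumr_const card_Sn -mulr_natl natz PoszM.
Qed.

(** A cofactor is a minor of order [r - 1]; since [b > 0], its bound can be weakened to the one for
    order [r], so that a single expression occurs later. *)
Lemma adj_bound r (M : 'M[int]_r) (b : nat) i j : (0 < b)%N ->
  (forall i j, `|M i j| <= b%:Z) -> `|(\adj M) i j| <= (r`! * b ^ r)%N%:Z.
Proof.
move=> b_gt0 hM; rewrite mxE /cofactor normrM normrX normrN1 expr1n mul1r.
apply: le_trans (det_bound (b := b) _) _ => [k l|]; first by rewrite !mxE.
rewrite lez_nat leq_mul //; last by rewrite leq_pexp2l // leq_pred.
by case: (r) => // k; rewrite factS leq_pmull.
Qed.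

(* The rows [f] of [K] are a maximal independent family, and [delta] is a nonzero
   maximal minor of these rows. *)
Lemma int_matrix_rank p q (K : 'M[int]_(p, q)) (b : nat) :
  (0 < b)%N -> (forall i j, `|K i j| <= b%:Z) ->
  exists r (f : 'I_r -> 'I_p) (delta : int) (P : 'M[int]_(q, r))
    (R : 'M[int]_(p, r)),
  [/\ (r <= p)%N, delta != 0 /\ `|delta| <= (r`! * b ^ r)%N%:Z,
      rowsub f K *m P = delta%:M, delta *: K = R *m rowsub f K
    & forall i j, `|R i j| <= (r * b * (r`! * b ^ r))%N%:Z].
Proof.
move=> b_gt0 hK; pose KQ : 'M[rat]_(p, q) := map_mx intr K.
pose r := \rank KQ; pose f : 'I_r -> 'I_p := maxrankfun KQ.
have A1_full : row_full (rowsub f KQ)^T.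
  by rewrite /row_full mxrank_tr; have := maxrowsub_free KQ.
pose c := fullrankfun A1_full.
pose M : 'M[int]_r := mxsub f c K.
have hM i j : `|M i j| <= b%:Z by rewrite mxE.
have MQ : map_mx intr M = (rowsub c (rowsub f KQ)^T)^T :> 'M[rat]_r.
  by apply/matrixP => i j; rewrite !mxE.
have detM : \det M != 0.
  rewrite -(intr_eq0 rat) -det_map_mx MQ det_tr -unitfE -unitmxE.
  exact: fullrowsub_unit.
(* Cramer's rule: the adjugate of the chosen minor, placed in the columns [c], inverts the chosen
   rows up to [delta], and it also expresses the other rows through them. *)
exists r, f, (\det M), (colsub c 1%:M *m \adj M), (colsub c K *m \adj M).
split.
- exact: rank_leq_row.
- by split=> //; apply: det_bound.
- rewrite mulmxA mulmx_colsub mulmx1.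
  have -> : colsub c (rowsub f K) = M by apply/matrixP => i j; rewrite !mxE.
  by rewrite mul_mx_adj.
- have [X KX] : exists X, KQ = X *m rowsub f KQ.
    by apply/submxP; rewrite (eq_maxrowsub KQ).
  have intr_mx_inj : injective (map_mx (intr : int -> rat) : 'M_(p, q) -> _).
    by move=> U V /matrixP UV; apply/matrixP => i j; have := UV i j; rewrite !mxE => /intr_inj.
  apply: intr_mx_inj; rewrite map_mxZ !map_mxM /= -/KQ.
  have -> : map_mx intr (rowsub f K) = rowsub f KQ :> 'M[rat]_(r, q).
    by apply/matrixP => i j; rewrite !mxE.
  have -> : map_mx intr (colsub c K) = X *m map_mx intr M :> 'M[rat]_(p, r).
    have -> : map_mx intr (colsub c K) = colsub c KQ :> 'M[rat]_(p, r).
      by apply/matrixP => i j; rewrite !mxE.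
    rewrite {1}KX -mulmx_colsub; congr (_ *m _).
    by apply/matrixP => i j; rewrite !mxE.
  by rewrite map_mx_adj -(mulmxA X) mul_mx_adj mul_mx_scalar -scalemxAl -KX det_map_mx.
- move=> i j; rewrite mxE; apply: le_trans (ler_norm_sum _ _ _) _.
  apply: (@le_trans _ _ (\sum_(k < r) (b * (r`! * b ^ r))%N%:Z)).
    apply: ler_sum => k _; rewrite normrM PoszM.
    by rewrite ler_pM ?normr_ge0 ?adj_bound // mxE.
  by rewrite sumr_const card_ord -mulr_natl natz -PoszM mulnA.
Qed.

End IntegerSystems.

(** * Correction of solutions modulo an integer *)

Section FiniteSquare.
Local Open Scope ring_scope.
Variables (A : naRing) (n : nat) (g : 'I_n -> A) (d : 'I_n -> nat).
Hypothesis g_gen : forall x, exists c, x = comb g c.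
Hypothesis g_rel : forall c, comb g c = 0 <-> forall i, (d i %| c 0%R i)%Z.
Hypothesis A2_fin : finite_set (@square A).

Local Notation "x ** y" := (na_mul x y) (at level 40).
Local Notation pi_ j x := (gcoord g_gen x 0 j).

Lemma square_subgroup : is_subgroup (@square A).
Proof.
split=> [H [[H0 _] _] //|x y Ax Ay H CH].
by case: (CH) => -[_ HB] _; apply: HB; [apply: Ax | apply: Ay].
Qed.

Lemma square_mul x y : @square A (x ** y).
Proof. by apply: sub_gen_smallest; exists x, y. Qed.

Lemma free_coord0 j : d j = 0%N -> pi_ j (0 : A) = 0.
Proof.
by move=> dj; have := free_coordB g_gen g_rel 0 0 dj; rewrite !subrr.
Qed.

Lemma free_coordD j x y : d j = 0%N -> pi_ j (x + y) = pi_ j x + pi_ j y.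
Proof.
move=> dj; have fB := free_coordB g_gen g_rel.
by rewrite -{1}[y]opprK fB // -[- y]sub0r fB // free_coord0 // sub0r opprK.
Qed.

Lemma free_coordMn j x k : d j = 0%N -> pi_ j (x *+ k) = pi_ j x *+ k.
Proof.
move=> dj; elim: k => [|k IH]; first by rewrite !mulr0n free_coord0.
by rewrite !mulrS free_coordD // IH.
Qed.

(** A nonzero free coordinate would be unbounded on the multiples of [x], which all lie in the
    finite set [A ^ 2]. *)
Lemma square_torsion : (@square A `<=` torsion d g_gen)%classic.
Proof.
move=> x Ax j dj; apply: contrapT => pi0.
have [s sE] := proj1 (finite_seqP _) A2_fin.
pose b := (\max_(y <- s) `|pi_ j y|)%N.
have : (x *+ b.+1) \in s.
  have : @square A (x *+ b.+1) by apply: (is_subgroupMz b.+1 square_subgroup).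
  by rewrite sE.
move=> hs; have : (`|pi_ j (x *+ b.+1)| <= b)%N.
  by rewrite /b; apply: (@leq_bigmax_seq _ s xpredT (fun y => `|pi_ j y|%N)).
rewrite free_coordMn // -mulr_natr abszM natz absz_nat leqNgt => /negP; apply.
by apply: leq_pmull; rewrite absz_gt0; apply/eqP.
Qed.

(** Any common multiple of the finite orders will do; the product is the simplest. *)
Definition exponent : nat := (\prod_j (if d j == 0%N then 1%N else d j))%N.

Lemma exponent_gt0 : (0 < exponent)%N.
Proof. by apply: prodn_gt0 => j; case: eqP => // /eqP; rewrite lt0n. Qed.

Lemma torsion_exponent x : torsion d g_gen x -> x *+ exponent = 0.
Proof.
move=> tx; rewrite -[x](gcoordK g_gen).
have -> : comb g (gcoord g_gen x) *+ exponent =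
    comb g (\row_i (gcoord g_gen x 0 i *+ exponent)).
  rewrite /comb -sumrMnl; apply: eq_bigr => i _.
  by rewrite mxE -mulr_natr mulrzA natz.
apply/g_rel => i; rewrite mxE; have [di|di] := posnP (d i).
  by rewrite di tx // mul0rn.
rewrite -mulr_natr natz; apply: dvdz_mull; rewrite /exponent (bigD1 i) //=.
by rewrite gtn_eqF // PoszM; apply: dvdz_mulr; apply: dvdnn.
Qed.

Lemma mul_exponent (x y : A) : (x ** y) *+ exponent = 0.
Proof. by apply: torsion_exponent; apply: square_torsion; exact: square_mul. Qed.

Variables (C : Type) (val : C -> A).
Implicit Type t : term C.

Fixpoint occ t (i : nat) : nat :=
  match t with
  | TVar i' => (i' == i)
  | TAdd t1 t2 => (occ t1 i + occ t2 i)%N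
  | _ => 0%N
  end.

Fixpoint cst_coord j t : int :=
  match t with
  | TCst c => pi_ j (val c)
  | TAdd t1 t2 => cst_coord j t1 + cst_coord j t2
  | _ => 0
  end.

(* Shifting the variables by multiples of the exponent of [A ^ 2] changes no
   product, so that the system is affine in the shift. *)
Lemma eval_shift t v u q : (term_bound t <= q)%N ->
  eval val (fun i => v i + u i *+ exponent) t =
  eval val v t + (\sum_(i < q) u i *+ occ t i) *+ exponent.
Proof.
elim: t => [i|c|t1 IH1 t2 IH2|t1 IH1 t2 IH2] /= hq.
- rewrite (bigD1 (Ordinal hq)) //= eqxx big1 ?addr0 // => k.
  by rewrite -val_eqE eq_sym /= => /negPf ->.
- by rewrite big1 ?mul0rn ?addr0.
- move: hq; rewrite geq_max => /andP[/IH1 -> /IH2 ->].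
  rewrite addrACA -mulrnDl -big_split; congr (_ + _ *+ _).
  by apply: eq_bigr => i _; rewrite mulrnDr.
- rewrite [in RHS]big1 // mul0rn addr0.
  move: hq; rewrite geq_max => /andP[/IH1 -> /IH2 ->].
  rewrite na_mulDl !na_mulDr.
  have Mr (x y : A) : x ** (y *+ exponent) = 0 by rewrite na_mulrn mul_exponent.
  have Ml (x y : A) : (x *+ exponent) ** y = 0 by rewrite na_mulnl mul_exponent.
  by rewrite Mr Mr Ml !addr0.
Qed.

(** Products are torsion, hence invisible in a free coordinate, where every term is therefore affine
    in the variables. *)
Lemma coord_eval j t v q : d j = 0%N -> (term_bound t <= q)%N ->
  pi_ j (eval val v t) = cst_coord j t + \sum_(i < q) pi_ j (v i) *+ occ t i.
Proof.
move=> dj; elim: t => [i|c|t1 IH1 t2 IH2|t1 IH1 t2 IH2] /= hq.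
- rewrite add0r (bigD1 (Ordinal hq)) //= eqxx big1 ?addr0 // => k.
  by rewrite -val_eqE eq_sym /= => /negPf ->.
- by rewrite big1 ?addr0.
- move: hq; rewrite geq_max => /andP[/IH1 h1 /IH2 h2].
  rewrite free_coordD // h1 h2 addrACA -big_split; congr (_ + _).
  by apply: eq_bigr => i _; rewrite mulrnDr.
- rewrite big1 ?addr0 //; apply: square_torsion => //.
  exact: square_mul.
Qed.

Lemma free_coordMz j x (k : int) : d j = 0%N -> pi_ j (x *~ k) = pi_ j x * k.
Proof.
move=> dj; case: k => k; first by rewrite -pmulrn free_coordMn // -mulr_natr natz.
have fB := free_coordB g_gen g_rel.
rewrite NegzE mulrNz -pmulrn -sub0r fB // free_coord0 // free_coordMn //.
by rewrite sub0r mulrN -mulr_natr natz.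
Qed.

Lemma system_bound_nth (S : system C) x0 i : (i < size S)%N ->
  (maxn (term_bound (nth x0 S i).1) (term_bound (nth x0 S i).2) <=
   system_bound S)%N.
Proof.
elim: S i => //= e S IH [|i] hi; first exact: leq_maxl.
by apply: leq_trans (IH i hi) (leq_maxr _ _).
Qed.

Lemma satisfies_tnth v (S : system C) :
  (forall e, eval val v (tnth (in_tuple S) e).1 =
             eval val v (tnth (in_tuple S) e).2) <-> satisfies val v S.
Proof.
have E x0 : (forall i, (i < size S)%N ->
    eval val v (nth x0 S i).1 = eval val v (nth x0 S i).2) <-> satisfies val v S.
  elim: S => [|e S IH] /=; first by split.
  rewrite -IH; split=> [h|[h1 h2] [|i] hi //]; last exact: h2.
  by split=> [|i hi]; [apply: (h 0%N) | apply: (h i.+1)].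
case: S E => [|e0 S] E; first by split=> // _ [].
rewrite -(E e0); split=> h => [i hi|e].
  by have := h (Ordinal hi); rewrite !(tnth_nth e0).
by rewrite !(tnth_nth e0); apply: h.
Qed.

(** Adding [E u], with [u] given by the adjugate, makes the independent equations exact and gives
    any other equation a defect [z M2 E]. Its free coordinates, multiplied by [delta], are
    combinations of constants of the system and stay below [B], whereas [|M2| >= B]. So [z] is
    torsion, and [E] kills it. *)
Lemma solvable_of_modular (S : system C) v (b kmax B : nat) :
  (0 < b)%N ->
  (forall i e, (occ (tnth (in_tuple S) e).1 i <= b)%N /\
               (occ (tnth (in_tuple S) e).2 i <= b)%N) ->
  (forall j e, d j = 0%N -> `|cst_coord j (tnth (in_tuple S) e).1 -
     cst_coord j (tnth (in_tuple S) e).2| <= kmax%:Z) ->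
  (forall r, (r <= size S)%N ->
     (r`! * b ^ r * kmax + r * (r * b * (r`! * b ^ r) * kmax) < B)%N /\
     (r`! * b ^ r <= B)%N) ->
  (forall e, exists y, eval val v (tnth (in_tuple S) e).1 -
     eval val v (tnth (in_tuple S) e).2 = y *+ (exponent * (B`! * B))) ->
  solvable val S.
Proof.
move=> b_gt0 hocc hk hB /choice[y hy].
pose p := size S; pose q := system_bound S.
pose e1 (e : 'I_p) := (tnth (in_tuple S) e).1.
pose e2 (e : 'I_p) := (tnth (in_tuple S) e).2.
pose K : 'M[int]_(p, q) := \matrix_(e, i) ((occ (e1 e) i)%:Z - (occ (e2 e) i)%:Z).
have hK e i : `|K e i| <= b%:Z.
  by rewrite mxE; have [] := hocc i e; rewrite -/(e1 e) -/(e2 e); lia.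
have [r [f [delta [P [R [rp [delta0 hdelta] KP RK hR]]]]]] := int_matrix_rank b_gt0 hK.
have [hB1 hB2] := hB r rp.
have bound_e e : (term_bound (e1 e) <= q)%N /\ (term_bound (e2 e) <= q)%N.
  have := system_bound_nth (tnth (in_tuple S) e) (ltn_ord e).
  by rewrite -(tnth_nth _ (in_tuple S)) geq_max => /andP.
pose D w e := eval val w (e1 e) - eval val w (e2 e).
have D_shift u e : D (fun i => v i + u i *+ exponent) e =
    D v e + (\sum_(i < q) u i *~ K e i) *+ exponent.
  rewrite /D; have [b1 b2] := bound_e e; rewrite (eval_shift _ _ b1) (eval_shift _ _ b2).
  rewrite opprD addrACA -mulrnBl -sumrB; congr (_ + _ *+ _).
  by apply: eq_bigr => i _; rewrite mxE mulrzBr -!pmulrn.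
have D_coord j w e : d j = 0%N ->
    pi_ j (D w e) = cst_coord j (e1 e) - cst_coord j (e2 e) +
      \sum_(i < q) pi_ j (w i) * K e i.
  move=> dj; have [b1 b2] := bound_e e.
  rewrite /D (free_coordB g_gen g_rel) // (coord_eval _ dj b1) (coord_eval _ dj b2).
  rewrite opprD addrACA -sumrB; congr (_ + _).
  by apply: eq_bigr => i _; rewrite mxE mulrBr; congr (_ - _);
    rewrite -mulr_natr natz.
(* [delta] divides [B!] because [0 < |delta| <= B]; the further factor [B] makes the quotient [M2]
   at least [B] in absolute value. *)
have [M2 [hM2 M2B]] : exists M2 : int, delta * M2 = (B`! * B)%N /\ B%:Z <= `|M2|.
  have d_gt0 : (0 < `|delta|)%N by rewrite absz_gt0.
  have dB : (`|delta| <= B)%N by rewrite -lez_nat abszE (le_trans hdelta) // lez_nat.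
  have /dvdnP[k kE] : (`|delta| %| B`!)%N by apply: dvdn_fact; rewrite d_gt0.
  have k_gt0 : (0 < k)%N by have := fact_gt0 B; rewrite kE; case: (k).
  exists (Num.sg delta * (k * B)%N%:Z); split.
    rewrite mulrA [delta * _]mulrC -normrEsg -abszE -PoszM kE.
    by rewrite mulnA [(`|delta| * k)%N]mulnC.
  by rewrite normrM normr_sg delta0 mul1r -abszE lez_nat absz_nat leq_pmull.
pose u i := \sum_l y (f l) *~ - (P i l * M2).
have KuE e : \sum_(i < q) (if insub (i : nat) is Some i' then u i' else 0) *~ K e i =
    (- \sum_l y (f l) *~ (K *m P) e l) *~ M2.
  under eq_bigr do rewrite valK.
  rewrite -sumrN mulrz_suml /u; under eq_bigr do rewrite mulrz_suml.
  rewrite exchange_big; apply: eq_bigr => l _ /=.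
  rewrite mxE mulrz_sumr -sumrN mulrz_suml; apply: eq_bigr => i _.
  by rewrite -mulrzA mulNr mulrNz mulNrz -mulrzA; congr (- (_ *~ _)); ring.
pose w i := v i + (if insub i is Some i' then u i' else 0) *+ exponent.
have DwE e : D w e =
    (y e *~ delta - \sum_l y (f l) *~ (K *m P) e l) *~ M2 *+ exponent.
  rewrite D_shift KuE mulrzBl mulrnDl -mulNrz; congr (_ + _).
  by rewrite -mulrzA hM2 -pmulrn -mulrnA mulnC; apply: hy.
have Dw_f l : D w (f l) = 0.
  rewrite DwE; suff -> : \sum_k y (f k) *~ (K *m P) (f l) k = y (f l) *~ delta.
    by rewrite subrr mul0rz mul0rn.
  have KPE k : (K *m P) (f l) k = (delta%:M : 'M_r) l k.
    by rewrite -KP !mxE; apply: eq_bigr => i _; rewrite !mxE.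
  rewrite (bigD1 l) //= KPE mxE eqxx big1 ?addr0 // => k kl.
  by rewrite KPE mxE eq_sym (negPf kl).
exists w; suff hw e : D w e = 0.
  apply/satisfies_tnth => e; apply/eqP; rewrite -subr_eq0; apply/eqP.
  exact: hw.
rewrite DwE; set z := y e *~ delta - _.
suff tz : torsion d g_gen z.
  by rewrite pmulrn -mulrzA mulrC mulrzA -pmulrn torsion_exponent // mul0rz.
move=> j dj; apply: contrapT => pz0.
have := D_coord j w e dj; have ->: pi_ j (D w e) = pi_ j z * M2 * exponent%:Z.
  rewrite DwE free_coordMn // -mulr_natr natz; congr (_ * _).
  exact: free_coordMz.
set k1 := cst_coord _ _ - _ => Ez.
have Kd i : delta * K e i = \sum_l R e l * K (f l) i.
  have := congr1 (fun M : 'M_(p, q) => M e i) RK; rewrite !mxE => ->.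
  by apply: eq_bigr => l _; rewrite !mxE.
pose kf l := cst_coord j (e1 (f l)) - cst_coord j (e2 (f l)).
(* The dependence of row [e] on the rows [f l] eliminates the variables: the independent equations
   hold exactly, so only constants remain. *)
have Efin : delta * (pi_ j z * M2 * exponent%:Z) = delta * k1 - \sum_l R e l * kf l.
  rewrite Ez mulrDr mulr_sumr; congr (_ + _).
  under eq_bigr do rewrite mulrCA Kd mulr_sumr.
  rewrite exchange_big -sumrN; apply: eq_bigr => l _ /=.
  have := D_coord j w (f l) dj; rewrite Dw_f free_coord0 // => /esym/eqP.
  rewrite addr_eq0 -/(kf l) => /eqP ->; rewrite mulrN opprK mulr_sumr.
  by apply: eq_bigr => i _; rewrite mulrCA.
have : `|delta * (pi_ j z * M2 * exponent%:Z)| < B%:Z.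
  rewrite Efin; apply: le_lt_trans (ler_normB _ _) _.
  apply: (@le_lt_trans _ _ (r`! * b ^ r * kmax + r * (r * b * (r`! * b ^ r) * kmax))%N%:Z); last by rewrite ltz_nat.
  rewrite PoszD; apply: lerD.
    by rewrite normrM PoszM ler_pM // hk.
  apply: le_trans (ler_norm_sum _ _ _) _.
  apply: (@le_trans _ _ (\sum_(l < r) (r * b * (r`! * b ^ r) * kmax)%N%:Z)).
    by apply: ler_sum => l _; rewrite normrM PoszM ler_pM // hk.
  by rewrite sumr_const card_ord -mulr_natl natz -PoszM.
rewrite !normrM -!abszE; move: M2B; rewrite -abszE lez_nat => M2B.
have h1 : (0 < `|delta|)%N by rewrite absz_gt0.
have h2 : (0 < `|pi_ j z|)%N by rewrite absz_gt0; apply/eqP.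
have h3 := exponent_gt0.
rewrite -!PoszM ltz_nat ltnNge => /negP; apply; apply: leq_trans M2B _.
rewrite absz_nat; apply: leq_trans (leq_pmull _ h1).
by apply: leq_trans (leq_pmulr _ h3); apply: leq_pmull.
Qed.

End FiniteSquare.

(** * Programs searching for solutions modulo an integer *)

Section RecursiveFunctions.
Local Notation ncmp := (ncmp False).
Local Notation cmp := (cmp False).

Fixpoint natrec (h : nat -> nat -> nat) (b x : nat) : nat :=
  if x is x'.+1 then h x' (natrec h b x') else b.

(** With [B := False] there is no growth condition, so all of primitive recursion is available. *)
Lemma ncmp_natrec k F G (H : seq word -> nat -> nat -> nat) :
  ncmp k F -> ncmp k G ->
  ncmp k.+2 (fun e => H (take k e) (size (nth [::] e k)) (size (nth [::] e k.+1))) ->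
  ncmp k (fun e => natrec (H e) (G e) (F e)).
Proof.
move=> cF cG cH.
pose h (a : symbol) e (w acc : word) := unary (H e (size w) (size acc)).
apply: (@cmp_ext _ _ (fun e => wrec (fun a => h a e) (unary (G e)) (unary (F e)))).
  move=> e _; elim: (F e) => //= x ->.
  by rewrite /h !size_nseq.
by apply: (@cmp_wrec _ _ _ _ _ (fun=> 0)) => //; exact: polym_const.
Qed.

Lemma ncmp_nth k i : i < k -> ncmp k (fun e => size (nth [::] e i)).
Proof. by move=> ik; apply: ncmp_size; apply: cmp_nth. Qed.

Lemma ncmp_pred k F : ncmp k F -> ncmp k (fun e => (F e).-1).
Proof.
move=> cF; apply: (@ncmp_ext _ _ (fun e => natrec (fun i _ => i) 0 (F e))).
  by move=> e _; case: (F e).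
apply: (ncmp_natrec (H := fun _ i _ => i)) => //; first exact: ncmp_const.
exact: ncmp_nth.
Qed.

Lemma ncmp_sub k F G : ncmp k F -> ncmp k G -> ncmp k (fun e => F e - G e).
Proof.
move=> cF cG.
apply: (@ncmp_ext _ _ (fun e => natrec (fun _ acc => acc.-1) (F e) (G e))).
  by move=> e _; elim: (G e) => [|x IH] /=; rewrite ?subn0 // subnS IH.
apply: (ncmp_natrec (H := fun _ _ acc => acc.-1)) => //.
by apply: ncmp_pred; apply: ncmp_nth.
Qed.

Lemma ncmp_mul k F G : ncmp k F -> ncmp k G -> ncmp k (fun e => F e * G e).
Proof.
move=> cF cG; apply: (@ncmp_ext _ _ (fun e => natrec (fun _ acc => G e + acc) 0 (F e))).
  by move=> e _; elim: (F e) => //= x ->; rewrite mulSn.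
apply: (ncmp_natrec (H := fun e _ acc => G e + acc)) => //; first exact: ncmp_const.
by apply: ncmp_add; [exact: ncmp_take | exact: ncmp_nth].
Qed.

Lemma ncmp_exp k F G : ncmp k F -> ncmp k G -> ncmp k (fun e => F e ^ G e).
Proof.
move=> cF cG; apply: (@ncmp_ext _ _ (fun e => natrec (fun _ acc => F e * acc) 1 (G e))).
  by move=> e _; elim: (G e) => //= x ->; rewrite expnS.
apply: (ncmp_natrec (H := fun e _ acc => F e * acc)) => //; first exact: ncmp_const.
by apply: ncmp_mul; [exact: ncmp_take | exact: ncmp_nth].
Qed.

Lemma ncmp_succ k F : ncmp k F -> ncmp k (fun e => (F e).+1).
Proof. by move=> cF; apply: cmp_cons. Qed.

Lemma ncmp_fact k F : ncmp k F -> ncmp k (fun e => (F e)`!).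
Proof.
move=> cF; apply: (@ncmp_ext _ _ (fun e => natrec (fun i acc => i.+1 * acc) 1 (F e))).
  by move=> e _; elim: (F e) => //= x ->; rewrite factS.
apply: (ncmp_natrec (H := fun _ i acc => i.+1 * acc)) => //; first exact: ncmp_const.
by apply: ncmp_mul; [apply: ncmp_succ |]; exact: ncmp_nth.
Qed.

Lemma ncmp_if0 k F G H : ncmp k F -> ncmp k G -> ncmp k H ->
  ncmp k (fun e => if F e == 0 then G e else H e).
Proof.
move=> cF cG cH; apply: cmp_ext (cmp_if nonempty cF cH cG) => e _.
by case: (F e).
Qed.

(** A counter that is reset when it reaches the modulus. For modulus 0 it is never reset, in
    accordance with [x %% 0 = x]. *)
Lemma ncmp_mod k F G : ncmp k F -> ncmp k G -> ncmp k (fun e => F e %% G e).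
Proof.
move=> cF cG; pose h (e : seq word) (i acc : nat) :=
  if (acc.+1 - G e) + (G e - acc.+1) == 0 then 0 else acc.+1.
apply: (@ncmp_ext _ _ (fun e => natrec (h e) 0 (F e))).
  move=> e _; elim: (F e) => [|x /= ->]; first by rewrite mod0n.
  rewrite /h modnS; congr (if _ then _ else _); set d := G e.
  rewrite addn_eq0 !subn_eq0 -eqn_leq {2}(divn_eq x d) -addnS dvdn_addr ?dvdn_mull //.
  have [->|d_gt0] := posnP d; first by rewrite dvd0n.
  apply/eqP/idP => [->|/(dvdn_leq (ltn0Sn _))]; first by rewrite dvdnn.
  by have := ltn_pmod x d_gt0; lia.
apply: (ncmp_natrec (H := h)) => //; first exact: ncmp_const.
have c1 : ncmp k.+2 (fun e => (size (nth [::] e k.+1)).+1).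
  by apply: ncmp_succ; apply: ncmp_nth.
apply: ncmp_if0; [|exact: ncmp_const|exact: c1].
by apply: ncmp_add; apply: ncmp_sub => //; exact: ncmp_take.
Qed.

Lemma ncmp_div k F G : ncmp k F -> ncmp k G -> ncmp k (fun e => F e %/ G e).
Proof.
move=> cF cG; pose h (e : seq word) (i acc : nat) :=
  if i.+1 %% G e == 0 then acc.+1 else acc.
apply: (@ncmp_ext _ _ (fun e => natrec (h e) 0 (F e))).
  move=> e _; elim: (F e) => [|x /= ->]; first by rewrite div0n.
  rewrite /h; have [->|d_gt0] := posnP (G e); first by rewrite modn0 !divn0.
  by rewrite divnS // -/(G e %| x.+1); case: (G e %| x.+1).
apply: (ncmp_natrec (H := h)) => //; first exact: ncmp_const.
apply: ncmp_if0; last 2 first.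
- by apply: ncmp_succ; exact: ncmp_nth.
- exact: ncmp_nth.
by apply: ncmp_mod; [apply: ncmp_succ; exact: ncmp_nth | exact: ncmp_take].
Qed.

Lemma ncmp_sum (I : finType) k (F : I -> seq word -> nat) :
  (forall i, ncmp k (F i)) -> ncmp k (fun e => \sum_i F i e).
Proof.
move=> cF; suff H (r : seq I) : ncmp k (fun e => \sum_(i <- r) F i e).
  by apply: ncmp_ext (H (enum I)) => e _; rewrite big_enum.
elim: r => [|i r IH].
  by apply: ncmp_ext (ncmp_const _ _ 0) => e _; rewrite big_nil.
by apply: ncmp_ext (ncmp_add (cF i) IH) => e _; rewrite big_cons.
Qed.

End RecursiveFunctions.

Fixpoint bval (w : word) : nat :=
  if w is a :: w' then is_one a + 2 * bval w' else 0.

Lemma bval_encode_nat x : bval (encode_nat x) = x.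
Proof.
have H p : bval (encode_pos p) = nat_of_pos p.
  by elim: p => //= p ->; rewrite -?NatTrec.doubleE ?mul2n ?NatTrec.doubleE.
rewrite /encode_nat -{2}[x]bin_of_natK; case: (bin_of_nat x) => //= p.
Qed.

Lemma ncmp_bval k f : cmp False k f -> ncmp False k (fun e => bval (f e)).
Proof.
move=> cf.
pose h a (e : seq word) (w acc : word) := unary (is_one a + 2 * size acc).
apply: (@cmp_ext _ _ (fun e => wrec (fun a => h a e) [::] (f e))).
  by move=> e _; elim: (f e) => //= a w ->; rewrite /h size_nseq.
apply: (@cmp_wrec _ _ _ _ _ (fun=> 0)) => //; [exact: cmp_nil| |exact: polym_const].
move=> a; apply: ncmp_add; first exact: ncmp_const.
by apply: (ncmp_mull 2); apply: ncmp_nth.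
Qed.

(* Congruent to [z] modulo [M > 0], but not reduced. *)
Definition residue (M : nat) (z : int) : nat :=
  if (0 <= z)%R then `|z| else `|z| * M.-1.

Definition word_residue (M : nat) (w : word) : nat :=
  if is_sym SNeg (ohead w) then bval (take_while is_digit (behead w)) * M.-1
  else bval (take_while is_digit (behead w)).

Lemma word_residue_encode_int M z w : no_digit w ->
  word_residue M (encode_int z ++ w) = residue M z.
Proof.
move=> hw; rewrite /word_residue /residue /encode_int.
have E : take_while is_digit (encode_nat `|z| ++ w) = encode_nat `|z|.
  by rewrite take_while_cat ?encode_nat_digits.
by case: (0 <= z)%R => /=; rewrite E bval_encode_nat.
Qed.

Section Computation.
Local Notation ncmp := (ncmp False).
Local Notation cmp := (cmp False).

Lemma ncmp_residue k M z : ncmp k M -> ncmp k (fun e => residue (M e) z).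
Proof.
move=> cM; rewrite /residue; case: (0 <= z)%R; first exact: ncmp_const.
exact: (ncmp_mull _ (ncmp_pred cM)).
Qed.

Lemma ncmp_word_residue k M f : ncmp k M -> cmp k f ->
  ncmp k (fun e => word_residue (M e) (f e)).
Proof.
move=> cM cf; have cb := ncmp_bval (cmp_take_while is_digit (cmp_behead cf)).
apply: cmp_ext (cmp_if (is_sym SNeg) cf (ncmp_mul cb (ncmp_pred cM)) cb) => e _.
by rewrite /word_residue; case: ifP.
Qed.

Definition pushs (l : seq nat) (s : word) : word := foldr push s l.
Definition top_at (s : word) (i : nat) : nat := top (iter i pop s).

Lemma pop_pushs l s i : iter (size l + i) pop (pushs l s) = iter i pop s.
Proof. by elim: l => //= b l IH; rewrite -iterS iterSr pop_push. Qed.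

Lemma top_at_pushs l s i : top_at (pushs l s) i =
  if i < size l then nth 0 l i else top_at s (i - size l).
Proof.
elim: l i => [|b l IH] i; first by rewrite subn0.
case: i => [|i]; rewrite /top_at /=; first exact: top_push.
by rewrite -iterS iterSr pop_push ltnS subSS; exact: IH.
Qed.

Definition values n (F : 'I_n -> nat) : seq nat := [seq F j | j <- enum 'I_n].

Lemma size_values n (F : 'I_n -> nat) : size (values F) = n.
Proof. by rewrite size_map size_enum_ord. Qed.

Lemma top_at_values n (F : 'I_n -> nat) s (j : 'I_n) :
  top_at (pushs (values F) s) j = F j.
Proof.
by rewrite top_at_pushs size_values ltn_ord (nth_map j) ?size_enum_ord ?nth_ord_enum.
Qed.

Lemma top_at_values_add n (F : 'I_n -> nat) s i :
  top_at (pushs (values F) s) (n + i) = top_at s i.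
Proof. by rewrite top_at_pushs size_values ltnNge leq_addr addKn. Qed.

Lemma pop_values n (F : 'I_n -> nat) s i :
  iter (n + i) pop (pushs (values F) s) = iter i pop s.
Proof. by rewrite -{1}(size_values F) pop_pushs. Qed.

Lemma pop_values2 n (F G : 'I_n -> nat) s :
  iter (n + n) pop (pushs (values F) (pushs (values G) s)) = s.
Proof. by rewrite pop_values; have := pop_values G s 0; rewrite addn0. Qed.

Lemma cmp_pops k i f : cmp k f -> cmp k (fun e => iter i pop (f e)).
Proof. by move=> cf; elim: i => //= i IH; apply: cmp_pop. Qed.

Lemma ncmp_top_at k i f : cmp k f -> ncmp k (fun e => top_at (f e) i).
Proof. by move=> cf; apply: ncmp_top; apply: cmp_pops. Qed.

Lemma cmp_values n k (F : 'I_n -> seq word -> nat) f :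
  (forall j, ncmp k (F j)) -> cmp k f ->
  cmp k (fun e => pushs (values (F^~ e)) (f e)).
Proof.
move=> cF cf; rewrite /values; elim: (enum 'I_n) => //= j l IH.
exact: cmp_push.
Qed.

End Computation.

(** * Evaluation of systems on residues *)

Section ModularEvaluation.
Variables (n m : nat) (gam : 'I_m -> 'I_n -> int).
Variables (sig : 'I_n -> 'I_n -> 'I_n -> int) (d : 'I_n -> nat).

(** One number [kap], read in base [M], codes the residues of all coordinates of all variables, so
    the search runs over a single interval. *)
Definition digit (M kap i : nat) : nat := (kap %/ M ^ i) %% M.

Definition cst_value M (c : 'I_m -> nat) (j : 'I_n) : nat :=
  \sum_l c l * residue M (gam l j).

Definition mul_value M (x y : 'I_n -> nat) (j : 'I_n) : nat :=
  \sum_i \sum_i' residue M (sig i i' j) * (x i * y i').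

Fixpoint value M kap (t : term (m.-tuple int)) (j : 'I_n) : nat :=
  match t with
  | TVar i => digit M kap (n * i + j)
  | TCst c => cst_value M (fun l => residue M (tnth c l)) j
  | TAdd t1 t2 => value M kap t1 j + value M kap t2 j
  | TMul t1 t2 => mul_value M (value M kap t1) (value M kap t2) j
  end.

(** A coordinate of finite order is meaningful modulo [d j]; only free coordinates are weakened to
    congruences modulo [M]. *)
Definition modulus M j : nat := if d j == 0 then M else d j.

(** Truncated subtraction in both directions gives an absolute difference, so the defects of several
    equations add up without cancellation. *)
Definition defect M (x y : 'I_n -> nat) : nat :=
  \sum_j ((x j %% modulus M j - y j %% modulus M j) +
          (y j %% modulus M j - x j %% modulus M j)).

Lemma defect_eq0 M x y :
  defect M x y == 0 = [forall j, x j == y j %[mod modulus M j]].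
Proof.
rewrite /defect sum_nat_eq0; apply: eq_forallb => j /=.
by rewrite addn_eq0 !subn_eq0 -eqn_leq.
Qed.

(** The stack holds [n] coordinates for each pending term, above one bottom entry that sums the
    defects of the equations already read. *)
Definition value_step M kap a (w acc : word) : word :=
  let rest := iter (n + n) pop acc in
  match a with
  | SVar => pushs (values (fun j : 'I_n => digit M kap (n * top w + j))) acc
  | SCst => pushs (values
      (cst_value M (fun l => word_residue M (iter l int_tail w)))) acc
  | SAdd => pushs (values (fun j : 'I_n => top_at acc j + top_at acc (n + j))) rest
  | SMul => pushs (values (mul_value M (fun i => top_at acc i)
      (fun i => top_at acc (n + i)))) rest
  | SEqn => push (top rest + defect M (fun i => top_at acc i)
      (fun i => top_at acc (n + i))) (pop rest)
  | _ => acc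
  end.

Definition value_stack M kap : word -> word :=
  wrec (value_step M kap) (push 0 [::]).

Lemma value_stackE M kap a w :
  value_stack M kap (a :: w) = value_step M kap a w (value_stack M kap w).
Proof. by []. Qed.

Lemma value_stack_digits M kap u w : all is_digit u ->
  value_stack M kap (u ++ w) = value_stack M kap w.
Proof. by elim: u => //= a u IH /andP[ha /IH <-]; case: a ha. Qed.

Lemma value_stack_ints M kap (c : seq int) w :
  value_stack M kap (flatten (map encode_int c) ++ w) = value_stack M kap w.
Proof.
elim: c => // z c IH.
have -> : flatten (map encode_int (z :: c)) =
  encode_int z ++ flatten (map encode_int c) by [].
rewrite -catA /encode_int -IH; case: (0 <= z)%R;
  by rewrite cat_cons value_stackE /= value_stack_digits ?encode_nat_digits.
Qed.

Lemma eq_values (F G : 'I_n -> nat) : F =1 G -> values F = values G.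
Proof. by move=> FG; rewrite /values (eq_map FG). Qed.

Lemma value_stack_term M kap (t : term (m.-tuple int)) w : no_digit w ->
  value_stack M kap (encode_term t ++ w) =
  pushs (values (value M kap t)) (value_stack M kap w).
Proof.
elim: t w => [i|c|t1 IH1 t2 IH2|t1 IH1 t2 IH2] w hw;
  rewrite encode_term_cat value_stackE /value_step.
- by rewrite top_var // value_stack_digits // all_nseq orbT.
- rewrite value_stack_ints; congr pushs; apply: eq_values => j.
  apply: eq_bigr => l _; congr (_ * _).
  have hl : l < size c by rewrite size_tuple.
  rewrite int_tail_iter // 1?ltnW // (drop_nth (0%R : int)) //= -catA.
  by rewrite word_residue_encode_int ?no_digit_ints // -tnth_nth.
- rewrite IH1 ?no_digit_term // IH2 // pop_values2.
  congr pushs; apply: eq_values => j.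
  by rewrite top_at_values top_at_values_add top_at_values.
- rewrite IH1 ?no_digit_term // IH2 // pop_values2.
  congr pushs; apply: eq_values => j /=.
  apply: eq_bigr => i _; apply: eq_bigr => i' _.
  by rewrite top_at_values top_at_values_add top_at_values.
Qed.

Lemma value_stack_system M kap (S : system (m.-tuple int)) :
  value_stack M kap (encode_system S) =
  push (\sum_(e <- S) defect M (value M kap e.1) (value M kap e.2)) [::].
Proof.
elim: S => [|e S IH]; first by rewrite big_nil.
rewrite encode_system_cons value_stackE /value_step.
have hS : no_digit (encode_system S).
  by case: (S) => // e' S'; rewrite encode_system_cons.
rewrite value_stack_term ?no_digit_term // value_stack_term // IH.
rewrite pop_values2 pop_push top_push big_cons addnC; congr (push (_ + _) _).
apply: eq_bigr => j _.
by rewrite top_at_values top_at_values_add top_at_values.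
Qed.

Section Machine.
Local Notation ncmp := (ncmp False).
Local Notation cmp := (cmp False).

Lemma ncmp_digit k M K F : ncmp k M -> ncmp k K -> ncmp k F ->
  ncmp k (fun e => digit (M e) (K e) (F e)).
Proof. by move=> cM cK cF; apply: ncmp_mod => //; apply: ncmp_div => //; exact: ncmp_exp. Qed.

Lemma ncmp_defect k M X Y : ncmp k M -> (forall j, ncmp k (X j)) ->
  (forall j, ncmp k (Y j)) ->
  ncmp k (fun e => defect (M e) (X^~ e) (Y^~ e)).
Proof.
move=> cM cX cY; apply: (ncmp_sum (F := fun j e => _)) => j.
have cm : ncmp k (fun e => modulus (M e) j).
  by rewrite /modulus; case: (d j == 0) => //; exact: ncmp_const.
by apply: ncmp_add; apply: ncmp_sub; apply: ncmp_mod.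
Qed.

Lemma cmp_value_stack k M K f : ncmp k M -> ncmp k K -> cmp k f ->
  cmp k (fun e => value_stack (M e) (K e) (f e)).
Proof.
move=> cM cK cf.
apply: (@cmp_wrec _ _ _ _ (fun a e => value_step (M e) (K e) a) (fun=> 0)) => //;
  [exact: cmp_const| |exact: polym_const].
have cM' := ncmp_take cM; have cK' := ncmp_take cK.
have cw : cmp k.+2 (fun e => nth [::] e k) by apply: cmp_nth; lia.
have ca : cmp k.+2 (fun e => nth [::] e k.+1) by apply: cmp_nth; lia.
have ct i := ncmp_top_at i ca.
have cr := cmp_pops (n + n) ca.
case=> //=.
- apply: (cmp_values (F := fun l e => _)) ca => j; apply: (ncmp_sum (F := fun i e => _)) => l.
  apply: ncmp_mul; last exact: ncmp_residue.
  by apply: ncmp_word_residue => //; exact: cmp_int_tail.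
- apply: (cmp_values (F := fun l e => _)) ca => j; apply: ncmp_digit => //.
  apply: ncmp_add; last exact: ncmp_const.
  by apply: ncmp_mull; exact: ncmp_top.
- apply: (cmp_values (F := fun l e => _)) cr => j; exact: ncmp_add.
- apply: (cmp_values (F := fun l e => _)) cr => j; apply: (ncmp_sum (F := fun i e => _)) => i.
  apply: (ncmp_sum (F := fun i e => _)) => i'; apply: ncmp_mul; first exact: ncmp_residue.
  exact: ncmp_mul.
- apply: cmp_push; last exact: cmp_pop.
  by apply: ncmp_add; [exact: ncmp_top | exact: (ncmp_defect (X := fun i e => _))].
Qed.

End Machine.

End ModularEvaluation.

(** * Decidability *)

Section Residues.
Local Open Scope ring_scope.
Variable M : nat.
Local Notation "a ~ b" := (a = b %[mod M%:Z])%Z (at level 70).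

Lemma eqmodzD a a' b b' : a ~ a' -> b ~ b' -> a + b ~ a' + b'.
Proof. by move=> ha hb; rewrite -modzDm ha hb modzDm. Qed.

Lemma eqmodzM a a' b b' : a ~ a' -> b ~ b' -> a * b ~ a' * b'.
Proof. by move=> ha hb; rewrite -modzMm ha hb modzMm. Qed.

Lemma eqmodz_sum (I : finType) (F : I -> nat) (G : I -> int) :
  (forall i, (F i)%:Z ~ G i) -> (\sum_i F i)%N%:Z ~ \sum_i G i.
Proof.
move=> h; rewrite -[Posz _]natz natr_sum.
apply: (big_ind2 (fun a b => a ~ b)) => //; first by move=> a b a' b'; exact: eqmodzD.
by move=> i _; rewrite natz.
Qed.

Lemma residueE z : (0 < M)%N -> (residue M z)%:Z ~ z.
Proof.
move=> M_gt0; rewrite /residue; case: ifP => hz; first by rewrite gez0_abs.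
have -> : (`|z| * M.-1)%N%:Z = `|z|%N%:Z * M%:Z + z.
  by rewrite PoszM; have : z < 0 by [rewrite ltNge hz]; move: M_gt0; case: (M) => // M'; lia.
by rewrite modzMDl.
Qed.

Lemma digit_exists (x : nat -> int) L : (0 < M)%N -> exists2 kap, (kap < M ^ L)%N &
  forall i, (i < L)%N -> (digit M kap i)%:Z ~ x i.
Proof.
move=> M_gt0; elim: L x => [|L IH] x; first by exists 0%N.
have [kap hkap dkap] := IH (fun i => x i.+1).
have [r rM rE] : exists2 r, (r < M)%N & r%:Z ~ x 0%N.
  exists `|(x 0%N %% M%:Z)%Z|%N.
    by rewrite -ltz_nat gez0_abs ?modz_ge0 ?ltz_pmod //; case: (M) M_gt0.
  by rewrite gez0_abs ?modz_mod // modz_ge0 //; case: (M) M_gt0.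
exists (kap * M + r)%N; first by rewrite expnSr; nia.
case=> [|i] hi; rewrite /digit.
  by rewrite expn0 divn1 modnMDl modn_small.
rewrite expnS divnMA divnMDl // [(r %/ M)%N]divn_small // addn0.
exact: dkap.
Qed.

End Residues.

Lemma decidable_cmp (P : problem) (F : word -> nat) :
  ncmp False 1 (fun e => F (nth [::] e 0)) ->
  (forall x : instance P, positive x <-> F (encode x) = 0) -> decidable_problem P.
Proof.
move=> cF hF.
have [p [Q [_ hp]]] := cmp_if nonempty cF (cmp_const False 1 [:: SZero])
  (cmp_const False 1 [:: SOne]).
exists (Seq p (Seq (clear (0 + 0)) (move (0 + 1) (0 + 0) (0 + 2)))) => x.
pose b := F (encode x) == 0; exists b.
have := hp [:: encode x] erefl.
have -> : (if nonempty (ohead (unary (F (nth [::] [:: encode x] 0)))) then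
    [:: SZero] else [:: SOne]) = [:: if b then SOne else SZero].
  by rewrite /b /=; case: (F _).
move=> H1; set w := [:: if b then _ else _] in H1 *.
have H2 := @run_clear_st False 0 [::] [:: encode x; w] 0 erefl.
have H3 := @run_move_st False 0 [::] [:: [::]; w] 1 0 2 erefl erefl erefl erefl erefl.
have [t ht _] := run_seq H1 (run_seq H2 H3).
exists t; split; last by rewrite hF; split=> /eqP.
exists (st [:: w ++ [::]; [::]]); split; last by [].
move: ht; rewrite /=; congr exec.
by apply/funext => -[|[|i]].
Qed.

(** * Search for solutions modulo an explicit level *)

Section ModularSolvability.
Local Open Scope ring_scope.
Variables (A : naRing) (n : nat) (g : 'I_n -> A) (d : 'I_n -> nat).
Hypothesis g_gen : forall x, exists c, x = comb g c.
Hypothesis g_rel : forall c, comb g c = 0 <-> forall i, (d i %| c 0%R i)%Z.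
Hypothesis A2_fin : finite_set (@square A).
Variables (m : nat) (gs : m.-tuple A).
Local Notation "x ** y" := (na_mul x y) (at level 40).

Definition gen_coord (l : 'I_m) (j : 'I_n) : int := gcoord g_gen (tnth gs l) 0 j.
Definition mul_coord (i i' j : 'I_n) : int := gcoord g_gen (g i ** g i') 0 j.

(** Exact integer coordinates of the value of a term, as an intermediary: [comb] maps them to [A],
    and [value] is congruent to them modulo [M]. *)
Fixpoint coords (rho : nat -> 'rV[int]_n) (t : term (m.-tuple int)) : 'rV[int]_n :=
  match t with
  | TVar i => rho i
  | TCst c => (\row_l tnth c l) *m \matrix_(l, j) gen_coord l j
  | TAdd t1 t2 => coords rho t1 + coords rho t2
  | TMul t1 t2 => coords rho t1 *m
      \matrix_i (coords rho t2 *m \matrix_(i', j) mul_coord i i' j)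
  end.

Lemma comb_coords rho t :
  comb g (coords rho t) = eval (int_comb gs) (fun i => comb g (rho i)) t.
Proof.
elim: t => [i|c|t1 IH1 t2 IH2|t1 IH1 t2 IH2] //=.
- rewrite comb_mulmx int_combE; apply: eq_comb => l.
  rewrite -[RHS](gcoordK g_gen); congr comb.
  by apply/rowP => j; rewrite !mxE.
- by rewrite combD IH1 IH2.
- rewrite -IH1 -IH2 comb_mulmx na_mul_combl; apply: eq_comb => i.
  rewrite rowK comb_mulmx na_mul_combr; apply: eq_comb => i'.
  rewrite -[RHS](gcoordK g_gen); congr comb.
  by apply/rowP => j; rewrite !mxE.
Qed.

Section Modulus.
Variable M : nat.
Hypothesis M_gt0 : (0 < M)%N.
Hypothesis d_dvd_M : forall j, d j <> 0%N -> (d j %| M)%N.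

Local Notation "a ~ b" := (a = b %[mod M%:Z])%Z (at level 70).
Local Notation val_ := (value gen_coord mul_coord M).

Lemma value_coords kap (rho : nat -> 'rV[int]_n) t :
  (forall i, (i < term_bound t)%N -> forall j : 'I_n,
    (digit M kap (n * i + j))%:Z ~ rho i 0%R j) ->
  forall j, (val_ kap t j)%:Z ~ coords rho t 0%R j.
Proof.
elim: t => [i|c|t1 IH1 t2 IH2|t1 IH1 t2 IH2] /= hrho j.
- exact: hrho.
- rewrite mxE; apply: eqmodz_sum => l; rewrite PoszM !mxE.
  by apply: eqmodzM; exact: residueE.
- rewrite PoszD mxE; apply: eqmodzD; [apply: IH1 | apply: IH2] => i hi;
    by apply: hrho; rewrite leq_max hi ?orbT.
- rewrite mxE; apply: eqmodz_sum => i; rewrite mxE mxE mulr_sumr.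
  apply: eqmodz_sum => i'; rewrite mxE 2!PoszM mulrC -mulrA.
  have h1 : (val_ kap t1 i)%:Z ~ coords rho t1 0%R i.
    by apply: IH1 => k hk; apply: hrho; rewrite leq_max hk.
  have h2 : (val_ kap t2 i')%:Z ~ coords rho t2 0%R i'.
    by apply: IH2 => k hk; apply: hrho; rewrite leq_max hk orbT.
  by do ?[apply: eqmodzM => //]; exact: residueE.
Qed.

Lemma modulus_dvd j : (modulus d M j %| M)%N.
Proof. by rewrite /modulus; case: eqP => // /d_dvd_M. Qed.

Lemma defect_coords kap (rho : nat -> 'rV[int]_n) t1 t2 :
  (forall i, (i < maxn (term_bound t1) (term_bound t2))%N -> forall j : 'I_n,
    (digit M kap (n * i + j))%:Z ~ rho i 0%R j) ->
  defect d M (val_ kap t1) (val_ kap t2) = 0%N <->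
  forall j, ((modulus d M j)%:Z %| coords rho t1 0%R j - coords rho t2 0%R j)%Z.
Proof.
move=> hrho.
have h1 := @value_coords kap rho t1 (fun i hi => hrho i (leq_trans hi (leq_maxl _ _))).
have h2 := @value_coords kap rho t2 (fun i hi => hrho i (leq_trans hi (leq_maxr _ _))).
have E j : (val_ kap t1 j == val_ kap t2 j %[mod modulus d M j])%N =
    ((modulus d M j)%:Z %| coords rho t1 0%R j - coords rho t2 0%R j)%Z.
  rewrite -eqz_mod_dvd -eqz_nat -!modz_nat.
  have mm a b : a ~ b -> (a = b %[mod (modulus d M j)%:Z])%Z.
    move=> /eqP; rewrite eqz_mod_dvd => h; apply/eqP; rewrite eqz_mod_dvd.
    by move: h; rewrite !dvdzE; apply: dvdn_trans (modulus_dvd j).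
  by rewrite (mm _ _ (h1 j)) (mm _ _ (h2 j)).
rewrite (rwP eqP) defect_eq0; split=> [/forallP h j|h]; first by rewrite -E.
by apply/forallP => j; rewrite E.
Qed.

(** The coordinates of finite order contribute zero in [A], and the free ones can be divided by
    [M]. *)
Lemma comb_multiple (x : 'rV[int]_n) :
  (forall j, ((modulus d M j)%:Z %| x 0%R j)%Z) -> exists y, comb g x = y *+ M.
Proof.
move=> hx; pose w : 'rV[int]_n := \row_j if d j == 0%N then (x 0%R j %/ M%:Z)%Z else 0.
exists (comb g w).
have -> : comb g w *+ M = comb g (\row_j (w 0 j * M%:Z)).
  rewrite pmulrn /comb mulrz_suml; apply: eq_bigr => j _.
  by rewrite [in RHS]mxE mulrzA.
apply/(comb_eq g_rel) => j; have := hx j; rewrite !mxE /modulus; case: eqP => dj.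
  by move=> h; rewrite divzK // subrr dvdz0.
by rewrite mul0r subr0.
Qed.

End Modulus.

Lemma modulus_comb_eq M x y : comb g x = comb g y ->
  forall j, ((modulus d M j)%:Z %| x 0%R j - y 0%R j)%Z.
Proof.
move=> /(comb_eq g_rel) h j; have := h j; rewrite /modulus; case: eqP => // ->.
by rewrite dvd0z => /eqP ->; rewrite dvdz0.
Qed.

Lemma occ_size (t : term (m.-tuple int)) i : (occ t i <= size (encode_term t))%N.
Proof.
elim: t => [i'|c|t1 IH1 t2 IH2|t1 IH1 t2 IH2] //=; first by case: (i' == i).
by rewrite size_cat; lia.
Qed.

Lemma term_bound_size (t : term (m.-tuple int)) : (term_bound t <= size (encode_term t))%N.
Proof.
elim: t => [i|c|t1 IH1 t2 IH2|t1 IH1 t2 IH2] //=; first by rewrite size_nseq.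
all: by rewrite size_cat; lia.
Qed.

Lemma encode_pos_lt p : (nat_of_pos p < 2 ^ size (encode_pos p))%N.
Proof. by elim: p => //= p; rewrite ?NatTrec.doubleE expnS; lia. Qed.

Lemma encode_int_lt (z : int) : (`|z| < 2 ^ size (encode_int z))%N.
Proof.
rewrite /encode_int /encode_nat /= expnS -{1}[`|z|%N]bin_of_natK.
by case: (bin_of_nat _) => //= p; have := encode_pos_lt p; lia.
Qed.

Definition cst_bound : nat := (\sum_j \sum_l `|gen_coord l j|)%N.

(** Coefficients are written in binary, so they are at most exponential in the length of the term; a
    sum of two such bounds fits because the encoding of a sum is longer than its two parts. *)
Lemma cst_coord_le j t : d j = 0%N ->
  `|cst_coord g_gen (int_comb gs) j t| <= (cst_bound * 2 ^ size (encode_term t))%N%:Z.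
Proof.
move=> dj; elim: t => [i|c|t1 IH1 t2 IH2|t1 IH1 t2 IH2] //=.
- have -> : gcoord g_gen (int_comb gs c) 0 j = \sum_l gen_coord l j * tnth c l.
    rewrite /int_comb; apply: (big_rec2 (fun x y => gcoord g_gen x 0 j = y)) => [|l y x _ <-].
      exact: (free_coord0 g_gen g_rel).
    by rewrite (free_coordD g_gen g_rel) // (free_coordMz g_gen g_rel).
  have hc l : (`|tnth c l| < 2 ^ (size (flatten (map encode_int c))).+1)%N.
    apply: leq_trans (encode_int_lt _) _; rewrite leq_exp2l // ltnW // ltnS.
    rewrite size_flatten /shape -map_comp sumnE big_map.
    by rewrite big_tuple (bigD1 l) //= leq_addr.
  apply: le_trans (ler_norm_sum _ _ _) _.
  apply: (@le_trans _ _ (\sum_l (`|gen_coord l j| *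
      2 ^ (size (flatten (map encode_int c))).+1)%N%:Z)).
    apply: ler_sum => l _; rewrite normrM PoszM ler_pM // ?abszE //.
    by rewrite -abszE lez_nat ltnW.
  rewrite -(big_morph Posz PoszD erefl) lez_nat -big_distrl /=.
  by rewrite leq_mul2r /cst_bound (bigD1 j) //= leq_addr orbT.
- apply: le_trans (ler_normD _ _) _; apply: le_trans (lerD IH1 IH2) _.
  rewrite -PoszD lez_nat -mulnDr leq_mul2l size_cat expnS expnD; apply/orP; right.
  have h1 : (0 < 2 ^ size (encode_term t1))%N by rewrite expn_gt0.
  have h2 : (0 < 2 ^ size (encode_term t2))%N by rewrite expn_gt0.
  by nia.
Qed.

Lemma size_encode_equation (S : system (m.-tuple int)) (e : 'I_(size S)) :
  (size (encode_term (tnth (in_tuple S) e).1) +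
   size (encode_term (tnth (in_tuple S) e).2) < size (encode_system S))%N.
Proof.
have e0 := tnth (in_tuple S) e; rewrite !(tnth_nth e0).
rewrite [tval _]/=; move: (val e) (ltn_ord e) => i {e}.
elim: S i => // e1 S IH [|i] hi; rewrite encode_system_cons /= !size_cat.
  by lia.
by have := IH i hi; lia.
Qed.

Lemma size_system_le (S : system (m.-tuple int)) : (size S <= size (encode_system S))%N.
Proof. by elim: S => // e S IH; rewrite encode_system_cons /= !size_cat; lia. Qed.

Definition cst_limit (s : nat) : nat := (2 * cst_bound * 2 ^ s)%N.
(** With [F = s! (s + 1)^s] and [k = cst_limit s], this is [F + F k + s (s (s + 1) F k)]. It
    dominates the bounds of [solvable_of_modular] for every rank [r <= s] and entries up to [s + 1];
    the first summand makes the inequality strict. *)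
Definition cutoff (s : nat) : nat :=
  (s`! * s.+1 ^ s * (1 + cst_limit s * (1 + s * (s * s.+1))))%N.
Definition level (s : nat) : nat := (exponent d * ((cutoff s)`! * cutoff s))%N.

Lemma cutoff_gt0 s : (0 < cutoff s)%N.
Proof. by rewrite !muln_gt0 fact_gt0 expn_gt0. Qed.

Lemma level_gt0 s : (0 < level s)%N.
Proof. by rewrite muln_gt0 exponent_gt0 muln_gt0 fact_gt0 cutoff_gt0. Qed.

Lemma dvd_level s j : d j <> 0%N -> (d j %| level s)%N.
Proof.
move=> dj; apply: dvdn_mulr; rewrite /exponent (bigD1 j) //=.
by case: eqP => // _; apply: dvdn_mulr.
Qed.

Lemma minor_cutoff s r : (r <= s)%N ->
  (r`! * s.+1 ^ r * cst_limit s +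
   r * (r * s.+1 * (r`! * s.+1 ^ r) * cst_limit s) < cutoff s)%N /\
  (r`! * s.+1 ^ r <= cutoff s)%N.
Proof.
move=> rs; rewrite /cutoff; set k := cst_limit s; set F := (s`! * _)%N.
have F_gt0 : (0 < F)%N by rewrite muln_gt0 fact_gt0 expn_gt0.
have Fr : (r`! * s.+1 ^ r <= F)%N.
  by apply: leq_mul; [exact: leq_fact | exact: leq_pexp2l].
set G := (r`! * _)%N in Fr *; split; last first.
  by apply: leq_trans Fr _; rewrite leq_pmulr.
have h1 : (G * k <= F * k)%N by rewrite leq_mul2r Fr orbT.
have h2 : (r * (r * s.+1 * G * k) <= s * (s * s.+1 * F * k))%N.
  by do ?[apply: leq_mul => //].
have -> : (F * (1 + k * (1 + s * (s * s.+1))) = F + F * k + s * (s * s.+1 * F * k))%N.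
  by ring.
by lia.
Qed.

Definition total_defect (M kap : nat) (S : system (m.-tuple int)) : nat :=
  \sum_(e <- S) defect d M (value gen_coord mul_coord M kap e.1)
                           (value gen_coord mul_coord M kap e.2).

(** Indices of variables are written in unary, so they are below the length [s] of the input, and
    [n * s] digits cover every coordinate that matters. *)
Lemma solvable_search (S : system (m.-tuple int)) :
  let s := size (encode_system S) in
  solvable (int_comb gs) S <->
  exists2 kap, (kap < level s ^ (n * s))%N & total_defect (level s) kap S = 0%N.
Proof.
move=> s; set M := level s.
have M_gt0 : (0 < M)%N := level_gt0 s.
have dM := @dvd_level s; rewrite -/M in dM.
have hs (e : 'I_(size S)) := size_encode_equation e; rewrite -/s in hs.
have total0 kap : total_defect M kap S = 0%N <-> forall e : 'I_(size S),
    defect d M (value gen_coord mul_coord M kap (tnth (in_tuple S) e).1)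
               (value gen_coord mul_coord M kap (tnth (in_tuple S) e).2) = 0%N.
  rewrite /total_defect (big_tnth _ _ S); split=> [/eqP|h]; last exact: big1.
  by rewrite sum_nat_eq0 => /forallP h e; apply/eqP; exact: h.
split=> [[v hv]|[kap _ /total0 hkap]].
  pose x k := if insub (k %% n)%N is Some j then gcoord g_gen (v (k %/ n)%N) 0 j else 0.
  have [kap kapM hkap] := digit_exists x (n * s) M_gt0; exists kap => //.
  apply/total0 => e; apply/(defect_coords (rho := fun i => gcoord g_gen (v i)) M_gt0 dM).
    move=> i hi j; have n_gt0 : (0 < n)%N by apply: leq_trans (ltn_ord j).
    have i_lt : (i < s)%N.
      have h1 := term_bound_size (tnth (in_tuple S) e).1.
      have h2 := term_bound_size (tnth (in_tuple S) e).2.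
      by have := hs e; move: hi; lia.
    rewrite hkap; last by have := ltn_ord j; nia.
    rewrite /x mulnC modnMDl modn_small // divnMDl // divn_small // addn0.
    by rewrite valK.
  apply: modulus_comb_eq; rewrite !comb_coords.
  have hE (t : term (m.-tuple int)) : eval (int_comb gs) (fun i => comb g (gcoord g_gen (v i))) t =
      eval (int_comb gs) v t by apply: eval_ext => // i _; rewrite gcoordK.
  by rewrite !hE; exact: (proj2 (satisfies_tnth (int_comb gs) v S) hv e).
pose rho i : 'rV[int]_n := \row_j (digit M kap (n * i + j))%:Z.
apply: (@solvable_of_modular _ _ _ _ g_gen g_rel A2_fin _ _ S
  (fun i => comb g (rho i)) s.+1 (cst_limit s) (cutoff s)) => //.
- move=> i e; have h1 := occ_size (tnth (in_tuple S) e).1 i.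
  have h2 := occ_size (tnth (in_tuple S) e).2 i.
  by have := hs e; lia.
- move=> j e dj; apply: le_trans (ler_normB _ _) _.
  apply: le_trans (lerD (cst_coord_le _ dj) (cst_coord_le _ dj)) _.
  rewrite -PoszD lez_nat -mulnDr /cst_limit [(2 * _)%N]mulnC -mulnA leq_mul2l.
  apply/orP; right; rewrite mul2n -addnn; have := hs e.
  by move=> h; apply: leq_add; rewrite leq_exp2l //; lia.
- by move=> r hr; apply: minor_cutoff; apply: leq_trans hr (size_system_le S).
move=> e; rewrite -!comb_coords -combB; apply: comb_multiple => // j.
have := hkap e; rewrite (defect_coords (rho := rho) M_gt0 dM) => [h|i _ j'].
  by rewrite !mxE; exact: h.
by rewrite mxE.
Qed.

Lemma ncmp_level k F : ncmp False k F -> ncmp False k (fun e => level (F e)).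
Proof.
move=> cF; have cS := ncmp_succ cF.
have cL : ncmp False k (fun e => cst_limit (F e)).
  by apply: (ncmp_mull (2 * cst_bound)); apply: ncmp_exp => //; exact: ncmp_const.
have cC : ncmp False k (fun e => cutoff (F e)).
  apply: ncmp_mul; first by apply: ncmp_mul; [exact: ncmp_fact | exact: ncmp_exp].
  apply: (ncmp_add (ncmp_const _ _ 1)); apply: (ncmp_mul cL).
  apply: (ncmp_add (ncmp_const _ _ 1)); apply: (ncmp_mul cF).
  exact: ncmp_mul.
apply: (ncmp_mull (exponent d)); apply: ncmp_mul => //; exact: ncmp_fact.
Qed.

Lemma diophantine_decidable : decidable_problem (diophantine gs).
Proof.
pose test (x : word) kap :=
  top (value_stack gen_coord mul_coord d (level (size x)) kap x).
(* The value is 0 as soon as one [kap] passes the test; the initial 1 stands for failure. *)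
pose search x := natrec (fun kap acc => if test x kap == 0%N then 0%N else acc) 1
  (level (size x) ^ (n * size x)).
apply: (@decidable_cmp _ search) => [|S].
  have c0 : cmp False 1 (fun e => nth [::] e 0) by apply: cmp_nth.
  have cs := ncmp_size c0; have cM := ncmp_level cs.
  apply: (ncmp_natrec (H := fun e kap acc =>
    if test (nth [::] e 0) kap == 0%N then 0%N else acc)).
  - by apply: ncmp_exp => //; exact: ncmp_mull.
  - exact: ncmp_const.
  apply: ncmp_if0; [|exact: ncmp_const|exact: ncmp_nth].
  by apply: ncmp_top; apply: cmp_value_stack; [exact: (ncmp_take cM)|exact: ncmp_nth|exact: (cmp_take c0)].
have /= -> := solvable_search S; set w := encode_system S.
have testE kap : test w kap = total_defect (level (size w)) kap S.
  by rewrite /test value_stack_system top_push.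
rewrite /search; set L := (_ ^ _)%N; elim: L => [|L IH] /=; first by split=> // -[].
case: ifP => [/eqP t0|/negP t1]; first by split=> // _; exists L; rewrite // -testE.
rewrite -IH; split=> [[kap hk k0]|[kap hk k0]]; last by exists kap; rewrite // ltnW.
exists kap => //; move: hk; rewrite ltnS leq_eqVlt => /orP[/eqP kL|//].
by case: t1; rewrite testE -kL k0.
Qed.

End ModularSolvability.

Theorem finite_square (A : naRing) : fin_gen A -> finite_set (@square A) ->
  forall m (gs : m.-tuple A), generates gs -> decidable_problem (diophantine gs).
Proof.
move=> /fin_gen_structure[n [g [d [g_gen g_rel]]]] A2_fin m gs _.
exact: (diophantine_decidable g_gen g_rel A2_fin gs).
Qed.

Unset Implicit Arguments.

Theorem theorem1p1 (A : naRing) (hA : fin_gen A) :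
  (infinite_set (@square A) ->
    exists K : fieldExtType rat,
      let O := naRing_of (ringOfIntegers K) in
      [/\ e_interpretable O A,
          fin_gen O
        & forall (d : nat) (hs : d.-tuple O) (m : nat) (gs : m.-tuple A),
            generates hs -> generates gs ->
            karp_reducible (diophantine hs) (diophantine gs)]) /\
  (finite_set (@square A) ->
    forall (m : nat) (gs : m.-tuple A),
      generates gs -> decidable_problem (diophantine gs)).
Proof.
split; first exact: infinite_square.
exact: finite_square.
Qed.
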